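(* Let $(q_n)_{n\in\mathbb{N}}$ be a non-increasing sequence of positive real numbers such that $nq_{2n}\to0$ as $n\to\infty$, and let $\beta(n)=(nq_{2n})^{-3}$. Let $(p_i)_{i\in\mathbb{N}}$ be a sequence in $[0,1]$ and assume that: (i) for some $i_0\in\mathbb{N}$, $p_i\geq q_i$ for all $i\geq i_0$; (ii) for every $c>0$, $$\sum_{i=\lceil c\beta(n)\rceil}^{n/2} q_i\longrightarrow\infty\quad\text{as } n\to\infty .$$ Then for all $p\in(0,1)$ and $\varepsilon\in(0,1]$, there exists $K=K(\varepsilon,p,(p_i))\in\mathbb{N}$ such that $$\mathbb{P}^{K}_{p,\varepsilon}\left(W_0=\Xi\right)>0 .$$
   Context: Graph: the vertex set is $\mathbb{Z}^2$. Let $\mathcal{E}_V$ be the set of vertical edges $\{(x,y_1),(x,y_2)\}$ with $|y_1-y_2|=1$; for $i\in\mathbb{N}=\{1,2,\dots\}$ let $\mathcal{E}_{H,i}$ be the set of horizontal edges $\{(x_1,y),(x_2,y)\}$ with $|x_1-x_2|=i$. Put $\mathcal{E}=\mathcal{E}_V\cup\bigcup_{i\ge1}\mathcal{E}_{H,i}$. Measure: for $K\in\mathbb{N}$, $p\in(0,1)$, $\varepsilon\in(0,1]$ and a sequence $(p_i)$ in $[0,1]$, $\mathbb{P}^K_{p,\varepsilon}$ is the law of a pair $(\omega,\eta)\in\{0,1\}^{\mathcal{E}}\times\{0,1\}^{\mathbb{Z}^2}$ with all coordinates independent, where $\omega(e)=1$ ($e$ is open) with probability $\varepsilon$ if $e\in\mathcal{E}_V$,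 with probability $p_i$ if $e\in\mathcal{E}_{H,i}$ with $i\leq K$, and with probability $0$ if $e\in\mathcal{E}_{H,i}$ with $i>K$; and $\eta(v)=1$ with probability $p$, $\eta(v)=0$ with probability $1-p$, for each $v\in\mathbb{Z}^2$. Words: $\Xi=\{0,1\}^{\mathbb{N}}$; its elements $\xi=(\xi_1,\xi_2,\dots)$ are called words. A word $\xi$ is seen from $v\in\mathbb{Z}^2$ in $(\omega,\eta)$ if there is a sequence $v=v_0,v_1,v_2,\dots$ of pairwise distinct vertices of $\mathbb{Z}^2$ such that for all $i\geq1$: $\{v_{i-1},v_i\}\in\mathcal{E}$ has length at most $K$, $\omega(\{v_{i-1},v_i\})=1$, and $\eta(v_i)=\xi_i$ (the state of $v_0$ plays no role). $W_0$ denotes the (random) set of words seen from the origin $(0,0)$. Sums over $i$ up to $n/2$ run over integers $i\leq n/2$. *)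

(* Defs.v *)
From HB Require Import structures.
From mathcomp Require Import all_boot all_order all_algebra finmap.
From mathcomp Require Import all_classical all_reals all_analysis.

Set Implicit Arguments.
Unset Strict Implicit.
Unset Printing Implicit Defensive.

Import Order.TTheory GRing.Theory Num.Theory.
Import numFieldNormedType.Exports.

Local Open Scope classical_set_scope.
Local Open Scope ring_scope.

Definition beta (R : realType) (q : nat -> R) (n : nat) : R :=
  (n%:R * q (2 * n)%N) ^- 3.

Definition vertex : choiceType := (int * int)%type.

Definition vertical (e : {fset vertex}) : Prop :=
  exists x y1 y2 : int, `|y1 - y2| = 1 /\ e = [fset (x, y1); (x, y2)]%fset.

Definition horizontal (i : nat) (e : {fset vertex}) : Prop :=
  exists x1 x2 y : int,
    `|x1 - x2| = i%:Z /\ e = [fset (x1, y); (x2, y)]%fset.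

Definition is_edge (e : {fset vertex}) : Prop :=
  vertical e \/ exists2 i : nat, (1 <= i)%N & horizontal i e.

Definition edge : choiceType := {e : {fset vertex} | `[< is_edge e >]}.

(* Edges are axis-parallel, so the l1 distance between the endpoints is the
   length of the edge. *)
Definition dist1 (u v : vertex) : nat :=
  (`|u.1 - v.1|%N + `|u.2 - v.2|%N)%N.

(* A configuration is a pair (omega, eta), where true stands for 1. *)
Definition config := ((edge -> bool) * (vertex -> bool))%type.

Definition coord (s : edge + vertex) (c : config) : bool :=
  match s with inl e => c.1 e | inr v => c.2 v end.

Definition cylinders : set (set config) :=
  [set A | exists s b, A = [set c | coord s c = b]].

(* Configurations with the product sigma-algebra. *)
Definition configT := g_sigma_algebraType cylinders.

Definition independent_coords (R : realType) (P : probability configT R) :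
    Prop :=
  forall (S : {fset (edge + vertex)%type}) (b : edge + vertex -> bool),
    P [set c | forall s, s \in S -> coord s c = b s] =
    (\prod_(s <- S) P [set c | coord s c = b s])%E.

(* When p, eps and all p_ i (i >= 1) lie in [0, 1], exactly one probability
   measure P satisfies this: the product measure.  The value p_ 0 is unused. *)
Definition is_perc_law (R : realType) (K : nat) (p eps : R) (p_ : nat -> R)
    (P : probability configT R) : Prop :=
  [/\ independent_coords P,
      forall e : edge, vertical (val e) -> P [set c | c.1 e = true] = eps%:E,
      forall (i : nat) (e : edge), (1 <= i)%N -> horizontal i (val e) ->
        P [set c | c.1 e = true] = (if (i <= K)%N then p_ i else 0)%:E
    & forall v : vertex, P [set c | c.2 v = true] = p%:E].

(* Words are indexed from 0: the letter xi_i (i >= 1) of a word is xi i.-1. *)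
Definition word := nat -> bool.

Definition seen (K : nat) (c : config) (v : vertex) (xi : word) : Prop :=
  exists w : nat -> vertex,
    [/\ w 0%N = v, injective w &
        forall i : nat, exists e : edge,
          [/\ val e = [fset w i; w i.+1]%fset, (dist1 (w i) (w i.+1) <= K)%N,
              c.1 e = true & c.2 (w i.+1) = xi i]].

(* The set W_0 of words seen from the origin. *)
Definition words_seen (K : nat) (c : config) : set word :=
  [set xi | seen K c (0, 0) xi].

(* Main.v *)
Require Import Defs.
From mathcomp Require Import all_boot all_order all_algebra finmap.
From mathcomp Require Import all_classical all_reals all_analysis.
From mathcomp Require Import ring lra zify.

(** The lattice is cut into blocks.  Every line is divided into intervals of
    length n = g * N, themselves divided into g sub-blocks of length N, and
    K = 2 * n.  The block (k, y) is the interval number 2 * k - y of line y.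
    Its vertices are called roots.  A word that stands at a root goes on as
    follows: it explores a tree of edges inside the sub-block, makes one long
    jump to the interval number 2 * k - y + 1 or 2 * k - y - 1 of the same
    line, and climbs one vertical edge, which ends at a root of the block
    (k + 1, y + 1) or (k, y + 1).  A root is good at height h + 1 if every
    word, of the right length, can do this and arrive at a root that is good
    at height h; roots at height 0 are all good.  So goodness is defined from
    the top down, one line at a time.  A word that starts from a good root
    never meets itself, as it explores a line only once, and all of its
    letters are treated simultaneously: this is how uncountably many words
    are handled.

    Why roots are good.  Put s = 1 / (n * q (2 * n)), which tends to infinity.
    A set of A vertices is joined to a positive fraction of a neighbouring
    interval by about A / s open jumps.  The explored tree has depth L with
    h ^ L about s, every vertex has h ^ 3 explored neighbours and asks for
    h ^ 2 good ones in each state.  Thus each of the 2 ^ L words of length L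
    has at least h ^ (2 * L), about s ^ 2, endpoints, and the probability that
    one of them fails to jump is small ([jump_fail], [tree_good_fail]).  The
    exploration uses at most 2 * h ^ (3 * L) vertices, at most a constant c
    times s ^ 3 = beta n.  Since q is non-increasing, the divergence hypothesis
    says that a vertex keeps a large mean degree when those vertices and all
    shorter edges are discarded, hence fresh neighbours are found with high
    probability ([few_kids]), and a Galton-Watson recursion with a fixed
    failure probability 1 / 4 applies ([explore_boundP]).

    Why good roots persist.  A block is rich if its good roots, sorted by the
    states read on landing and on climbing, have positive density.  The g
    sub-blocks are independent given the lines above, so that a block with a
    rich child is rich except with a small probability ([rich_fail],
    [fail_prob]).  If a block is not rich, then a self-avoiding contour
    surrounds its zone of influence; at least a third of its steps cross
    distinct failing blocks ([contour_path], [contour_word_uniq]), and summing over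
    contours bounds the probability by 1 / 4 ([not_rich_prob]).  So the origin
    is good with probability at least 1 / 4, whatever the height
    ([good_prob]).

    Finally, by a compactness argument all words are seen as soon as all
    finite words are ([words_seenE]), and the probabilities of these
    decreasing events pass to the limit ([prob_words_seen]).

    Each event before the limit depends on finitely many coordinates, so the
    probabilistic part is carried out with a finite expectation, defined by
    recursion on a list of coordinates; [P_dep] links it to the given
    measure. *)

Set Implicit Arguments.
Unset Strict Implicit.
Unset Printing Implicit Defensive.

Import Order.TTheory GRing.Theory Num.Theory.
Import numFieldNormedType.Exports.

Local Open Scope classical_set_scope.
Local Open Scope ring_scope.

(** * Expectation over finitely many independent coordinates *)

Section Expectation.
Variables (R : realFieldType) (T : eqType) (w : T -> R).
Hypothesis w01 : forall c, 0 <= w c <= 1.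

Notation Om := (T -> bool).

Definition set_coord (om : Om) (c : T) (x : bool) : Om :=
  fun d => if d == c then x else om d.

(** Integrates out the coordinates in l and freezes the others at om. It is
    thus a conditional expectation, still a function of the configuration, and
    iterated conditioning is concatenation of lists ([expect_cat]). *)
Fixpoint expect (l : seq T) (f : Om -> R) (om : Om) : R :=
  if l is c :: l' then
    w c * expect l' f (set_coord om c true) + (1 - w c) * expect l' f (set_coord om c false)
  else f om.

Lemma expect_cons c l f om : expect (c :: l) f om =
  w c * expect l f (set_coord om c true) + (1 - w c) * expect l f (set_coord om c false).
Proof. by []. Qed.

Definition depends_on (A : Type) (f : Om -> A) (S : T -> bool) :=
  forall om om', (forall c, S c -> om c = om' c) -> f om = f om'.

Lemma w_ge0 c : 0 <= w c. Proof. by case/andP: (w01 c). Qed.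
Lemma w_le1 c : 0 <= 1 - w c. Proof. by case/andP: (w01 c); rewrite subr_ge0. Qed.

Lemma set_coordC om c d x y : c != d -> set_coord (set_coord om c x) d y = set_coord (set_coord om d y) c x.
Proof.
move=> ncd; apply: funext => e; rewrite /set_coord.
by case: eqP => // ->; case: eqP => // dc; rewrite dc eqxx in ncd.
Qed.

Lemma set_coord_set om c x y : set_coord (set_coord om c x) c y = set_coord om c y.
Proof. by apply: funext => e; rewrite /set_coord; case: eqP. Qed.

Lemma set_coord_other om c x d : d != c -> set_coord om c x d = om d.
Proof. by rewrite /set_coord => /negbTE->. Qed.

Lemma expect_ext l f g om : (forall om, f om = g om) -> expect l f om = expect l g om.
Proof. by move=> /funext->. Qed.

Lemma expect_cat l1 l2 f om : expect (l1 ++ l2) f om = expect l1 (expect l2 f) om.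
Proof. by elim: l1 om => //= c l1 IH om; rewrite !IH. Qed.

(** Lists need not be duplicate-free: a second occurrence of a coordinate
    overwrites the first. *)
Lemma expect_perm l1 l2 f : perm_eq l1 l2 -> expect l1 f =1 expect l2 f.
Proof.
elim: l1 l2 => [|c l1 IH] l2 /=.
  by rewrite perm_sym => /perm_nilP->.
move=> pl; have cl2 : c \in l2 by rewrite -(perm_mem pl) mem_head.
move: pl; case/splitPr: cl2 => p1 p2 pl.
have {pl} /IH {}IH : perm_eq l1 (p1 ++ p2).
  by rewrite -(perm_cons c); apply: (perm_trans pl); rewrite -cat1s perm_catCA.
move=> om.
have {}IH : expect l1 f = expect (p1 ++ p2) f by apply: funext.
rewrite IH {IH}.
elim: p1 om => [|d p1 IH] om //=.
have [cd|ncd] := eqVneq c d.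
  by rewrite -cd -!IH !set_coord_set; ring.
rewrite -!IH !(set_coordC _ _ _ ncd); ring.
Qed.

(** Only the configurations that agree with om off l are averaged, so
    quantities that depend on other coordinates can be replaced by their value
    at om. *)
Lemma expect_le_on l f g om :
  (forall om', (forall c, c \notin l -> om' c = om c) -> f om' <= g om') ->
  expect l f om <= expect l g om.
Proof.
elim: l om => [|c l IH] om /= fg; first exact: fg.
apply: lerD; apply: ler_wpM2l; rewrite ?w_ge0 ?w_le1 //; apply: IH => om' H;
  apply: fg => d; rewrite inE negb_or => /andP[dc dl];
  by rewrite H // set_coord_other.
Qed.

Lemma expect_le l f g om : (forall om, f om <= g om) -> expect l f om <= expect l g om.
Proof. by move=> fg; apply: expect_le_on. Qed.

Lemma expect_eq_on l f g om :
  (forall om', (forall c, c \notin l -> om' c = om c) -> f om' = g om') ->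
  expect l f om = expect l g om.
Proof.
by move=> fg; apply/eqP; rewrite eq_le !expect_le_on // => om' /fg->.
Qed.

Lemma expect_const l k om : expect l (fun=> k) om = k.
Proof. by elim: l om => //= c l IH om; rewrite !IH; ring. Qed.

Lemma expect_D l f g om : expect l (fun o => f o + g o) om = expect l f om + expect l g om.
Proof. by elim: l om => //= c l IH om; rewrite !IH; ring. Qed.

Lemma expect_Z l k f om : expect l (fun o => k * f o) om = k * expect l f om.
Proof. by elim: l om => //= c l IH om; rewrite !IH; ring. Qed.

Lemma expect_B l f g om : expect l (fun o => f o - g o) om = expect l f om - expect l g om.
Proof. by elim: l om => //= c l IH om; rewrite !IH; ring. Qed.

Lemma expect_sum l (I : Type) (s : seq I) (P : pred I) (F : I -> Om -> R) om :
  expect l (fun o => \sum_(i <- s | P i) F i o) om = \sum_(i <- s | P i) expect l (F i) om.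
Proof.
elim: s => [|i s IH].
  rewrite big_nil -[RHS](expect_const l 0 om); apply: expect_ext => o; by rewrite big_nil.
rewrite big_cons; case: ifP => Pi; rewrite -IH.
  by rewrite -expect_D; apply: expect_ext => o; rewrite big_cons Pi.
by apply: expect_ext => o; rewrite big_cons Pi.
Qed.

Lemma expect_ge0 l f om : (forall o, 0 <= f o) -> 0 <= expect l f om.
Proof. by move=> f0; rewrite -(expect_const l 0 om); apply: expect_le. Qed.

Lemma expect_le_const l f k om : (forall o, f o <= k) -> expect l f om <= k.
Proof. by move=> f0; rewrite -[leRHS](expect_const l k om); apply: expect_le. Qed.

(** Conditioning on the coordinates outside A, then averaging over those in A.
    *)
Lemma expect_split (A : pred T) l f om :
  expect l f om = expect (seq.filter (predC A) l) (expect (seq.filter A l) f) om.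
Proof.
rewrite -expect_cat; apply: expect_perm.
by rewrite perm_sym perm_catC; apply/permPl/perm_filterC.
Qed.

Lemma expect_out l f (S : pred T) om :
  depends_on f S -> (forall c, c \in l -> ~~ S c) -> expect l f om = f om.
Proof.
move=> df dis; rewrite -[RHS](expect_const l _ om); apply: expect_eq_on => om' H.
by apply: df => c Sc; apply: H; apply/negP => /dis; rewrite Sc.
Qed.

Lemma depends_set A (f : Om -> A) (S : pred T) om c x :
  depends_on f S -> ~~ S c -> f (set_coord om c x) = f om.
Proof.
move=> df Sc; apply: df => d Sd; apply: set_coord_other.
by apply: contraTneq Sd => ->.
Qed.

Lemma depends_sub A (f : Om -> A) (S S' : pred T) :
  depends_on f S -> (forall c, S c -> S' c) -> depends_on f S'.
Proof. by move=> df SS om om' H; apply: df => c /SS; apply: H. Qed.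

Lemma depends_comp A B (h : A -> B) (f : Om -> A) (S : pred T) :
  depends_on f S -> depends_on (fun o => h (f o)) S.
Proof. by move=> df om om' /df->. Qed.

Lemma depends_at (c : T) (S : pred T) : S c -> depends_on (fun o => o c) S.
Proof. by move=> Sc om om'; apply. Qed.

Lemma expect_dep l f (S : pred T) : depends_on f S -> depends_on (expect l f) (fun c => S c && (c \notin l)).
Proof.
move=> df; elim: l => [|c l IH] om om' H /=.
  by apply: df => c Sc; apply: H; rewrite Sc.
suff HH x : expect l f (set_coord om c x) = expect l f (set_coord om' c x) by rewrite !HH.
apply: IH => d /andP[Sd dl]; rewrite /set_coord; case: eqP => // /eqP dc.
by apply: H; rewrite Sd inE negb_or dc dl.
Qed.

(** Independence: at each integrated coordinate one of the two factors is
    constant. *)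
Lemma expect_indepM l f g (S1 S2 : pred T) om :
  depends_on f S1 -> depends_on g S2 -> (forall c, c \in l -> ~~ (S1 c && S2 c)) ->
  expect l (fun o => f o * g o) om = expect l f om * expect l g om.
Proof.
move=> df dg; elim: l om => [|c l IH] om //= dis.
have dis' : forall d, d \in l -> ~~ (S1 d && S2 d).
  by move=> d dl; apply: dis; rewrite inE dl orbT.
rewrite !IH //; have := dis c (mem_head _ _); rewrite negb_and => /orP[] nS.
  have He x : expect l f (set_coord om c x) = expect l f om.
    by apply: (@depends_set _ _ _ _ _ x (@expect_dep l f S1 df)); rewrite /= negb_and nS.
  by rewrite !He; ring.
have He x : expect l g (set_coord om c x) = expect l g om.
  by apply: (@depends_set _ _ _ _ _ x (@expect_dep l g S2 dg)); rewrite /= negb_and nS.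
by rewrite !He; ring.
Qed.

Lemma expect_at l c (phi : bool -> R) om : c \in l ->
  expect l (fun o => phi (o c)) om = w c * phi true + (1 - w c) * phi false.
Proof.
move=> cl; rewrite (expect_split (pred1 c)).
have : expect (seq.filter (pred1 c) l) (fun o => phi (o c))
   = fun=> w c * phi true + (1 - w c) * phi false.
  apply: funext => o.
  have : c \in seq.filter (pred1 c) l by rewrite mem_filter /= eqxx.
  have : all (pred1 c) (seq.filter (pred1 c) l) by apply: filter_all.
  elim: (seq.filter _ _) o => [|d s IH] o // /andP[/eqP-> als] _; rewrite expect_cons.
  case: s IH als => [|e s] IH als; first by rewrite /= /set_coord eqxx.
  have ce : c \in e :: s by move: als => /= /andP[/eqP-> _]; rewrite mem_head.
  rewrite !IH //; ring.
by move=> ->; rewrite expect_const.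
Qed.

Lemma expect_prod l (I : eqType) (s : seq I) (lab : I -> T) (phi : I -> bool -> R) om :
  uniq (map lab s) -> {subset map lab s <= l} ->
  expect l (fun o => \prod_(i <- s) phi i (o (lab i))) om =
  \prod_(i <- s) (w (lab i) * phi i true + (1 - w (lab i)) * phi i false).
Proof.
elim: s => [|i s IH] /=.
  move=> _ _; rewrite big_nil -[RHS](expect_const l _ om).
  by apply: expect_ext => o; rewrite big_nil.
move=> /andP[ns us] sub; rewrite big_cons -IH //; last first.
  by move=> c cs; apply: sub; rewrite inE cs orbT.
rewrite -(expect_at (l := l) (phi i) om); last by apply: sub; rewrite mem_head.
rewrite -(expect_indepM (S1 := pred1 (lab i)) (S2 := mem (map lab s))).
- by apply: expect_ext => o; rewrite big_cons.
- by apply: (depends_comp (phi i)); apply: depends_at => /=.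
- move=> o o' H; apply: eq_big_seq => j js; congr (phi j _); apply: H.
  by apply/mapP; exists j.
- by move=> c _; apply/negP => /andP[/eqP->]; apply/negP.
Qed.

(** The product is at most exp (- \sum x i), and exp (- t) <= 1 / (1 + t);
    this form avoids the exponential. *)
Lemma prod_le_inv (I : eqType) (s : seq I) (x : I -> R) :
  (forall i, i \in s -> 0 <= x i <= 1) ->
  \prod_(i <- s) (1 - x i) <= (1 + \sum_(i <- s) x i)^-1.
Proof.
elim: s => [|i s IH] H; first by rewrite !big_nil addr0 invr1.
have Hs j : j \in s -> 0 <= x j <= 1 by move=> js; apply: H; rewrite inE js orbT.
rewrite !big_cons; have /andP[x0 x1] := H i (mem_head _ _).
have S0 : 0 <= \sum_(j <- s) x j.
  by rewrite big_seq; apply: sumr_ge0 => j /Hs /andP[].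
apply: (@le_trans _ _ ((1 - x i) * (1 + \sum_(j <- s) x j)^-1)).
  by apply: ler_wpM2l (IH Hs); rewrite subr_ge0.
move: (\sum_(j <- s) x j) S0 => S S0.
rewrite ler_pdivrMr; last lra.
rewrite mulrC ler_pdivlMr; last lra.
nra.
Qed.

End Expectation.

Section Reveal.
Variables (R : realFieldType) (T : eqType) (w : T -> R).
Hypothesis w01 : forall c, 0 <= w c <= 1.

(** Revealing first the value of g, which is read in A, leaves the other
    coordinates untouched: once g is known, what follows may be bounded as if
    g were deterministic, provided that it does not read A again. *)
Lemma expect_reveal l (A : pred T) (C : Type) (g : (T -> bool) -> C)
    (F : C -> (T -> bool) -> R) (h : C -> R) om :
  depends_on g A -> (forall o, depends_on (F (g o)) (predC A)) ->
  (forall o o', expect w l (F (g o)) o' <= h (g o)) ->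
  expect w l (fun o => F (g o) o) om <= expect w l (fun o => h (g o)) om.
Proof.
move=> dg dF Fh; rewrite !(expect_split w (predC A) l).
apply: expect_le => // o; set lA' := seq.filter (predC A) l.
rewrite [leRHS](expect_out w01 (S := A)); last 2 first.
- exact: depends_comp dg.
- by move=> c; rewrite mem_filter => /andP[].
rewrite (@expect_eq_on _ _ _ w01 _ _ (F (g o))); last first.
  move=> o' H; congr (F _ _); apply: dg => c Ac; apply: H.
  by rewrite mem_filter /= Ac.
have <- : expect w [seq c <- l | A c] (F (g o)) = F (g o).
  apply: funext => o'; apply: (expect_out w01) (dF o) _ => // c.
  by rewrite mem_filter /= => /andP[->].
by rewrite -expect_split.
Qed.

End Reveal.

(** * Exploring a random graph by trees *)

Section Exploration.
Variables (T V : eqType) (B : seq V) (ed : V -> V -> T) (st : V -> T).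
Variables (M d : nat).
Notation Om := (T -> bool).

Definition avail (X : seq V) := [seq y <- B | y \notin X].

Definition kids z (X : seq V) (om : Om) :=
  take M [seq y <- B | (y \notin X) && om (ed z y)].

(** Explores the vertices of cs one after the other, each avoiding all that
    was used before. Returns the numbers of successful explorations that
    started from a vertex in state 1 and in state 0, and the final used set.
    *)
Fixpoint sweep (ex : V -> seq V -> Om -> bool * seq V) cs X om :
    (nat * nat) * seq V :=
  if cs is c :: cs' then
    let r1 := ex c X om in
    let r2 := sweep ex cs' r1.2 om in
    (((r1.1 && om (st c)) + r2.1.1, (r1.1 && ~~ om (st c)) + r2.1.2)%N, r2.2)
  else ((0, 0)%N, X).

(** Exploration to depth j from z. It succeeds if z has M fresh neighbours of
    which, in each of the two states, at least d have a successful exploration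
    to depth j - 1. The second component is the set of all used vertices; it
    bounds what was inspected, also after a failure. *)
Fixpoint explore j z X om : bool * seq V :=
  if j is j'.+1 then
    let cs := kids z X om in
    if (size cs < M)%N then (false, X) else
    let r := sweep (explore j') cs (cs ++ X) om in
    ((d <= r.1.1)%N && (d <= r.1.2)%N, r.2)
  else (true, X).

(** Bounds the number of vertices brought into use down to depth j, besides
    the starting point. *)
Fixpoint explore_cost j := if j is j'.+1 then (M + M * explore_cost j')%N else 0%N.

Lemma mem_avail X y : (y \in avail X) = (y \in B) && (y \notin X).
Proof. by rewrite mem_filter andbC. Qed.

Lemma kids_size z X om : (size (kids z X om) <= M)%N.
Proof. by rewrite size_take_min geq_minl. Qed.

Lemma kids_sub z X om : {subset kids z X om <= avail X}.
Proof.
by move=> y /mem_take; rewrite !mem_filter => /andP[/andP[-> _] ->].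
Qed.

Lemma kids_open z X om y : y \in kids z X om -> om (ed z y).
Proof. by move=> /mem_take; rewrite !mem_filter => /andP[/andP[_ ->]]. Qed.

Lemma kids_uniq z X om : uniq B -> uniq (kids z X om).
Proof. by move=> uB; apply: take_uniq; apply: filter_uniq. Qed.

Definition grows (X X' : seq V) k :=
  [/\ {subset X <= X'}, (size X' <= size X + k)%N
    & forall y, y \in X' -> y \notin X -> y \in B].

Lemma grows_refl X k : grows X X k.
Proof. by split=> //; rewrite ?leq_addr // => y ->. Qed.

Lemma grows_trans X1 X2 X3 k1 k2 :
  grows X1 X2 k1 -> grows X2 X3 k2 -> grows X1 X3 (k1 + k2).
Proof.
move=> [s1 n1 b1] [s2 n2 b2]; split.
- by move=> y /s1 /s2.
- by rewrite addnA; apply: leq_trans n2 _; rewrite leq_add2r.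
- move=> y y3 y1; have [y2|y2] := boolP (y \in X2); first exact: b1.
  exact: b2.
Qed.

Lemma sweep_grows ex k cs X om : (forall z X, grows X (ex z X om).2 k) ->
  grows X (sweep ex cs X om).2 (size cs * k).
Proof.
move=> Hex; elim: cs X => [|c cs IH] X /=; first exact: grows_refl.
exact: grows_trans (Hex c X) (IH _).
Qed.

Lemma kids_grows z X om : grows X (kids z X om ++ X) M.
Proof.
split.
- by move=> y yX; rewrite mem_cat yX orbT.
- by rewrite size_cat addnC leq_add2l kids_size.
- move=> y; rewrite mem_cat => /orP[|->//] /kids_sub.
  by rewrite mem_avail => /andP[].
Qed.

Lemma explore_grows j z X om : grows X (explore j z X om).2 (explore_cost j).
Proof.
elim: j z X => [|j IH] z X /=; first exact: grows_refl.
case: ltnP => sk /=; first exact: grows_refl.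
have -> : (M + M * explore_cost j = M + size (kids z X om) * explore_cost j)%N.
  by congr (_ + _ * _)%N; apply/eqP; rewrite eqn_leq sk kids_size.
exact: grows_trans (kids_grows z X om) (sweep_grows _ _ (IH)).
Qed.

Definition inner_coord X (c : T) :=
  has (fun a => c == st a) (avail X) ||
  has (fun a => has (fun b => (a != b) && (c == ed a b)) (avail X)) (avail X).
(** The coordinates that an exploration from the vertices of zs may inspect:
    edges from zs to unused vertices, then edges between unused vertices and
    their states. *)
Definition may_read zs X (c : T) :=
  has (fun z => has (fun y => c == ed z y) (avail X)) zs || inner_coord X c.

Lemma avail_sub X X' : {subset X <= X'} -> {subset avail X' <= avail X}.
Proof.
by move=> s y; rewrite !mem_avail => /andP[-> /=]; apply: contra; apply: s.
Qed.

Lemma inner_sub X X' c : {subset X <= X'} -> inner_coord X' c -> inner_coord X c.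
Proof.
move=> /avail_sub s /orP[/hasP[a /s aX e]|/hasP[a /s aX /hasP[b /s bX e]]].
  by apply/orP; left; apply/hasP; exists a.
by apply/orP; right; apply/hasP; exists a => //; apply/hasP; exists b.
Qed.

Lemma may_read_sub zs zs' X X' c : {subset X <= X'} -> {subset zs' <= zs} ->
  may_read zs' X' c -> may_read zs X c.
Proof.
move=> sX sz /orP[/hasP[z /sz zz /hasP[y /(avail_sub sX) yX e]]|ic].
  by apply/orP; left; apply/hasP; exists z => //; apply/hasP; exists y.
by apply/orP; right; apply: inner_sub ic.
Qed.

Lemma kids_dep z X : depends_on (kids z X) (fun c => has (fun y => c == ed z y) (avail X)).
Proof.
move=> o o' H; rewrite /kids; congr take; apply: eq_in_filter => y yB.
case yX: (y \in X) => //=; apply: H; apply/hasP; exists y => //.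
by rewrite mem_avail yB yX.
Qed.

Lemma sweep_dep ex cs X :
  (forall o z X, {subset X <= (ex z X o).2}) ->
  (forall z X, depends_on (ex z X) (may_read [:: z] X)) ->
  depends_on (sweep ex cs X) (fun c => may_read cs X c || (c \in map st cs)).
Proof.
move=> Hg Hex; elim: cs X => [|c cs IH] X o o' H //=.
have e1 : ex c X o = ex c X o'.
  apply: Hex => e re; apply: H; apply/orP; left.
  by apply: may_read_sub re => // y; rewrite !inE => ->.
have e2 : o (st c) = o' (st c) by apply: H; rewrite /= mem_head orbT.
rewrite e1 e2 (IH _ o o') // => e /orP[re|es]; apply: H.
  apply/orP; left; apply: may_read_sub re; first exact: Hg.
  by move=> y; rewrite inE => ->; rewrite orbT.
by rewrite /= inE es !orbT.
Qed.

Lemma explore_dep j z X : depends_on (explore j z X) (may_read [:: z] X).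
Proof.
elim: j z X => [|j IH] z X o o' H //=.
have ek : kids z X o = kids z X o'.
  by apply: kids_dep => c Hc; apply: H; rewrite /may_read /= Hc.
rewrite -ek; case: ifP => // _.
rewrite (@sweep_dep (explore j) _ _ _ _ o o') //; last first.
  move=> c Hc; apply: H; apply/orP; right.
  have subX : {subset X <= kids z X o ++ X} by case: (kids_grows z X o).
  case/orP: Hc => [/orP[/hasP[k kk /hasP[y yf /eqP->]]|ic]|/mapP[k kk ->]].
  - apply/orP; right; apply/hasP; exists k; first exact: kids_sub kk.
    apply/hasP; exists y; first exact: avail_sub yf.
    rewrite eqxx andbT; apply: contraTneq yf => <-.
    by rewrite mem_avail mem_cat kk andbF.
  - exact: inner_sub ic.
  - by apply/orP; left; apply/hasP; exists k => //; exact: kids_sub kk.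
by move=> o1 z1 X1; case: (explore_grows j z1 X1 o1).
Qed.

(** The coordinates that may have been inspected when X is the used set and
    the vertices of U, although used, have not yet been explored. Vertices of
    U have been reached, but neither their state nor their edges to unused
    vertices have been looked at. *)
Definition touched (X U : seq V) (c : T) :=
  has (fun a => (a \notin U) &&
        ((c == st a) || has (fun b => c == ed a b) B)) X
  || has (fun a => has (fun b => c == ed a b) X) X.

Lemma touched_sub X U X' U' c :
  {subset X <= X'} -> {subset U' <= U} -> touched X U c -> touched X' U' c.
Proof.
move=> sX sU /orP[/hasP[a aX /andP[aU e]]|/hasP[a aX /hasP[b bX e]]].
  apply/orP; left; apply/hasP; exists a; first exact: sX.
  by rewrite e andbT; apply: contra aU; apply: sU.
apply/orP; right; apply/hasP; exists a; first exact: sX.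
by apply/hasP; exists b => //; apply: sX.
Qed.

Hypothesis uB : uniq B.
Hypothesis ed_inj : forall a b c e, ed a b = ed c e ->
  (a = c /\ b = e) \/ (a = e /\ b = c).
Hypothesis st_inj : injective st.
Hypothesis st_ed : forall a b c, st a != ed b c.

Lemma inner_untouched X U c : inner_coord X c -> ~~ touched X U c.
Proof.
move=> ic; apply/negP => /orP[/hasP[a aX /andP[_ /orP[/eqP ec|]]]|].
- case/orP: ic => /hasP[b]; rewrite mem_avail ec => /andP[bB bX].
    by move=> /eqP/st_inj ab; rewrite ab (negbTE bX) in aX.
  by move=> /hasP[b' _ /andP[_]]; rewrite (negbTE (st_ed _ _ _)).
- move=> /hasP[a' aB' /eqP ec].
  case/orP: ic => /hasP[b]; rewrite mem_avail ec => /andP[bB bX].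
    by rewrite eq_sym (negbTE (st_ed _ _ _)).
  move=> /hasP[b']; rewrite mem_avail => /andP[_ bX'] /andP[_ /eqP/ed_inj[]] [ea eb].
    by rewrite ea (negbTE bX) in aX.
  by rewrite ea (negbTE bX') in aX.
- move=> /hasP[a aX /hasP[a' aX' /eqP ec]].
  case/orP: ic => /hasP[b]; rewrite mem_avail ec => /andP[bB bX].
    by rewrite eq_sym (negbTE (st_ed _ _ _)).
  move=> /hasP[b']; rewrite mem_avail => /andP[_ bX'] /andP[_ /eqP/ed_inj[]] [ea eb].
    by rewrite ea (negbTE bX) in aX.
  by rewrite ea (negbTE bX') in aX.
Qed.

(** An exploration that starts from pending vertices only reads fresh
    coordinates; this is what makes successive explorations behave as if they
    were independent. *)
Lemma may_read_untouched zs X U c : {subset zs <= X} -> {subset zs <= U} ->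
  may_read zs X c -> ~~ touched X U c.
Proof.
move=> zX zU /orP[/hasP[z zz /hasP[y]]|]; last exact: inner_untouched.
rewrite mem_avail => /andP[yB yX] /eqP->.
apply/negP => /orP[/hasP[a aX /andP[aU /orP[|/hasP[b bB]]]]|].
- by rewrite eq_sym (negbTE (st_ed _ _ _)).
- move=> /eqP/ed_inj[] [ez ey].
    by rewrite -ez zU in aU.
  by rewrite -ey (negbTE yX) in aX.
- move=> /hasP[a aX /hasP[b bX /eqP/ed_inj[]]] [ez ey].
    by rewrite -ey (negbTE yX) in bX.
  by rewrite -ey (negbTE yX) in aX.
Qed.

Lemma may_read_st zs X c : may_read zs X (st c) -> c \notin X.
Proof.
case/orP => [/hasP[z _ /hasP[y _]]|/orP[/hasP[b]|]].
- by rewrite (negbTE (st_ed _ _ _)).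
- by rewrite mem_avail => /andP[_ bX] /eqP/st_inj->.
- by move=> /hasP[b _ /hasP[b' _ /andP[_]]]; rewrite (negbTE (st_ed _ _ _)).
Qed.

Lemma touched_st X U c : c \in X -> c \notin U -> touched X U (st c).
Proof.
by move=> cX cU; apply/orP; left; apply/hasP; exists c => //; rewrite cU eqxx.
Qed.

Lemma untouched_st X (U : seq V) c : c \in U -> ~~ touched X U (st c).
Proof.
move=> cU; apply/negP => /orP[/hasP[a _ /andP[aU /orP[|/hasP[b _]]]]|].
- by move=> /eqP/st_inj ca; rewrite -ca cU in aU.
- by rewrite (negbTE (st_ed _ _ _)).
- by move=> /hasP[a _ /hasP[b _]]; rewrite (negbTE (st_ed _ _ _)).
Qed.

Lemma touched_ed X U z y : z \in X -> z \notin U -> y \in B ->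
  touched X U (ed z y).
Proof.
move=> zX zU yB; apply/orP; left; apply/hasP; exists z => //.
by rewrite zU /=; apply/orP; right; apply/hasP; exists y.
Qed.

Section Probability.
Variables (R : realFieldType) (w : T -> R) (L : seq T) (p : R) (bud : nat) (D : R).
Hypothesis w01 : forall c, 0 <= w c <= 1.
Hypothesis p01 : 0 <= p <= 1.
Hypothesis st_L : forall a, a \in B -> st a \in L /\ w (st a) = p.
Hypothesis ed_L : forall a b, a \in B -> b \in B -> a != b -> ed a b \in L.
(* Many neighbours remain in the mean, whatever set of bud vertices is
   excluded. *)
Hypothesis degB : forall z X, z \in B -> (size X <= bud)%N ->
  D <= \sum_(y <- avail X) w (ed z y).
Hypothesis D_large : (2 ^ (M + 4))%:R <= D.
Let tau1 : R := 1 - 3 / 8 * p.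
Let tau0 : R := 1 - 3 / 8 * (1 - p).
Hypothesis tau_small : 2 ^+ d * (tau1 ^+ M + tau0 ^+ M) <= 1 / 8.

Notation EL := (expect w L).
Definition untouched X U := predC (touched X U).

Lemma half_ge0 n : 0 <= (2 : R) ^- n.
Proof. by rewrite invr_ge0 exprn_ge0. Qed.

(** An exploration that is followed by some continuation Phi, which does not
    look at touched coordinates. If the continuation has mean at most a1 after
    a success and a0 after a failure, then the total is bounded as if the
    exploration failed with probability 1 / 4, independently of Phi. *)
Definition explore_bound j := forall z (X U : seq V) (Phi : bool -> seq V -> Om -> R) (a1 a0 : R),
  z \in B -> z \in X -> z \notin U -> {subset U <= X} ->
  (size X + explore_cost j <= bud)%N -> a1 <= a0 ->
  (forall b (X' : seq V), {subset X <= X'} -> (size X' <= size X + explore_cost j)%N ->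
     depends_on (Phi b X') (untouched X' U) /\
     forall o, EL (Phi b X') o <= if b then a1 else a0) ->
  forall o, EL (fun o => Phi (explore j z X o).1 (explore j z X o).2 o) o
            <= a1 + (a0 - a1) / 4.

(** Each explored vertex is in state 1 with probability p and succeeds with
    probability at least 3 / 4, so that every success of state 1 discounts the
    weight 2 ^- n1 by one half: the mean factor per vertex is tau1 = 1 - (3 /
    4) * p / 2. Same for the state 0. *)
Lemma sweep_bound j cs (X U : seq V) (Phi : nat -> nat -> seq V -> Om -> R) (a1 k1 k0 : R) :
  explore_bound j ->
  uniq cs -> {subset cs <= B} -> {subset cs <= X} ->
  (forall c, c \in cs -> c \notin U) -> {subset U <= X} ->
  (size X + size cs * explore_cost j <= bud)%N -> 0 <= k1 -> 0 <= k0 ->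
  (forall n1 n0 (X' : seq V), {subset X <= X'} -> (size X' <= size X + size cs * explore_cost j)%N ->
     depends_on (Phi n1 n0 X') (untouched X' U) /\
     forall o, EL (Phi n1 n0 X') o <= a1 + k1 * 2 ^- n1 + k0 * 2 ^- n0) ->
  forall o, EL (fun o => let r := sweep (explore j) cs X o in Phi r.1.1 r.1.2 r.2 o) o
            <= a1 + k1 * tau1 ^+ (size cs) + k0 * tau0 ^+ (size cs).
Proof.
move=> Hj; elim: cs X U Phi k1 k0 => [|c cs IH] X U Phi k1 k0.
  move=> _ _ _ _ _ _ _ _ H o /=; rewrite !expr0.
  have [|_ /(_ o)] := H 0%N 0%N X (fun _ => id); first by rewrite leq_addr.
  by rewrite expr0 invr1 !mulr1; apply: le_trans.
move=> /= /andP[ncs ucs] sB sX sU UX szX k1_0 k0_0 H o.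
have cB : c \in B by apply: sB; rewrite mem_head.
have cX : c \in X by apply: sX; rewrite mem_head.
have cU : c \notin U by apply: sU; rewrite mem_head.
have csB : {subset cs <= B} by move=> y yc; apply: sB; rewrite inE yc orbT.
have csX : {subset cs <= X} by move=> y yc; apply: sX; rewrite inE yc orbT.
have csU y : y \in cs -> y \notin U by move=> yc; apply: sU; rewrite inE yc orbT.
have [stL wst] := st_L cB.
have [p0 p1] := andP p01.
have t1_0 : 0 <= tau1 ^+ size cs by apply: exprn_ge0; rewrite /tau1; lra.
have t0_0 : 0 <= tau0 ^+ size cs by apply: exprn_ge0; rewrite /tau0; lra.
pose F (s : bool) (o : Om) :=
  let r1 := explore j c X o in let r2 := sweep (explore j) cs r1.2 o in
  Phi ((r1.1 && s) + r2.1.1)%N ((r1.1 && ~~ s) + r2.1.2)%N r2.2 o.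
pose h (s : bool) : R := a1 + k1 * tau1 ^+ size cs * (if s then 5 / 8 else 1)
  + k0 * tau0 ^+ size cs * (if s then 1 else 5 / 8).
have sweep_dep' X1 : depends_on (sweep (explore j) cs X1)
    (fun c0 => may_read cs X1 c0 || (c0 \in map st cs)).
  apply: sweep_dep; last by move=> *; exact: explore_dep.
  by move=> o1 z1 X2; case: (explore_grows j z1 X2 o1).
have grow2 X1 o1 : grows X1 (sweep (explore j) cs X1 o1).2 (size cs * explore_cost j).
  by apply: sweep_grows => *; exact: explore_grows.
suff : EL (fun o => F (o (st c)) o) o <= EL (fun o => h (o (st c))) o.
  move=> /le_trans; apply; rewrite (expect_at w h o stL) wst /h !exprS /tau1 /tau0.
  move: (tau1 ^+ _) (tau0 ^+ _) => A1 A0; lra.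
apply: (expect_reveal w01 (A := pred1 (st c)) (g := fun o => o (st c))).
- by apply: depends_at => /=.
- move=> o1 o2 o3 Ho; rewrite /F.
  have e1 : explore j c X o2 = explore j c X o3.
    apply: explore_dep => e re; apply: Ho; apply/negP => /eqP ee.
    by move: re; rewrite ee => /may_read_st; rewrite cX.
  set X1 := (explore j c X o3).2.
  have [sX1 zX1 _] : grows X X1 (explore_cost j) by exact: explore_grows.
  have e2 : sweep (explore j) cs X1 o2 = sweep (explore j) cs X1 o3.
    apply: sweep_dep' => e /orP[re|/mapP[y ycs ee]]; apply: Ho; apply/negP => /eqP.
      by move=> ee; move: re; rewrite ee => /may_read_st; rewrite sX1.
    by rewrite ee => /st_inj yc; rewrite yc (negbTE ncs) in ycs.
  rewrite e1 -/X1 e2; set r := sweep _ _ _ _.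
  have [sX2 zX2 _] : grows X1 r.2 (size cs * explore_cost j) by exact: grow2.
  apply: (proj1 (H _ _ r.2 _ _)).
  + by move=> y /sX1 /sX2.
  + by apply: leq_trans zX2 _; rewrite mulSn addnA leq_add2r.
  + move=> e /= te; apply: Ho; apply: contra te => /eqP->.
    by apply: touched_st => //; apply: sX2; apply: sX1.
- move=> o1 o2; set s := o1 (st c).
  (* The state s being known, the exploration of c is charged on the counter of
   s. *)
pose a (b : bool) : R := a1 + k1 * tau1 ^+ size cs * 2 ^- (b && s)
                 + k0 * tau0 ^+ size cs * 2 ^- (b && ~~ s).
  have u_0 : 0 <= k1 * tau1 ^+ size cs by apply: mulr_ge0.
  have v_0 : 0 <= k0 * tau0 ^+ size cs by apply: mulr_ge0.
  have -> : h s = a true + (a false - a true) / 4.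
    rewrite /h /a; move: (k1 * _) (k0 * _) => u v.
    by case: (s); rewrite /= !expr0 !expr1 invr1; lra.
  rewrite /F; apply: (Hj c X (cs ++ U) (fun b X1 o =>
    let r2 := sweep (explore j) cs X1 o in
    Phi ((b && s) + r2.1.1)%N ((b && ~~ s) + r2.1.2)%N r2.2 o)) => //.
  + by rewrite mem_cat negb_or ncs.
  + by move=> y; rewrite mem_cat => /orP[/csX|/UX].
  + by apply: leq_trans szX; rewrite leq_add2l mulSn leq_addr.
  + rewrite /a; move: (k1 * _) (k0 * _) u_0 v_0 => u v u0 v0.
    by case: (s); rewrite /= !expr0 !expr1 invr1; lra.
  move=> b X1 sX1 zX1; split.
    move=> o3 o4 Ho.
    have -> : sweep (explore j) cs X1 o3 = sweep (explore j) cs X1 o4.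
      apply: sweep_dep' => e /orP[re|/mapP[y ycs ->]]; apply: Ho.
        apply: may_read_untouched re => y yc; first by apply: sX1; apply: csX.
        by rewrite mem_cat yc.
      by apply: untouched_st; rewrite mem_cat ycs.
    set r := sweep _ _ _ _.
    have [sX2 zX2 _] : grows X1 r.2 (size cs * explore_cost j) by exact: grow2.
    apply: (proj1 (H _ _ r.2 _ _)).
    + by move=> y /sX1 /sX2.
    + apply: leq_trans zX2 _; rewrite mulSn addnA leq_add2r //.
    + move=> e /= te; apply: Ho; apply: contra te.
      by apply: touched_sub => // y yU; rewrite mem_cat yU orbT.
  move=> o3.
  suff -> : (if b then a true else a false) = a1 + (k1 * 2 ^- (b && s)) * tau1 ^+ size cs
     + (k0 * 2 ^- (b && ~~ s)) * tau0 ^+ size cs.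
    apply: (IH X1 U (fun n1 n0 => Phi ((b && s) + n1)%N ((b && ~~ s) + n0)%N)) => //.
    + by move=> y /csX /sX1.
    + by move=> y /UX /sX1.
    + apply: leq_trans szX; rewrite mulSn addnA leq_add2r //.
    + by apply: mulr_ge0 => //; apply: half_ge0.
    + by apply: mulr_ge0 => //; apply: half_ge0.
    move=> n1 n0 X2 sX2 zX2.
    have [|| dP bP] := H ((b && s) + n1)%N ((b && ~~ s) + n0)%N X2.
    + by move=> y /sX1 /sX2.
    + by apply: leq_trans zX2 _; rewrite mulSn addnA leq_add2r.
    split=> // o4; apply: le_trans (bP o4) _.
    by rewrite !exprD !invfM !mulrA.
  by rewrite /a; case: b; rewrite /= ?expr0 ?invr1 ?mulr1 // -!mulrA ![_^-1 * _]mulrC.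
Qed.

(** The number of open neighbours is a sum of independent indicators of mean
    at least D, and D is huge in comparison with M. *)
Lemma few_kids z (X : seq V) o : z \in B -> z \in X -> (size X <= bud)%N ->
  EL (fun o => (size (kids z X o) < M)%N%:R) o <= 1 / 8.
Proof.
move=> zB zX szX.
(* Markov's inequality for 2 ^- (number of open neighbours). *)
pose phi (x : bool) : R := if x then 1 / 2 else 1.
apply: (@le_trans _ _ (EL (fun o => 2 ^+ M * \prod_(y <- avail X) phi (o (ed z y))) o)).
  apply: expect_le => // o'.
  have prodE : \prod_(y <- avail X) phi (o' (ed z y)) =
      2 ^- size [seq y <- B | (y \notin X) && o' (ed z y)].
    rewrite /avail; elim: (B) => [|y B' IH] /=; first by rewrite big_nil expr0 invr1.
    case yX: (y \notin X) => //=; rewrite big_cons IH /phi.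
    case: (o' _) => /=; last by rewrite mul1r.
    by rewrite exprS invfM mul1r.
  rewrite prodE /kids size_take_min; set n := size _.
  case: ltnP => [|_]; last by apply: mulr_ge0; [exact: exprn_ge0|exact: half_ge0].
  rewrite gtn_min ltnn orFb => nM /=.
  rewrite ler_pdivlMr ?exprn_gt0 // mul1r.
  by apply: ler_weXn2l; [lra|exact: ltnW].
rewrite expect_Z.
have edz_inj : injective (ed z).
  by move=> a b /ed_inj[] [] // <- ->.
rewrite (expect_prod w (l := L) (lab := ed z) (fun=> phi)); last 2 first.
- by rewrite map_inj_uniq //; apply: filter_uniq.
- move=> c /mapP[y]; rewrite mem_avail => /andP[yB yX] ->.
  by apply: ed_L => //; apply: contraNneq yX => <-.
have -> : \prod_(y <- avail X) (w (ed z y) * phi true + (1 - w (ed z y)) * phi false)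
    = \prod_(y <- avail X) (1 - w (ed z y) / 2).
  by apply: eq_bigr => y _; rewrite /phi; field.
have P1 : \prod_(y <- avail X) (1 - w (ed z y) / 2) <=
    (1 + \sum_(y <- avail X) w (ed z y) / 2)^-1.
  by apply: prod_le_inv => y _; have /andP[w0 w1] := w01 (ed z y); apply/andP; split; lra.
have := degB zB szX; rewrite -mulr_suml in P1 *.
move: (\sum_(y <- _) _) P1 => S P1 DS.
have M0 : 0 < (2 : R) ^+ M by exact: exprn_gt0.
have : 2 ^+ M * 16 <= S.
  apply: le_trans DS; apply: le_trans D_large.
  by rewrite natrX exprD ler_wpM2l ?(ltW M0) // !exprS expr0; lra.
move=> HS; apply: le_trans (ler_wpM2l (ltW M0) P1) _.
rewrite ler_pdivrMr; lra.
Qed.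

(** Induction on the depth. A failure is caused by a lack of neighbours, of
    probability at most 1 / 8, or by fewer than d successes in some state,
    whose indicator is at most 2 ^ d * (2 ^- n1 + 2 ^- n0), of mean at most 1
    / 8. The sum is 1 / 4 again. *)
Lemma explore_boundP j : explore_bound j.
Proof.
elim: j => [|j IH] z X U Phi a1 a0 zB zX zU UX szX a10 H o.
  have [//||_ Hb] := H true X; first by rewrite leq_addr.
  by apply: le_trans (Hb o) _; lra.
pose F (cs : seq V) (o : Om) := if (size cs < M)%N then Phi false X o else
  let r := sweep (explore j) cs (cs ++ X) o in
  Phi ((d <= r.1.1)%N && (d <= r.1.2)%N) r.2 o.
pose h (cs : seq V) : R := if (size cs < M)%N then a0 else a1 + (a0 - a1) / 8.
have szX' : (size X <= bud)%N by apply: leq_trans szX; rewrite leq_addr.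
suff : EL (fun o => F (kids z X o) o) o <= EL (fun o => h (kids z X o)) o.
  move=> HF; apply: (@le_trans _ _ (EL (fun o => F (kids z X o) o) o)).
    by apply: expect_le => // o'; rewrite /F /=; case: ifP.
  apply: le_trans HF _.
  apply: (@le_trans _ _ (EL (fun o => (a1 + (a0 - a1) / 8) +
      (a0 - a1) * (size (kids z X o) < M)%N%:R) o)).
    by apply: expect_le => // o'; rewrite /h; case: ifP => _ /=; lra.
  rewrite expect_D expect_const expect_Z.
  have /(ler_wpM2l (_ : 0 <= a0 - a1)) := few_kids o zB zX szX'.
  by rewrite subr_ge0 => /(_ a10); lra.
apply: (expect_reveal w01 (A := fun c => has (fun y => c == ed z y) (avail X))).
- exact: kids_dep.
- move=> o1 o2 o3 Ho; rewrite /F; set cs := kids z X o1.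
  have notX' X' e : {subset X <= X'} -> untouched X' U e ->
      ~~ has (fun y => e == ed z y) (avail X).
    move=> sX' /=; apply: contra => /hasP[y]; rewrite mem_avail => /andP[yB _] /eqP->.
    by apply: touched_ed => //; apply: sX'.
  case: ltnP => szk.
    have [//||dP _] := H false X; first by rewrite leq_addr.
    by apply: dP => e He; apply: Ho; apply: notX' He.
  have [sX0 zX0 _] := kids_grows z X o1.
  have e1 : sweep (explore j) cs (cs ++ X) o2 = sweep (explore j) cs (cs ++ X) o3.
    apply: (@sweep_dep (explore j)).
    - by move=> o4 z4 X4; case: (explore_grows j z4 X4 o4).
    - exact: explore_dep.
    move=> e He; apply: Ho; apply/negP => /hasP[y]; rewrite mem_avail => /andP[yB yX] /eqP ee.
    have zcs : z \notin cs.
      by apply: contraL zX => /kids_sub; rewrite mem_avail => /andP[].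
    case/orP: He => [re|/mapP[k kk]]; last by rewrite ee => /esym/eqP; rewrite (negbTE (st_ed _ _ _)).
    have : ~~ touched (cs ++ X) cs e.
      by apply: may_read_untouched re => // u uc; rewrite mem_cat uc.
    by rewrite ee touched_ed //; apply: sX0.
  rewrite e1; set r := sweep _ _ _ _.
  have [sX2 zX2 _] : grows (cs ++ X) r.2 (size cs * explore_cost j).
    by apply: sweep_grows => *; exact: explore_grows.
  apply: (proj1 (H _ r.2 _ _)).
  + by move=> y /sX0 /sX2.
  + apply: leq_trans zX2 _; rewrite /= addnA.
    by apply: leq_add => //; rewrite leq_mul2r kids_size orbT.
  + by move=> e He; apply: Ho; apply: notX' He => y /sX0 /sX2.
- move=> o1 o2; rewrite /F /h; set cs := kids z X o1.
  case: ltnP => szk.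
    by have [//||_ Hb] := H false X; [rewrite leq_addr|exact: Hb].
  have [sX0 zX0 _] := kids_grows z X o1.
  have szM : size cs = M by apply/eqP; rewrite eqn_leq szk kids_size.
  (* Fewer than d successes cost at most k * 2 ^- (their number). *)
pose k := (a0 - a1) * 2 ^+ d.
  have k_0 : 0 <= k by apply: mulr_ge0; rewrite ?subr_ge0 ?exprn_ge0.
  apply: (@le_trans _ _ (a1 + k * tau1 ^+ size cs + k * tau0 ^+ size cs)); last first.
    rewrite szM -addrA -mulrDr /k -mulrA lerD2l.
    by rewrite -[_ / 8]/(_ * 8^-1) -div1r; apply: ler_wpM2l => //; rewrite subr_ge0.
  apply: (sweep_bound (U := U) (Phi := fun n1 n0 X' =>
    Phi ((d <= n1)%N && (d <= n0)%N) X') IH) => //.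
  + exact: kids_uniq.
  + by move=> y /kids_sub; rewrite mem_avail => /andP[].
  + by move=> y yc; rewrite mem_cat yc.
  + move=> c /kids_sub; rewrite mem_avail => /andP[_]; apply: contra; exact: UX.
  + by move=> y /UX /sX0.
  + by apply: leq_trans szX; rewrite /= addnA szM leq_add2r.
  move=> n1 n0 X2 sX2 zX2.
  have [||dP bP] := H ((d <= n1)%N && (d <= n0)%N) X2.
  + by move=> y /sX0 /sX2.
  + by apply: leq_trans zX2 _; rewrite /= addnA szM leq_add2r.
  split=> // o3; apply: le_trans (bP o3) _.
  have big n : (n < d)%N -> a0 - a1 <= k * 2 ^- n.
    move=> nd; rewrite /k -mulrA ler_peMr ?subr_ge0 //.
    rewrite ler_pdivlMr ?exprn_gt0 // mul1r.
    by apply: ler_weXn2l; [lra|exact: ltnW].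
  have pos n : 0 <= k * 2 ^- n by apply: mulr_ge0 => //; exact: half_ge0.
  have := pos n1; have := pos n0.
  case: (leqP d n1) => [_|/big] /=; last by lra.
  by case: (leqP d n0) => [_|/big] /=; lra.
Qed.

Lemma explore_fail j z o : z \in B -> (1 + explore_cost j <= bud)%N ->
  EL (fun o => (~~ (explore j z [:: z] o).1)%:R) o <= 1 / 4.
Proof.
move=> zB zb.
have : EL (fun o => (~~ (explore j z [:: z] o).1)%:R) o <= 0 + (1 - 0) / 4.
  apply: (@explore_boundP j z [:: z] [::] (fun b _ _ => (~~ b)%:R)) => //.
  - by rewrite mem_head.
  - by move=> b X' _ _; split=> // o'; rewrite expect_const; case: b.
by rewrite add0r subr0.
Qed.

End Probability.

Definition open_path (om : Om) z s (xi : seq bool) :=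
  path (fun a b => om (ed a b)) z s && (map (om \o st) s == xi).

(** An open path with states xi from z to l whose vertices, other than z, were
    brought into use between X and X'; hence it avoids X and the paths found
    by other explorations. *)
Definition leaf_path (X X' : seq V) om z xi l s :=
  [/\ l = last z s, uniq s, open_path om z s xi
    & forall y, y \in s -> [/\ y \in X', y \notin X & y \in B]].

(** A successful exploration to depth j gives every word of length j at least
    d ^ j distinct endpoints. *)
Definition leaves j (ex : V -> seq V -> Om -> bool * seq V) := forall z X om xi,
  z \in X -> (ex z X om).1 -> size xi = j ->
  exists ls, [/\ uniq ls, (d ^ j <= size ls)%N & forall l, l \in ls ->
    exists s, leaf_path X (ex z X om).2 om z xi l s].

(** The explorations of a sweep use disjoint sets of new vertices, so that
    their endpoints are distinct and their numbers add up. *)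
Lemma sweep_leaves j cs X om (a : bool) xi :
  leaves j (explore j) -> uniq cs -> {subset cs <= X} -> size xi = j ->
  let r := sweep (explore j) cs X om in
  exists ls, [/\ uniq ls, ((if a then r.1.1 else r.1.2) * d ^ j <= size ls)%N
    & forall l, l \in ls -> exists c s,
      [/\ c \in cs, om (st c) = a & leaf_path X r.2 om c xi l s]].
Proof.
move=> Hj; elim: cs X => [|c cs IH] X.
  by move=> _ _ _; exists [::]; split=> //; case: a.
move=> /andP[ncs ucs] sX sxi.
have cX : c \in X by apply: sX; rewrite mem_head.
set r1 := explore j c X om; set r2 := sweep (explore j) cs r1.2 om.
have [sX1 _ _] : grows X r1.2 (explore_cost j) by exact: explore_grows.
have [sX2 _ _] : grows r1.2 r2.2 (size cs * explore_cost j).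
  by apply: sweep_grows => *; exact: explore_grows.
have [|ls2 [uls2 zls2 Hls2]] := IH r1.2 ucs _ sxi.
  by move=> y yc; apply: sX1; apply: sX; rewrite inE yc orbT.
rewrite -/r2 in zls2 Hls2.
have Hls2' l : l \in ls2 -> exists c0 s,
    [/\ c0 \in c :: cs, om (st c0) = a & leaf_path X r2.2 om c0 xi l s].
  move=> /Hls2[c0 [s [c0cs sa [ll us op Hs]]]]; exists c0, s; split=> //.
    by rewrite inE c0cs orbT.
  split=> // y /Hs[yX' yX yB]; split=> //.
  by apply: contra yX; apply: sX1.
rewrite /= -/r1 -/r2.
have [/andP[ok1 /eqP sta]|nok] := boolP (r1.1 && (om (st c) == a)); last first.
  exists ls2; split=> //; apply: leq_trans zls2; rewrite leq_mul2r; apply/orP; right.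
  by move: nok; case: (a); case: r1.1; case: (om _).
have [ls1 [uls1 zls1 Hls1]] := Hj c X om xi cX ok1 sxi.
exists (ls1 ++ ls2); split.
- rewrite cat_uniq uls1 uls2 andbT /=; apply/hasPn => l /Hls2.
  move=> [c0 [s0 [c0cs _ [-> _ _ Hs0]]]].
  apply/negP => /Hls1[s [ll _ _ Hs]].
  have : last c0 s0 \in c0 :: s0 by exact: mem_last.
  have : last c0 s0 \in c :: s by rewrite ll; exact: mem_last.
  have c0X : c0 \in X by apply: sX; rewrite inE c0cs orbT.
  rewrite !inE => /orP[/eqP->|/Hs[y1 yX _]] /orP[/eqP ec|/Hs0[y2 y3 _]].
  + by rewrite ec c0cs in ncs.
  + by rewrite sX1 in y3.
  + by rewrite ec c0X in yX.
  + by rewrite y1 in y3.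
- rewrite size_cat; apply: leq_trans (leq_add zls1 zls2).
  by rewrite ok1 sta; case: (a); rewrite /= mulSn.
- move=> l; rewrite mem_cat => /orP[/Hls1[s [ll us op Hs]]|/Hls2'//].
  exists c, s; split=> //; first by rewrite mem_head.
  by split=> // y /Hs[y1 y2 y3]; split=> //; apply: sX2.
Qed.

Lemma explore_leaves j : leaves j (explore j).
Proof.
elim: j => [|j IH] z X om xi zX.
  move=> _ /size0nil->; exists [:: z]; split=> // l; rewrite inE => /eqP->.
  by exists [::].
rewrite /=; case: ltnP => //= szk /andP[ok1 ok0].
case: xi => [|a xi] //= [sxi]; set cs := kids z X om in ok1 ok0 szk *.
have [sX0 _ _] := kids_grows z X om.
have [|y yc|ls [uls zls Hls]] := @sweep_leaves j cs (cs ++ X) om a xi IH _ _ sxi.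
- exact: kids_uniq.
- by rewrite mem_cat yc.
set r := sweep _ _ _ _ in ok1 ok0 zls Hls *.
have [sX2 _ _] : grows (cs ++ X) r.2 (size cs * explore_cost j).
  by apply: sweep_grows => *; exact: explore_grows.
exists ls; split=> //.
  apply: leq_trans zls; rewrite expnS leq_mul2r; apply/orP; right.
  by case: (a).
move=> l /Hls[c [s [ccs sta [ll us /andP[op ost] Hs]]]]; exists (c :: s).
have := kids_sub ccs; rewrite mem_avail => /andP[cB cX].
split=> //=.
- by rewrite us andbT; apply/negP => /Hs[_ cn _]; rewrite mem_cat ccs in cn.
- by rewrite /open_path /= op (kids_open ccs) sta (eqP ost) /= eqxx.
- move=> y; rewrite inE => /orP[/eqP->|/Hs[y1 y2 y3]].
    by split=> //; apply: sX2; rewrite mem_cat ccs.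
  by split=> //; apply: contra y2; apply: sX0.
Qed.

End Exploration.

(** * One block *)

Lemma expect_bigM (R : realFieldType) (T : eqType) (w : T -> R) l (I : eqType)
    (s : seq I) (f : I -> (T -> bool) -> R) (S : I -> pred T) om :
  uniq s -> (forall i, i \in s -> depends_on (f i) (S i)) ->
  (forall i j c, i != j -> S i c -> ~~ S j c) ->
  expect w l (fun o => \prod_(i <- s) f i o) om = \prod_(i <- s) expect w l (f i) om.
Proof.
move=> us df dis; elim: s us df => [|i s IH] /=.
  move=> _ _; rewrite big_nil -[RHS](expect_const w l _ om).
  by apply: expect_ext => o; rewrite big_nil.
move=> /andP[ns us] df; rewrite big_cons -IH //; last first.
  by move=> j js; apply: df; rewrite inE js orbT.
rewrite -(expect_indepM w (S1 := S i) (S2 := fun c => has (fun j => S j c) s)).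
- by apply: expect_ext => o; rewrite big_cons.
- by apply: df; rewrite mem_head.
- move=> o o' H; apply: eq_big_seq => j js.
  apply: (df j _); first by rewrite inE js orbT.
  by move=> c Sc; apply: H; apply/hasP; exists j.
- move=> c _; apply/negP => /andP[Si /hasP[j js Sj]].
  have ij : i != j by apply: contraNneq ns => ->.
  by move: Sj; apply/negP; apply: dis Si.
Qed.

Notation block := (nat * nat)%type.
Notation site := (nat * nat)%type.
Notation kind := ((nat * nat) * (nat * nat))%type.
(** A coordinate is named by its block, its sub-block and its kind; so every
    coordinate belongs to exactly one sub-block, and independence of blocks is
    visible in the name. *)
Notation coordT := ((block * nat) * kind)%type.

(** The kinds of coordinates. A block of line y owns the states of its roots
    (on line y), the states of the vertices just below, where words land, the
    vertical edges between both, the edges inside each sub-block, and the jump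
    edges of line y that leave its roots. The parity built into the numbering
    of blocks makes all of these distinct. *)
Definition root_state i : kind := ((0, i), (0, 0))%N.
Definition land_state i : kind := ((1, i), (0, 0))%N.
Definition vert_edge i : kind := ((2, i), (0, 0))%N.
(** Symmetric in i and j, as an edge is unordered. *)
Definition tree_edge i j : kind := ((3, minn i j), (0, maxn i j))%N.
(** The jump goes to the landing vertex of the site u of the child number s.
    *)
Definition jump_edge (s : bool) i (u : site) : kind := ((4 + s, i), u)%N.

Definition coord_at (v : block) t kd : coordT := ((v, t), kd).

Section Block.
Variables (g N M d depth r : nat).

(** A kind with its indices in range; unused indices are 0, which makes the
    naming injective. *)
Definition vkind (kd : kind) : bool :=
  let: ((tag, i), (a, b)) := kd in
  match tag with
  | 0 | 1 | 2 => [&& (i < N)%N, a == 0%N & b == 0%N]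
  | 3 => [&& (i < b)%N, (b < N)%N & a == 0%N]
  | 4 | 5 => [&& (i < N)%N, (a < g)%N & (b < N)%N]
  | _ => false
  end.

Definition vsite (u : site) := (u.1 < g)%N && (u.2 < N)%N.

Definition tree_coord v t i j : coordT := coord_at v t (tree_edge i j).
Definition state_coord v t i : coordT := coord_at v t (root_state i).

Lemma tree_coord_inj v t a b c e : tree_coord v t a b = tree_coord v t c e ->
  (a = c /\ b = e) \/ (a = e /\ b = c).
Proof. by case; lia. Qed.

Lemma state_coord_inj v t : injective (state_coord v t).
Proof. by move=> a b []. Qed.

Lemma state_tree_coord v t a b c : state_coord v t a != tree_coord v t b c.
Proof. by apply/eqP. Qed.

Lemma vkind_tree_edge i j : (i < N)%N -> (j < N)%N -> i != j -> vkind (tree_edge i j).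
Proof. by rewrite /=; lia. Qed.

Notation Om := (coordT -> bool).
Notation Bl := (iota 0 N).

Definition explore_root v t i (om : Om) :=
  explore Bl (tree_coord v t) (state_coord v t) M d depth i [:: i] om.

Definition tree_path v t (om : Om) i s xi :=
  [&& uniq (i :: s), all (fun j => (j < N)%N) s
    & open_path (tree_coord v t) (state_coord v t) om i s xi].

Definition reach v t i xi (om : Om) : seq nat :=
  [seq l <- Bl | `[< exists2 s, l = last i s & tree_path v t om i s xi >]].

(** The root u can take every word of length depth, and then every pair of
    letters a, b, to a site of A a b: b will be the state of the next root and
    a the state of the landing vertex below it. *)
Definition tree_good v (u : site) s (A : bool -> bool -> seq site) (om : Om) :=
  (explore_root v u.1 u.2 om).1 &&
  [forall xi : depth.-tuple bool, forall a, forall b,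
    has (fun l => has (fun u' => om (coord_at v u.1 (jump_edge s l u'))) (A a b))
      (reach v u.1 u.2 xi om)].

(** The coordinates that decide whether a root is good, given the targets. The
    root's own state, landing state and vertical edge are excluded: they are
    independent of its goodness. *)
Definition root_reads v t i (c : coordT) :=
  [&& c.1 == (v, t), vkind c.2, c.2.1.1 != 1%N, c.2.1.1 != 2%N & c.2 != root_state i].

Lemma may_read_valid v t i c : (i < N)%N ->
  may_read Bl (tree_coord v t) (state_coord v t) [:: i] [:: i] c ->
  root_reads v t i c && (c.2.1.1 < 4)%N.
Proof.
have memf a : (a \in avail Bl [:: i]) = (a < N)%N && (a != i).
  by rewrite mem_avail mem_iota inE.
move=> iN /orP[|/orP[/hasP[a]|/hasP[a af /hasP[b]]]]; last 2 first.
- rewrite memf => /andP[aN ai] /eqP->.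
  rewrite /root_reads eqxx /= aN andbT; apply/andP; split=> //.
  by apply: contra ai => /eqP[->].
- move: af; rewrite !memf => /andP[aN ai] /andP[bN bi] /andP[ab /eqP->].
  by rewrite /root_reads eqxx /= !andbT; lia.
- rewrite /= orbF => /hasP[a]; rewrite memf => /andP[aN ai] /eqP->.
  by rewrite /root_reads eqxx /= !andbT; lia.
Qed.

Lemma explore_root_dep v t i : (i < N)%N ->
  depends_on (explore_root v t i) (fun c => root_reads v t i c && (c.2.1.1 < 4)%N).
Proof.
move=> iN o o' H; apply: (explore_dep M d) => c /(may_read_valid iN) Hc.
exact: H.
Qed.

Lemma tree_path_dep v t i s xi : (i < N)%N ->
  depends_on (fun o => tree_path v t o i s xi) (fun c => root_reads v t i c && (c.2.1.1 < 4)%N).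
Proof.
move=> iN o o' H; rewrite /tree_path.
have [us|//] := boolP (uniq (i :: s)); have [sN|//] := boolP (all _ s).
rewrite /= /open_path; congr andb; last first.
  congr (_ == _); apply/eq_in_map => j js /=; apply: H.
  rewrite /root_reads /= eqxx /= (allP sN) //= andbT.
  move: us => /= /andP[is_ _]; by apply: contraNneq is_ => [[<-]].
have iN' : all (fun j => (j < N)%N) (i :: s) by rewrite /= iN.
suff Hp a : uniq (a :: s) -> all (fun j => (j < N)%N) (a :: s) ->
    path (fun a b => o (tree_coord v t a b)) a s = path (fun a b => o' (tree_coord v t a b)) a s.
  exact: Hp.
elim: s a {us sN iN'} => [|b s IH] a //= /and3P[abs bs us] /and3P[aN bN sN].
rewrite IH /= ?bs ?us ?bN ?sN //; congr andb; apply: H.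
rewrite /root_reads /= eqxx /=.
have : a != b by apply: contraNneq abs => ->; rewrite mem_head.
by lia.
Qed.

Lemma reach_dep v t i xi : (i < N)%N ->
  depends_on (reach v t i xi) (fun c => root_reads v t i c && (c.2.1.1 < 4)%N).
Proof.
move=> iN o o' H; rewrite /reach; apply: eq_filter => l.
by apply/asboolP/asboolP => -[s ls sp]; exists s => //;
  rewrite ?(tree_path_dep s xi iN H) // -(tree_path_dep s xi iN H).
Qed.

Lemma reachP v t i xi om l :
  l \in reach v t i xi om -> (l < N)%N /\ exists2 s, l = last i s & tree_path v t om i s xi.
Proof. by rewrite mem_filter mem_iota => /andP[/asboolP Hs /andP[_ lN]]. Qed.

Lemma reach_uniq v t i xi om : uniq (reach v t i xi om).
Proof. by apply: filter_uniq; apply: iota_uniq. Qed.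

(** The endpoints of the exploration are reached by self-avoiding paths. *)
Lemma reach_big v t i om xi : (i < N)%N -> (explore_root v t i om).1 -> size xi = depth ->
  (d ^ depth <= size (reach v t i xi om))%N.
Proof.
move=> iN exi sxi.
have [|ls [uls zls Hls]] := explore_leaves (iota_uniq 0 N) (z := i) (X := [:: i]) _ exi sxi.
  by rewrite mem_head.
apply: leq_trans zls _; apply: uniq_leq_size => // l /Hls[s [ll us op Hs]].
have sN : all (fun j => (j < N)%N) (i :: s).
  by rewrite /= iN; apply/allP => j /Hs[_ _]; rewrite mem_iota.
rewrite mem_filter mem_iota; apply/andP; split.
  apply/asboolP; exists s => //; rewrite /tree_path op andbT /= us andbT.
  move: sN => /= /andP[_ ->]; rewrite andbT.
  by apply/negP => /Hs[_]; rewrite inE eqxx.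
by rewrite /= add0n ll (allP sN) // mem_last.
Qed.

Lemma tree_good_dep v u s A : vsite u ->
  (forall a b u', u' \in A a b -> vsite u') ->
  depends_on (tree_good v u s A) (root_reads v u.1 u.2).
Proof.
move=> /andP[tg iN] HA o o' H.
have H4 c : root_reads v u.1 u.2 c && (c.2.1.1 < 4)%N -> o c = o' c.
  by move=> /andP[Hc _]; apply: H.
rewrite /tree_good (explore_root_dep iN H4); congr andb.
apply: eq_forallb => xi; apply: eq_forallb => a; apply: eq_forallb => b.
rewrite (reach_dep xi iN H4); apply: eq_in_has => l /reachP[lN _].
apply: eq_in_has => u' /HA/andP[u1 u2]; apply: H.
by rewrite /root_reads eqxx /= /jump_edge; case: u' u1 u2 => a' b' /= -> ->; case: s; rewrite /= lN.
Qed.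

Section BlockProbability.
Variables (R : realFieldType) (w : coordT -> R) (L : seq coordT) (v : block).
Variables (p eps pm D J0 : R) (bud : nat).
Hypothesis w01 : forall c, 0 <= w c <= 1.
Hypothesis HL : forall t kd, (t < g)%N -> vkind kd -> coord_at v t kd \in L.
Hypothesis w_root_state : forall t i, (t < g)%N -> (i < N)%N -> w (coord_at v t (root_state i)) = p.
Hypothesis w_land_state : forall t i, (t < g)%N -> (i < N)%N -> w (coord_at v t (land_state i)) = p.
Hypothesis w_vert_edge : forall t i, (t < g)%N -> (i < N)%N -> w (coord_at v t (vert_edge i)) = eps.
Hypothesis pm_gt0 : 0 < pm.
Hypothesis pm_le : pm <= p /\ pm <= 1 - p.
Hypothesis eps01 : 0 < eps <= 1.
Hypothesis deg : forall t z X, (t < g)%N -> (z < N)%N -> (size X <= bud)%N ->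
  D <= \sum_(y <- avail Bl X) w (tree_coord v t z y).
Hypothesis D_large : (2 ^ (M + 4))%:R <= D.
Hypothesis tau_small :
  2 ^+ d * ((1 - 3 / 8 * p) ^+ M + (1 - 3 / 8 * (1 - p)) ^+ M) <= 1 / 8.
Hypothesis Hbud : (1 + explore_cost M depth <= bud)%N.
Hypothesis J0_ge0 : 0 <= J0.
(* J0 bounds from below the mean number of open jumps from a vertex to a
   class. *)
Hypothesis jump : forall t i s A, (t < g)%N -> (i < N)%N -> uniq A ->
  all vsite A -> (r <= size A)%N ->
  J0 <= \sum_(u <- A) w (coord_at v t (jump_edge s i u)).
Hypothesis jump_small : (2 ^ depth * 4)%:R * (1 + (d ^ depth)%:R * J0)^-1 <= 1 / 4.

Notation EL := (expect w L).

Lemma prob01 : 0 <= p <= 1.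
Proof. by case: pm_le; have := pm_gt0 => *; apply/andP; split; lra. Qed.

Lemma explore_root_fail t i o : (t < g)%N -> (i < N)%N ->
  EL (fun o => (~~ (explore_root v t i o).1)%:R) o <= 1 / 4.
Proof.
move=> tg iN; apply: (explore_fail (iota_uniq 0 N) (@tree_coord_inj v t) (@state_coord_inj v t)
  (@state_tree_coord v t) w01 prob01 (bud := bud) (D := D)) => //.
- move=> a; rewrite mem_iota add0n => /andP[_ aN]; split; last exact: w_root_state.
  by apply: HL => //=; rewrite aN.
- move=> a b; rewrite !mem_iota !add0n => /andP[_ aN] /andP[_ bN] ab.
  by apply: HL => //; apply: vkind_tree_edge.
- by move=> z X; rewrite mem_iota add0n => /andP[_ zN]; apply: deg.
- by rewrite mem_iota.
Qed.

(** The set of endpoints is read in the tree, the jump edges are independent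
    of it. The probability that all jumps from d ^ depth endpoints to A are
    closed is a product of as many factors 1 - w, bounded with [prod_le_inv].
    *)
Lemma jump_fail t i s xi A o : (t < g)%N -> (i < N)%N -> uniq A ->
  all vsite A -> (r <= size A)%N ->
  EL (fun o => (d ^ depth <= size (reach v t i xi o))%N%:R *
     (~~ has (fun l => has (fun u => o (coord_at v t (jump_edge s l u))) A) (reach v t i xi o))%:R) o
  <= (1 + (d ^ depth)%:R * J0)^-1.
Proof.
move=> tg iN uA vA rA.
pose F (ls : seq nat) (o : Om) : R := (d ^ depth <= size ls)%N%:R *
  (~~ has (fun l => has (fun u => o (coord_at v t (jump_edge s l u))) A) ls)%:R.
rewrite -[leRHS](expect_const w L _ o).
apply: (@expect_reveal _ _ _ w01 _ (fun c => root_reads v t i c && (c.2.1.1 < 4)%N) _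
  (reach v t i xi) F (fun=> _)); first exact: reach_dep.
  move=> o1 o2 o3 H; rewrite /F; congr (_ * (~~ _)%:R).
  apply: eq_has => l; apply: eq_has => u; apply: H => /=.
  by rewrite negb_and orbC; case: (s).
move=> o1 o2; set ls := reach v t i xi o1.
have uls : uniq ls by exact: reach_uniq.
have lsN l : l \in ls -> (l < N)%N by move=> /reachP[].
rewrite /F; case: leqP => szl; last first.
  rewrite (@expect_ext _ _ w L _ (fun=> 0)) ?expect_const ?invr_ge0; last by move=> ?; rewrite mul0r.
  by rewrite addr_ge0 ?mulr_ge0 ?ler0n.
pose open_prob := [seq (l, u) | l <- ls, u <- A].
pose cc (lu : nat * site) := coord_at v t (jump_edge s lu.1 lu.2).
have ucc : uniq (map cc open_prob).
  rewrite map_inj_uniq; first by apply: allpairs_uniq => // -[? ?] [? ?].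
  by move=> [l1 [a1 b1]] [l2 [a2 b2]] [-> -> ->].
have vJ l u : l \in ls -> u \in A -> vkind (jump_edge s l u).
  move=> /lsN lN /(allP vA)/andP[]; case: u => a b /= -> ->.
  by case: (s); rewrite /= lN.
rewrite (@expect_ext _ _ w L _ (fun o => \prod_(lu <- open_prob) (~~ o (cc lu))%:R)); last first.
  move=> o3; rewrite mul1r /open_prob big_allpairs /=.
  elim: (ls) => [|l ls' IH] /=; first by rewrite big_nil.
  rewrite big_cons -IH negb_or -mulnb natrM; congr (_ * _).
  elim: (A) => [|u A' IHA] /=; first by rewrite big_nil.
  by rewrite big_cons -IHA negb_or -mulnb natrM.
rewrite (expect_prod w (fun=> fun b => (~~ b)%:R)) //; last first.
  move=> c /mapP[[l u] /allpairsP[[l' u'] /= [ll uu [-> ->]]] ->].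
  by apply: HL => //; apply: vJ.
have -> : \prod_(i0 <- open_prob) (w (cc i0) * (~~ true)%:R + (1 - w (cc i0)) * (~~ false)%:R)
    = \prod_(i0 <- open_prob) (1 - w (cc i0)).
  by apply: eq_bigr => lu _ /=; rewrite mulr0 add0r mulr1.
apply: le_trans (prod_le_inv _) _; first by move=> *; exact: w01.
have dJ : 0 <= (d ^ depth)%:R * J0 by apply: mulr_ge0; rewrite ?ler0n.
suff HS : (d ^ depth)%:R * J0 <= \sum_(lu <- open_prob) w (cc lu).
  by rewrite lef_pV2 ?posrE ?lerD2l //; lra.
rewrite /open_prob big_allpairs /=.
apply: (@le_trans _ _ (\sum_(l <- ls) J0)).
  rewrite big_const_seq count_predT iter_addr_0 -[leRHS]mulr_natl.
  by apply: ler_wpM2r => //; rewrite ler_nat.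
by rewrite big_seq [leRHS]big_seq; apply: ler_sum => l /lsN lN; apply: jump.
Qed.

(** Union bound over the 2 ^ depth words and the 4 pairs of letters; depth is
    chosen so that it costs at most 1 / 4. *)
Lemma tree_good_fail u s A o : vsite u ->
  (forall a b, [/\ uniq (A a b), all vsite (A a b) & (r <= size (A a b))%N]) ->
  EL (fun o => (~~ tree_good v u s A o)%:R) o <= 1 / 2.
Proof.
move=> /andP[tg iN] HA.
pose bad xi a b (o : Om) : R := (d ^ depth <= size (reach v u.1 u.2 xi o))%N%:R *
     (~~ has (fun l => has (fun u' => o (coord_at v u.1 (jump_edge s l u'))) (A a b))
       (reach v u.1 u.2 xi o))%:R.
apply: (@le_trans _ _ (EL (fun o => (~~ (explore_root v u.1 u.2 o).1)%:R
   + \sum_(xi : depth.-tuple bool) \sum_(a : bool) \sum_(b : bool) bad xi a b o) o)).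
  apply: expect_le => // o'.
  have bad0 xi a b : 0 <= bad xi a b o' by apply: mulr_ge0; rewrite ler0n.
  have sum0 : 0 <= \sum_(xi : depth.-tuple bool) \sum_(a : bool) \sum_(b : bool) bad xi a b o'.
    by do !(apply: sumr_ge0 => ? _).
  case: (boolP (tree_good v u s A o')) => [_|]; first by apply: addr_ge0 => //; rewrite ler0n.
  rewrite /tree_good negb_and; case exi : (explore_root _ _ _ _).1 => /=; last by move=> _; lra.
  rewrite add0r negb_forall => /existsP[xi].
  rewrite negb_forall => /existsP[a]; rewrite negb_forall => /existsP[b Hn].
  have Hb : bad xi a b o' = 1 by rewrite /bad reach_big ?size_tuple // Hn mulr1.
  rewrite (bigD1 xi) //= (bigD1 a) //= (bigD1 b) //= Hb -!addrA lerDl.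
  by rewrite !addr_ge0 //; do !(apply: sumr_ge0 => ? _).
rewrite expect_D.
apply: (@le_trans _ _ (1 / 4 + 1 / 4)); last by lra.
apply: lerD; first exact: explore_root_fail.
apply: le_trans jump_small; rewrite expect_sum.
apply: (@le_trans _ _ (\sum_(xi : depth.-tuple bool) \sum_(a : bool) \sum_(b : bool)
   (1 + (d ^ depth)%:R * J0)^-1)).
  apply: ler_sum => xi _; rewrite expect_sum; apply: ler_sum => a _; rewrite expect_sum.
  apply: ler_sum => b _; have [uA vA rA] := HA a b; exact: jump_fail.
rewrite !sumr_const card_tuple card_bool -!mulrnA -[leLHS]mulr_natl.
by rewrite le_eqVlt; apply/orP; left; apply/eqP; congr (_%:R * _); lia.
Qed.

Definition in_class t i a b (G : Om -> bool) (o : Om) :=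
  [&& o (coord_at v t (vert_edge i)), o (coord_at v t (land_state i)) == a, o (coord_at v t (root_state i)) == b & G o].

(** The vertical edge, the two states and the goodness of a root are
    independent. *)
Lemma in_class_prob t i a b G o : (t < g)%N -> (i < N)%N ->
  depends_on G (root_reads v t i) -> EL (fun o => (~~ G o)%:R) o <= 1 / 2 ->
  eps * pm ^+ 2 / 2 <= EL (fun o => (in_class t i a b G o)%:R) o.
Proof.
move=> tg iN dG HG.
have G12 : 1 / 2 <= EL (fun o => (G o)%:R) o.
  have -> : EL (fun o => (G o)%:R) o = 1 - EL (fun o => (~~ G o)%:R) o.
    rewrite -[X in X - _](expect_const w L 1 o) -expect_B; apply: expect_ext => o'.
    by case: (G o'); rewrite /= ?subr0 ?subrr.
  by lra.
have pmw (c : bool) : pm <= p * (true == c)%:R + (1 - p) * (false == c)%:R.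
  by case: pm_le; case: c => /=; lra.
have -> : EL (fun o => (in_class t i a b G o)%:R) o =
   EL (fun o => (o (coord_at v t (vert_edge i)))%:R * ((o (coord_at v t (land_state i)) == a)%:R *
     ((o (coord_at v t (root_state i)) == b)%:R * (G o)%:R))) o.
  by apply: expect_ext => o'; rewrite /in_class -!mulnb !natrM.
have dG' : depends_on (fun o => (G o)%:R : R) (root_reads v t i) by exact: (depends_comp (fun b : bool => b%:R) dG).
have d1 kd : depends_on (fun o : Om => (o (coord_at v t kd))%:R : R) (pred1 (coord_at v t kd)).
  by apply: (depends_comp (fun b : bool => b%:R)); apply: depends_at => /=.
have d2 kd c : depends_on (fun o : Om => (o (coord_at v t kd) == c)%:R : R) (pred1 (coord_at v t kd)).
  by apply: (depends_comp (fun b : bool => (b == c)%:R)); apply: depends_at => /=.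
have dM S1 S2 (f1 f2 : Om -> R) : depends_on f1 S1 -> depends_on f2 S2 ->
    depends_on (fun o => f1 o * f2 o) (fun c => S1 c || S2 c).
  move=> df1 df2 o1 o2 H; congr (_ * _); [apply: df1|apply: df2] => c Sc;
  by apply: H; rewrite Sc ?orbT.
have d3 := dM _ _ _ _ (d2 (root_state i) b) dG'.
have d4 := dM _ _ _ _ (d2 (land_state i) a) d3.
rewrite (expect_indepM w o (d1 (vert_edge i)) d4); last first.
  move=> c _; apply/negP => /andP[/eqP->].
  by rewrite /root_reads /= !xpair_eqE /= !andbF.
rewrite (expect_indepM w o (d2 (land_state i) a) d3); last first.
  move=> c _; apply/negP => /andP[/eqP->].
  by rewrite /root_reads /= !xpair_eqE /= !andbF.
rewrite (expect_indepM w o (d2 (root_state i) b) dG'); last first.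
  by move=> c _; apply/negP => /andP[/eqP->]; rewrite /root_reads /= !eqxx !andbF.
rewrite (expect_at w (fun x => x%:R)); last by apply: HL => //=; rewrite iN.
rewrite (expect_at w (fun x => (x == a)%:R)); last by apply: HL => //=; rewrite iN.
rewrite (expect_at w (fun x => (x == b)%:R)); last by apply: HL => //=; rewrite iN.
rewrite w_vert_edge // w_land_state // w_root_state // mulr0 addr0 mulr1 -!mulrA.
have /andP[e0 _] := eps01; apply: ler_wpM2l; first exact: ltW.
have pm0 := ltW pm_gt0.
have half0 : 0 <= pm / 2 by apply: divr_ge0.
apply: ler_pM => //; rewrite -[_ / 2]/(pm * 2^-1) -div1r.
by apply: ler_pM; rewrite ?divr_ge0.
Qed.

Definition class_count t a b (G : nat -> Om -> bool) (o : Om) :=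
  count (fun i => in_class t i a b (G i) o) Bl.

(** A count that is at most N and has mean at least mu * N / 2 is at least mu
    * N / 4 with probability at least mu / 4. *)
Lemma class_count_few t a b G o : (t < g)%N -> (0 < N)%N ->
  r%:R <= eps * pm ^+ 2 / 4 * N%:R ->
  (forall i, (i < N)%N -> depends_on (G i) (root_reads v t i) /\
     EL (fun o => (~~ G i o)%:R) o <= 1 / 2) ->
  EL (fun o => (class_count t a b G o < r)%N%:R) o <= 1 - eps * pm ^+ 2 / 4.
Proof.
move=> tg N0 rN HG; set mu := eps * pm ^+ 2.
have mean : mu / 2 * N%:R <= EL (fun o => (class_count t a b G o)%:R) o.
  have -> : EL (fun o => (class_count t a b G o)%:R) o =
     \sum_(i <- Bl) EL (fun o => (in_class t i a b (G i) o)%:R) o.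
    rewrite -expect_sum; apply: expect_ext => o'; rewrite /class_count -sum1_count natr_sum big_mkcond.
    by apply: eq_bigr => i _; case: ifP.
  have -> : mu / 2 * N%:R = \sum_(i <- Bl) mu / 2.
    by rewrite big_const_seq count_predT iter_addr_0 size_iota mulr_natr.
  rewrite big_seq [leRHS]big_seq; apply: ler_sum => i.
  rewrite mem_iota add0n => /andP[_ iN]; have [dGi Gi] := HG i iN.
  exact: in_class_prob.
(* The count is at most N, and at most r when it is below r. *)
have up : EL (fun o => (class_count t a b G o)%:R) o <=
    EL (fun o => (N%:R + r%:R) - N%:R * (class_count t a b G o < r)%N%:R) o.
  apply: expect_le => // o'.
  have cN : (class_count t a b G o' <= N)%N by rewrite /class_count -[leqRHS](size_iota 0); apply: count_size.
  case: ltnP => H /=; rewrite ?mulr1 ?mulr0 ?subr0.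
    by rewrite addrAC subrr add0r ler_nat ltnW.
  by rewrite -natrD ler_nat; apply: leq_trans cN _; apply: leq_addr.
move: up; rewrite expect_B expect_const expect_Z => up.
have N1 : 0 < (N%:R : R) by rewrite ltr0n.
have : N%:R * EL (fun o => (class_count t a b G o < r)%N%:R) o <= N%:R * (1 - mu / 4).
  rewrite /mu in mean *; move: (_ * pm ^+ 2) (EL _ _) (EL _ _) mean up rN => m x y *; lra.
by rewrite ler_pM2l.
Qed.

Definition sites : seq site := [seq (t, i) | t <- iota 0 g, i <- Bl].
Definition targets (G : site -> Om -> bool) (o : Om) a b : seq site :=
  [seq u <- sites | in_class u.1 u.2 a b (G u) o].
Definition rich (A : bool -> bool -> seq site) :=
  [forall a, forall b, (r <= size (A a b))%N].

(** If a class has fewer than r elements in the whole block, the same holds in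
    each of the g sub-blocks, which are independent. *)
Lemma rich_fail (G : site -> Om -> bool) o : (0 < N)%N ->
  r%:R <= eps * pm ^+ 2 / 4 * N%:R ->
  (forall u, vsite u -> depends_on (G u) (root_reads v u.1 u.2) /\
     forall o, EL (fun o => (~~ G u o)%:R) o <= 1 / 2) ->
  EL (fun o => (~~ rich (targets G o))%:R) o <= 4 * (1 - eps * pm ^+ 2 / 4) ^+ g.
Proof.
move=> N0 rN HG.
pose f t a b (o : Om) : R := (class_count t a b (fun i => G (t, i)) o < r)%N%:R.
apply: (@le_trans _ _ (EL (fun o => \sum_(a : bool) \sum_(b : bool)
   \prod_(t <- iota 0 g) f t a b o) o)).
  apply: expect_le => // o'.
  have f0 a b : 0 <= \prod_(t <- iota 0 g) f t a b o'.
    by apply: prodr_ge0 => *; rewrite ler0n.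
  case: (boolP (rich _)) => [_|]; first by do !(apply: sumr_ge0 => ? _).
  rewrite negb_forall => /existsP[a]; rewrite negb_forall => /existsP[b].
  rewrite -ltnNge => Hr.
  rewrite (bigD1 a) //= (bigD1 b) //= big1_seq.
    by rewrite -addrA lerDl addr_ge0 //; do !(apply: sumr_ge0 => ? _).
  move=> t /=; rewrite mem_iota add0n => /andP[_ tg].
  rewrite /f (leq_ltn_trans _ Hr) //.
  rewrite /class_count -size_filter.
  have -> : [seq i <- Bl | in_class t i a b (G (t, i)) o'] =
     map snd [seq u <- [seq (t, i) | i <- Bl] | in_class u.1 u.2 a b (G u) o'].
    by rewrite filter_map -map_comp map_id.
  rewrite size_map; apply: uniq_leq_size.
    by apply: filter_uniq; rewrite map_inj_uniq ?iota_uniq // => ? ? [].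
  move=> u; rewrite !mem_filter => /andP[-> /mapP[i iN ->]] /=.
  by apply/allpairsP; exists (t, i); rewrite mem_iota add0n.
rewrite expect_sum.
have mu1 : 0 <= 1 - eps * pm ^+ 2 / 4.
  have /andP[e0 e1] := eps01; have := pm_gt0; case: pm_le => p1 p2 p3.
  have : eps * pm ^+ 2 <= 1 * 1.
    apply: ler_pM => //; [exact: ltW|exact: sqr_ge0|].
    by rewrite expr_le1 //; lra.
  by move: (_ * _ ^+ 2) => x; lra.
apply: (@le_trans _ _ (\sum_(a : bool) \sum_(b : bool) (1 - eps * pm ^+ 2 / 4) ^+ g)).
  apply: ler_sum => a _; rewrite expect_sum; apply: ler_sum => b _.
  rewrite (@expect_bigM _ _ w L _ (iota 0 g) (fun t => f t a b)
    (fun t c => c.1 == (v, t))) ?iota_uniq //; last 2 first.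
  - move=> t; rewrite mem_iota add0n => /andP[_ tg] o1 o2 H; rewrite /f.
    congr ((_ < _)%N%:R); apply: eq_in_count => i; rewrite mem_iota add0n => /andP[_ iN].
    have [|dG _] := HG (t, i); first by apply/andP.
    have Hc kd : o1 (coord_at v t kd) = o2 (coord_at v t kd) by apply: H => /=.
    by rewrite /in_class !Hc (dG o1 o2) // => c /andP[ct _]; apply: H.
  - by move=> t1 t2 c t12 /eqP->; apply/eqP => -[/eqP]; apply/negP.
  have -> : (1 - eps * pm ^+ 2 / 4) ^+ g = \prod_(t <- iota 0 g) (1 - eps * pm ^+ 2 / 4).
    by rewrite big_const_seq count_predT size_iota iter_mulr_1.
  rewrite big_seq [leRHS]big_seq; apply: ler_prod => t.
  rewrite mem_iota add0n => /andP[_ tg]; apply/andP; split.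
    by apply: expect_ge0 => // ?; rewrite ler0n.
  apply: class_count_few => // i iN; have [|? ?] := HG (t, i); first by apply/andP.
  by split.
rewrite !sumr_const card_bool -mulrnA -[leLHS]mulr_natl; lra.
Qed.

End BlockProbability.
End Block.

(** * Good roots, rich blocks and contours *)

Section Macro.
Variables (g N M d depth r : nat).
Notation Om := (coordT -> bool).

(** Position 2 * k - y becomes 2 * k - y - 1 or 2 * k - y + 1 on the line
    above. *)
Definition child (v : block) (s : bool) : block := (v.1 + s, v.2.+1)%N.

(** Goodness with h lines above. The jumps go to the left child if it is rich,
    else to the right one; the choice depends only on the lines above. *)
Fixpoint good h v u (om : Om) : bool :=
  if h is h'.+1 then
    let s := ~~ rich r (targets g N (child v false) (good h' (child v false)) om) in
    tree_good N M d depth v u s (targets g N (child v s) (good h' (child v s)) om) om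
  else true.

Definition rich_block h v (om : Om) := rich r (targets g N v (good h v) om).

Definition vblock H (v : block) := (v.1 <= v.2 <= H)%N.

Definition kinds : seq kind :=
  [seq kd <- [seq (x, y) | x <- [seq (a, b) | a <- iota 0 6, b <- iota 0 N],
                           y <- [seq (a, b) | a <- iota 0 g.+1, b <- iota 0 N]]
     | vkind g N kd].
Definition blocks H : seq block :=
  [seq v <- [seq (k, y) | k <- iota 0 H.+1, y <- iota 0 H.+1] | vblock H v].
(** All the coordinates owned by the blocks (k, y) with k <= y <= H; the
    descendants of (0, 0) up to level H are among them. *)
Definition coords H : seq coordT :=
  [seq (vt, kd) | vt <- [seq (v, t) | v <- blocks H, t <- iota 0 g], kd <- kinds].

Lemma mem_pairs (A B : eqType) (s : seq A) (t : seq B) x :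
  (x \in [seq (a, b) | a <- s, b <- t]) = (x.1 \in s) && (x.2 \in t).
Proof.
case: x => a b; apply/allpairsP/andP => [[[a' b'] /= [ha hb [-> ->]]]|[ha hb]] //.
by exists (a, b).
Qed.

Lemma mem_kinds kd : (kd \in kinds) = vkind g N kd.
Proof.
rewrite mem_filter; apply: andb_idr; case: kd => [[tag i] [a b]].
rewrite !mem_pairs !mem_iota /=.
by do 6 (case: tag => [|tag] /=; first by lia).
Qed.

Lemma kinds_uniq : uniq kinds.
Proof.
have up (A B : eqType) (s : seq A) (t : seq B) : uniq s -> uniq t ->
    uniq [seq (a, b) | a <- s, b <- t].
  by move=> us ut; apply: allpairs_uniq => // -[? ?] [? ?].
by apply: filter_uniq; rewrite !up ?iota_uniq.
Qed.

Lemma mem_blocks H v : (v \in blocks H) = vblock H v.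
Proof. rewrite mem_filter mem_pairs !mem_iota /vblock; apply: andb_idr; case: v => a b /=; lia. Qed.

Lemma mem_coords H c :
  (c \in coords H) = [&& vblock H c.1.1, (c.1.2 < g)%N & vkind g N c.2].
Proof.
by case: c => [[v t] kd]; rewrite !mem_pairs mem_blocks mem_iota add0n mem_kinds /= andbA.
Qed.

Lemma coords_uniq H : uniq (coords H).
Proof.
apply: allpairs_uniq; rewrite ?kinds_uniq //; last by move=> [? ?] [? ?].
apply: allpairs_uniq; rewrite ?iota_uniq //; last by move=> [? ?] [? ?].
by apply: filter_uniq; apply: allpairs_uniq; rewrite ?iota_uniq // => -[? ?] [? ?].
Qed.

(** The coordinates that decide whether v is rich: those of v and of higher
    levels. *)
Definition block_reads H (v : block) (c : coordT) :=
  [&& vblock H c.1.1, (c.1.2 < g)%N, vkind g N c.2 &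
    (c.1.1 == v) || (v.2 < c.1.1.2)%N].

Lemma mem_sites u : (u \in sites g N) = vsite g N u.
Proof. by rewrite mem_pairs !mem_iota. Qed.

Lemma sites_uniq : uniq (sites g N).
Proof. by apply: allpairs_uniq; rewrite ?iota_uniq // => -[? ?] [? ?]. Qed.

Lemma targets_uniq v G o a b : uniq (targets g N v G o a b).
Proof. by apply: filter_uniq; apply: sites_uniq. Qed.

Lemma targets_vsite v G o a b u : u \in targets g N v G o a b -> vsite g N u.
Proof. by rewrite mem_filter mem_sites => /andP[]. Qed.

Lemma targets_dep H h v : vblock H v ->
  (forall u, vsite g N u -> depends_on (good h v u) (block_reads H v)) ->
  depends_on (targets g N v (good h v)) (block_reads H v).
Proof.
move=> vH HG o o' Ho; apply: funext => a; apply: funext => b.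
apply: eq_in_filter => u; rewrite mem_sites => vu.
have Hc kd : vkind g N kd -> o (coord_at v u.1 kd) = o' (coord_at v u.1 kd).
  by move=> vk; apply: Ho; rewrite /block_reads /= vH vk eqxx; case/andP: vu => ->.
by case/andP: (vu) => _ uN; rewrite /in_class (HG u vu o o' Ho) !Hc //= uN.
Qed.

Lemma child_block_reads H v s c : vblock H v -> block_reads H (child v s) c -> block_reads H v c.
Proof.
rewrite /block_reads /child => vH /and4P[-> -> -> /orP[/eqP->|]] /=; first by rewrite leqnn orbT.
by move=> /ltnW->; rewrite orbT.
Qed.

Lemma good_dep H h v u : (v.1 <= v.2)%N -> (v.2 + h <= H)%N -> vsite g N u ->
  depends_on (good h v u) (block_reads H v).
Proof.
elim: h v u => [|h IH] v u v12 vH vu; first by [].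
have vbl : vblock H v by rewrite /vblock; lia.
have targets_depends s : depends_on (targets g N (child v s) (good h (child v s))) (block_reads H v).
  move=> o o' Ho; apply: (@targets_dep H) => [|u' vu'|c].
  - by rewrite /vblock /child /=; case: s => /=; lia.
  - by apply: IH => //; rewrite /child /=; case: s => /=; lia.
  - by move/(child_block_reads vbl); apply: Ho.
move=> o o' Ho /=; rewrite (targets_depends _ _ _ Ho); set s := ~~ _.
rewrite (targets_depends _ _ _ Ho); apply: (@tree_good_dep g); first exact: vu.
  by move=> a b u'; exact: targets_vsite.
move=> c /and5P[/eqP c1 c2 _ _ _]; apply: Ho.
by rewrite /block_reads c1 /= vbl c2 eqxx; case/andP: vu => ->.
Qed.

Lemma targets_depends H h v : (v.1 <= v.2)%N -> (v.2 + h <= H)%N ->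
  depends_on (targets g N v (good h v)) (block_reads H v).
Proof.
move=> v12 vH; apply: targets_dep; first by rewrite /vblock; lia.
by move=> u vu; apply: good_dep.
Qed.

Lemma rich_block_dep H h v : (v.1 <= v.2)%N -> (v.2 + h <= H)%N ->
  depends_on (rich_block h v) (block_reads H v).
Proof. by move=> v12 vH; apply: (depends_comp (rich r)); apply: targets_depends. Qed.

(** A block fails if it is not rich although some child offers it rich
    targets; at the top no target is needed. *)
Definition failing H v (om : Om) :=
  [&& vblock H v, ~~ rich_block (H - v.2) v om &
    [|| v.2 == H, rich_block (H - v.2.+1) (child v false) om
      | rich_block (H - v.2.+1) (child v true) om]].

Lemma failing_dep H v : depends_on (failing H v) (block_reads H v).
Proof.
move=> o o' Ho; rewrite /failing; case: (boolP (vblock H v)) => //= vbl.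
move: (vbl) => /andP[v12 vH]; rewrite (rich_block_dep v12 (H := H) _ Ho) ?subnKC //.
case: eqP => //= vneH; congr (_ && (_ || _)).
all: apply: (@rich_block_dep H) => [||c /(child_block_reads vbl)]; try exact: Ho.
all: by rewrite /child /=; lia.
Qed.

Lemma child_le (v : block) s : (v.1 <= v.2)%N -> ((child v s).1 <= (child v s).2)%N.
Proof. by move=> v12; rewrite /child /= -addn1; apply: leq_add => //; case: s. Qed.

(** A contour runs along the lattice points, where the block (k, y) occupies
    the segment from k to k + 1 at height y and its children the segment from
    k to k + 2 at height y + 1. It goes up, down to the left, or to the right
    across a failing block. *)
Definition cstep H om : rel (nat * nat) := fun p q =>
  [|| q == (p.1, p.2.+1), p == (q.1.+1, q.2.+1)
    | (q == (p.1.+1, p.2)) && failing H p om].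

(** A block that is not rich either fails, and is crossed, or has no rich
    child, and the contour climbs, passes over both children by induction and
    comes down. *)
Lemma contour_path H om v : vblock H v -> ~~ rich_block (H - v.2) v om ->
  exists2 s, path (cstep H om) v s & last v s = (v.1.+1, v.2).
Proof.
have [n] := ubnP (H - v.2)%N; elim: n v => // n IH v szn vb nok.
have [fv|nfv] := boolP (failing H v om).
  by exists [:: (v.1.+1, v.2)] => //=; rewrite /cstep eqxx fv !orbT.
move: nfv; rewrite /failing vb nok /= !negb_or => /and3P[vtop n1 n2].
have vH : (v.2 < H)%N by case/andP: vb => _; rewrite ltn_neqAle vtop.
have chb s : vblock H (child v s).
  by rewrite /vblock child_le //; case/andP: vb.
have szc : (H - v.2.+1 < n)%N by rewrite subnSK.
have [s1 p1 l1] := IH (child v false) szc (chb _) n1.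
have [s2 p2 l2] := IH (child v true) szc (chb _) n2.
rewrite /child /= !addn0 in p1 l1; rewrite /child /= !addn1 in p2 l2.
exists ((v.1, v.2.+1) :: s1 ++ s2 ++ [:: (v.1.+1, v.2)]).
  rewrite /= !cat_path p1 l1 p2 l2 /= andbT /cstep eqxx /=.
  by rewrite eqxx orbT.
by rewrite /= !last_cat.
Qed.

Definition cmove (p : nat * nat) (a : 'I_3) : nat * nat :=
  match val a with
  | 0 => (p.1, p.2.+1) | 1 => (p.1.-1, p.2.-1) | _ => (p.1.+1, p.2)
  end.
(** The blocks crossed to the right by a walk, encoded as a word in three
    letters: 0 for up, 1 for down to the left, 2 for right. *)
Fixpoint crossed (p : nat * nat) (ws : seq 'I_3) : seq (nat * nat) :=
  if ws is a :: ws' then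
    let s := crossed (cmove p a) ws' in
    if val a == 2 then p :: s else s
  else [::].

(** The two last equations count steps: dn is the number of steps down. The
    displacement of the walk gives the number of steps to the right and the
    total length. *)
Lemma contour_word H om p s : path (cstep H om) p s ->
  exists ws dn, [/\ size ws = size s, subseq (crossed p ws) (belast p s),
    all (fun v => failing H v om) (crossed p ws),
    ((last p s).1 + dn = p.1 + size (crossed p ws))%N &
    (size s + p.2 = size (crossed p ws) + dn + dn + (last p s).2)%N].
Proof.
elim: s p => [|q s IH] p /=.
  by move=> _; exists [::], 0%N; split=> //=; lia.
case/andP => pq /IH[ws [dn [zw sw aw e1 e2]]].
have sub : subseq (crossed q ws) (p :: belast q s).
  by apply: (subseq_trans sw); apply: subseq_cons.
case/or3P: pq => [/eqP eq|/eqP ep|/andP[/eqP eq fp]].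
- exists (@Ordinal 3 0 isT :: ws), dn.
  have -> : crossed p (@Ordinal 3 0 isT :: ws) = crossed q ws.
    by rewrite /= /cmove /= eq.
  by split=> //=; rewrite ?zw //; move: e1 e2; rewrite eq /=; lia.
- exists (@Ordinal 3 1 isT :: ws), dn.+1.
  have -> : crossed p (@Ordinal 3 1 isT :: ws) = crossed q ws.
    by rewrite /= /cmove /= ep; case: (q).
  by split=> //=; rewrite ?zw //; move: e1 e2; rewrite ep /=; lia.
- exists (@Ordinal 3 2 isT :: ws), dn.
  have -> : crossed p (@Ordinal 3 2 isT :: ws) = p :: crossed q ws.
    by rewrite /= /cmove /= eq.
  by split; rewrite /= ?zw ?eqxx ?fp //; move: e1 e2; rewrite eq /=; lia.
Qed.

(** Removing loops makes the contour self-avoiding, so that the crossed blocks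
    are distinct; as it moves by (1, 0) in total, it has one more step to the
    right than steps down, and as many steps up as down. *)
Lemma contour_word_uniq H om v : vblock H v -> ~~ rich_block (H - v.2) v om ->
  exists f (ws : (3 * f).+1.-tuple 'I_3),
    [/\ (f < H.+1 * H.+1)%N, size (crossed v ws) = f.+1, uniq (crossed v ws)
      & all (fun v => failing H v om) (crossed v ws)].
Proof.
move=> vb nok; have [s0 p0 l0] := contour_path vb nok.
case/shortenP: p0 l0 => s ps us _ ls.
have [ws [dn [zw sw aw e1 e2]]] := contour_word ps.
rewrite ls /= in e1 e2.
have szf : size (crossed v ws) = dn.+1 by lia.
have uw : uniq (crossed v ws).
  apply: (subseq_uniq sw); move: us; rewrite lastI rcons_uniq => /andP[_ ->] //.
have szw : size ws == (3 * dn).+1 by rewrite zw; lia.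
exists dn, (Tuple szw); split=> //.
rewrite -szf /=; have <- : size [seq (k, y) | k <- iota 0 H.+1, y <- iota 0 H.+1] = (H.+1 * H.+1)%N.
  by rewrite size_allpairs !size_iota.
apply: uniq_leq_size => // p /(allP aw) /and3P[vp _ _].
by rewrite mem_pairs !mem_iota; case/andP: vp; case: p => k y /=; lia.
Qed.

Section MacroProbability.
Variables (R : realFieldType) (w : coordT -> R).
Variables (p eps pm D J0 delta : R) (bud : nat).
Hypothesis w01 : forall c, 0 <= w c <= 1.
Hypothesis w_root_state : forall v t i, (t < g)%N -> (i < N)%N -> w (coord_at v t (root_state i)) = p.
Hypothesis w_land_state : forall v t i, (t < g)%N -> (i < N)%N -> w (coord_at v t (land_state i)) = p.
Hypothesis w_vert_edge : forall v t i, (t < g)%N -> (i < N)%N -> w (coord_at v t (vert_edge i)) = eps.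
Hypothesis pm_gt0 : 0 < pm.
Hypothesis pm_le : pm <= p /\ pm <= 1 - p.
Hypothesis eps01 : 0 < eps <= 1.
Hypothesis deg : forall v t z X, (t < g)%N -> (z < N)%N -> (size X <= bud)%N ->
  D <= \sum_(y <- avail (iota 0 N) X) w (tree_coord v t z y).
Hypothesis D_large : (2 ^ (M + 4))%:R <= D.
Hypothesis tau_small :
  2 ^+ d * ((1 - 3 / 8 * p) ^+ M + (1 - 3 / 8 * (1 - p)) ^+ M) <= 1 / 8.
Hypothesis Hbud : (1 + explore_cost M depth <= bud)%N.
Hypothesis J0_ge0 : 0 <= J0.
Hypothesis jump : forall v t i s A, (t < g)%N -> (i < N)%N -> uniq A ->
  all (vsite g N) A -> (r <= size A)%N ->
  J0 <= \sum_(u <- A) w (coord_at v t (jump_edge s i u)).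
Hypothesis jump_small : (2 ^ depth * 4)%:R * (1 + (d ^ depth)%:R * J0)^-1 <= 1 / 4.
Hypothesis N_gt0 : (0 < N)%N.
Hypothesis g_gt0 : (0 < g)%N.
Hypothesis r_small : r%:R <= eps * pm ^+ 2 / 4 * N%:R.
Hypothesis delta_ge0 : 0 <= delta.
Hypothesis delta_ge : 4 * (1 - eps * pm ^+ 2 / 4) ^+ g <= delta.
Hypothesis delta_le : delta <= 1 / 216.

Variable H : nat.
Notation EL := (expect w (coords H)).
Definition owned v (c : coordT) := c.1.1 == v.
Definition block_coords v := seq.filter (owned v) (coords H).

Lemma mem_block_coords v t kd : vblock H v -> (t < g)%N -> vkind g N kd -> coord_at v t kd \in block_coords v.
Proof.
by move=> vb tg vk; rewrite mem_filter mem_coords /owned /= eqxx vb tg vk.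
Qed.

Lemma notin_block_coords v (c : coordT) : ~~ owned v c -> c \notin block_coords v.
Proof. by rewrite mem_filter negb_and => ->. Qed.

Lemma child_not_owned v s c : block_reads H (child v s) c -> ~~ owned v c.
Proof.
move=> /and4P[_ _ _]; rewrite /owned /child /=; apply: contraL => /eqP->.
rewrite negb_or; case: v => k y /=; apply/andP; split; last by rewrite -leqNgt leqnSn.
by rewrite xpair_eqE [X in _ && X]ltn_eqF ?andbF ?ltnSn.
Qed.

(** The blocks of the lines above being frozen, the targets are deterministic.
    *)
Lemma tree_good_fail_on v u s (o : Om) : vblock H v -> vsite g N u ->
  forall A : bool -> bool -> seq site,
  (forall a b, [/\ uniq (A a b), all (vsite g N) (A a b) & (r <= size (A a b))%N]) ->
  expect w (block_coords v) (fun o => (~~ tree_good N M d depth v u s A o)%:R) o <= 1 / 2.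
Proof.
move=> vb vu A HA; apply: (@tree_good_fail g N M d depth r _ w (block_coords v) v p eps pm D J0 bud) => //.
- by move=> t kd tg vk; apply: mem_block_coords.
- by move=> *; apply: w_root_state.
- by move=> *; apply: deg.
- by move=> *; apply: jump.
Qed.

Lemma rich_targets v h (o : Om) a b : rich_block h v o ->
  [/\ uniq (targets g N v (good h v) o a b), all (vsite g N) (targets g N v (good h v) o a b)
    & (r <= size (targets g N v (good h v) o a b))%N].
Proof.
move=> /forallP/(_ a)/forallP/(_ b) rA; split=> //; first exact: targets_uniq.
by apply/allP => u; apply: targets_vsite.
Qed.

(** The lines above are frozen, so that the choice of a child and the targets
    are deterministic; then [rich_fail] applies. *)
Lemma fail_prob v o : expect w (block_coords v) (fun o => (failing H v o)%:R) o <= delta.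
Proof.
case: (boolP (vblock H v)) => [vb|nvb]; last first.
  apply: le_trans delta_ge0; apply: expect_le_const => // o'.
  by rewrite /failing (negbTE nvb).
have rich_bound G : (forall u, vsite g N u -> depends_on (G u) (root_reads g N v u.1 u.2) /\
     forall o, expect w (block_coords v) (fun o => (~~ G u o)%:R) o <= 1 / 2) ->
  expect w (block_coords v) (fun o => (~~ rich r (targets g N v G o))%:R) o <= delta.
  move=> HG; apply: le_trans delta_ge.
  apply: (@rich_fail g N r _ w (block_coords v) v p eps pm) => //.
  - by move=> t kd tg vk; apply: mem_block_coords.
  - by move=> *; apply: w_root_state.
  - by move=> *; apply: w_land_state.
  - by move=> *; apply: w_vert_edge.
move: (vb) => /andP[v12 vH].
have [vtop|vtop] := eqVneq v.2 H.
  apply: le_trans (rich_bound (fun u o => true) _); last first.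
    by move=> u vu; split=> // o'; rewrite /= expect_const /=; lra.
  apply: expect_le => // o'; rewrite /failing vtop subnn /rich_block; case: vblock => //=.
  by rewrite eqxx andbT.
set h := (H - v.2.+1)%N.
have Hh : (H - v.2 = h.+1)%N by rewrite /h subnSK // ltn_neqAle vtop.
have ok_same s o' : (forall c, c \notin block_coords v -> o' c = o c) ->
    targets g N (child v s) (good h (child v s)) o' = targets g N (child v s) (good h (child v s)) o.
  move=> Ho; apply: (@targets_depends H) => [||c /child_not_owned /notin_block_coords]; last exact: Ho.
    exact: child_le.
  by rewrite /h subnKC // ltn_neqAle vtop.
case: (boolP (rich_block h (child v false) o || rich_block h (child v true) o)) => [Hok|Hnok]; last first.
  apply: le_trans delta_ge0; rewrite -[leRHS](expect_const w (block_coords v) 0 o).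
  apply: expect_le_on => // o' Ho; rewrite /failing -/h (negbTE vtop) /rich_block !ok_same //.
  by rewrite -!/(rich_block _ _ _) (negbTE Hnok) !andbF.
set s := ~~ rich_block h (child v false) o.
have oks : rich_block h (child v s) o by rewrite /s; case: (boolP (rich_block _ _ _)) Hok => //=.
pose A := targets g N (child v s) (good h (child v s)) o.
apply: le_trans (rich_bound (fun u => tree_good N M d depth v u s A) _); last first.
  move=> u vu; split; last by move=> o'; apply: tree_good_fail_on => // a b; apply: rich_targets.
  by apply: tree_good_dep => // a b u'; exact: targets_vsite.
apply: expect_le_on => // o' Ho; rewrite /failing Hh.
have -> : rich_block h.+1 v o' = rich r (targets g N v (fun u => tree_good N M d depth v u s A) o').
  rewrite /rich_block; apply: (congr1 (rich r)); apply: funext => a; apply: funext => b.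
  apply: eq_filter => u; rewrite /in_class /=.
  by rewrite !ok_same // -/(rich_block _ _ _) -/s ok_same.
by rewrite ler_nat; case: (rich _ _); case: (vblock _ _) => //=; case: [|| _, _ | _].
Qed.

Lemma min_level (S : seq block) : S != [::] ->
  exists2 v, v \in S & forall v', v' \in S -> (v.2 <= v'.2)%N.
Proof.
elim: S => // v S IH _; have [->|/IH[v0 v0S Hv0]] := eqVneq S [::].
  by exists v; rewrite ?mem_head // => v'; rewrite inE => /eqP->.
case: (leqP v.2 v0.2) => le.
  exists v; rewrite ?mem_head // => v'; rewrite inE => /orP[/eqP->//|/Hv0].
  exact: leq_trans.
exists v0; first by rewrite inE v0S orbT.
by move=> v'; rewrite inE => /orP[/eqP->|/Hv0//]; exact: ltnW.
Qed.

(** Failures of distinct blocks multiply: a block of lowest level owns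
    coordinates that the other blocks do not read, and given the rest it fails
    with probability at most delta. *)
Lemma fail_prod (S : seq block) o : uniq S ->
  EL (fun o => \prod_(v <- S) (failing H v o)%:R) o <= delta ^+ size S.
Proof.
have [n] := ubnP (size S); elim: n S => // n IH S szS uS.
have [->|S0] := eqVneq S [::].
  by rewrite expr0; apply: expect_le_const => // o'; rewrite big_nil.
(* A block of lowest level is read by no other block of S. *)
have [v vS Hv] := min_level S0.
have pS : perm_eq S (v :: rem v S) by exact: perm_to_rem.
have uS' : uniq (rem v S) by exact: rem_uniq.
have szS' : size S = (size (rem v S)).+1 by rewrite (perm_size pS).
pose rest (o : Om) : R := \prod_(v' <- rem v S) (failing H v' o)%:R.
have rest0 o' : 0 <= rest o' by apply: prodr_ge0 => *; rewrite ler0n.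
have rest_dep : depends_on rest (predC (owned v)).
  move=> o1 o2 Ho; apply: eq_big_seq => v'; rewrite mem_rem_uniq // inE => /andP[vv' v'S].
  congr (_%:R); congr (nat_of_bool _); apply: (failing_dep (H := H)) => c.
  move=> /and4P[_ _ _ cv]; apply: Ho => /=; apply: contraTN cv => /eqP->.
  by rewrite eq_sym (negbTE vv') /= -leqNgt Hv.
rewrite (@expect_ext _ _ w _ _ (fun o => (failing H v o)%:R * rest o)); last first.
  by move=> o'; rewrite (perm_big _ pS) big_cons.
rewrite (expect_split w (owned v)) szS' exprS.
apply: (@le_trans _ _ (expect w (seq.filter (predC (owned v)) (coords H)) (fun o => delta * rest o) o)).
  apply: expect_le => // o'; rewrite -/(block_coords v).
  rewrite (expect_indepM w (S1 := predT) (S2 := predC (owned v))) //; last 2 first.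
  - by move=> o1 o2 Ho; congr ((failing H v _)%:R); apply: funext => c; apply: Ho.
  - by move=> c; rewrite mem_filter => /andP[/= -> _].
  rewrite (expect_out w01 _ rest_dep); last by move=> c; rewrite mem_filter => /andP[/= -> _].
  by apply: ler_wpM2r => //; apply: fail_prob.
rewrite expect_Z; apply: ler_wpM2l => //.
have -> : expect w (seq.filter (predC (owned v)) (coords H)) rest o = EL rest o.
  rewrite [RHS](expect_split w (owned v)); apply: expect_ext => o'; apply/esym.
  by apply: (expect_out w01 _ rest_dep) => c; rewrite mem_filter => /andP[/= -> _].
by apply: IH => //; rewrite -ltnS -szS'.
Qed.


Lemma geo_sum n : \sum_(f < n) (1 / 8 : R) ^+ f.+1 <= 1 / 4.
Proof.
suff : \sum_(f < n) (1 / 8 : R) ^+ f.+1 <= 1 / 7 - (1 / 8) ^+ n / 7.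
  move=> /le_trans; apply; have : 0 <= (1 / 8 : R) ^+ n by apply: exprn_ge0; lra.
  by move: (_ ^+ n) => x; lra.
elim: n => [|n IH]; first by rewrite big_ord0 expr0; lra.
rewrite big_ord_recr /= !exprS; move: IH; move: (\sum_(_ < _) _) (_ ^+ n) => S x; lra.
Qed.

(** Sum over contours: there are 3 ^ (3 * f + 1) words with f + 1 crossed
    blocks, each of probability at most delta ^ (f + 1), and 27 * delta is at
    most 1 / 8. *)
Lemma not_rich_prob v o : vblock H v ->
  EL (fun o => (~~ rich_block (H - v.2) v o)%:R) o <= 1 / 4.
Proof.
move=> vb.
pose term f (ws : (3 * f).+1.-tuple 'I_3) (o : Om) : R :=
  \prod_(v <- crossed v ws) (failing H v o)%:R.
pose P f (ws : (3 * f).+1.-tuple 'I_3) :=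
  (size (crossed v ws) == f.+1) && uniq (crossed v ws).
apply: (@le_trans _ _ (EL (fun o => \sum_(f < (H.+1 * H.+1)%N)
   \sum_(ws : (3 * f).+1.-tuple 'I_3 | P f ws) term f ws o) o)).
  apply: expect_le => // o'.
  have t0 f ws : 0 <= term f ws o' by apply: prodr_ge0 => *; rewrite ler0n.
  case: (boolP (rich_block _ _ _)) => [_|nok] /=; first by do !(apply: sumr_ge0 => ? _).
  have [f [ws [fH szf uf af]]] := contour_word_uniq vb nok.
  rewrite (bigD1 (Ordinal fH)) //= (bigD1 ws) /=; last by rewrite /P szf eqxx uf.
  have -> : term f ws o' = 1.
    rewrite /term big_seq; apply: big1 => v' /(allP af) -> //.
  by rewrite -addrA lerDl addr_ge0 //; do !(apply: sumr_ge0 => ? _).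
rewrite expect_sum; apply: le_trans (geo_sum (H.+1 * H.+1)); apply: ler_sum => f _.
rewrite expect_sum.
apply: (@le_trans _ _ (\sum_(ws : (3 * f).+1.-tuple 'I_3) delta ^+ f.+1)).
  rewrite [leRHS](bigID (P f)) /= -[leLHS]addr0; apply: lerD; last first.
    by apply: sumr_ge0 => *; apply: exprn_ge0.
  by apply: ler_sum => ws /andP[/eqP <- uw]; apply: fail_prod.
rewrite sumr_const card_tuple card_ord -[leLHS]mulr_natl.
apply: (@le_trans _ _ ((27 * (1 / 216) : R) ^+ f.+1)); last first.
  by rewrite (_ : 27 * (1 / 216) = 1 / 8 :> R) //; lra.
rewrite exprMn; apply: ler_pM; rewrite ?ler0n ?exprn_ge0 //; last first.
  by rewrite lerXn2r // nnegrE; lra.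
have -> : (27 : R) ^+ f.+1 = (3 ^ (3 * f.+1))%:R by rewrite expnM natrX.
by rewrite ler_nat leq_exp2l // ltn_pmul2l.
Qed.

(** The origin is not good if its left child is not rich, or else if its tree
    or its jumps fail. *)
Lemma good_prob u o : (0 < H)%N -> vsite g N u ->
  1 / 4 <= EL (fun o => (good H (0, 0)%N u o)%:R) o.
Proof.
move=> H0 vu; have [h Hh] : exists h, H = h.+1 by exists H.-1; rewrite prednK.
have v0 : vblock H (0, 0)%N by [].
have v1 : vblock H (0, 1)%N by rewrite /vblock Hh.
have Hh1 : (H - (0, 1)%N.2 = h)%N by rewrite Hh subSS subn0.
suff : EL (fun o => (~~ good H (0, 0)%N u o)%:R) o <= 3 / 4.
  move=> Hb; have -> : EL (fun o => (good H (0, 0)%N u o)%:R) o =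
      1 - EL (fun o => (~~ good H (0, 0)%N u o)%:R) o.
    rewrite -[X in X - _](expect_const w (coords H) 1 o) -expect_B; apply: expect_ext => o'.
    by case: (good _ _ _ _); rewrite /= ?subr0 ?subrr.
  by lra.
pose v : block := (0, 0)%N; pose c0 := child v false.
apply: (@le_trans _ _ (EL (fun o => (~~ rich_block h c0 o)%:R
   + (rich_block h c0 o && ~~ good h.+1 v u o)%:R) o)).
  by apply: expect_le => // o'; rewrite Hh; case: (rich_block _ _ _); case: (good _ _ _ _) => /=; lra.
rewrite expect_D; have := not_rich_prob o v1; rewrite Hh1 => H1.
suff : EL (fun o => (rich_block h c0 o && ~~ good h.+1 v u o)%:R) o <= 1 / 2.
  by move: H1; rewrite /c0 /child /=; lra.
rewrite (expect_split w (owned v)); apply: expect_le_const => // o'; rewrite -/(block_coords v).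
have targets_same o2 : (forall c, c \notin block_coords v -> o2 c = o' c) ->
    targets g N c0 (good h c0) o2 = targets g N c0 (good h c0) o'.
  move=> Ho; apply: (@targets_depends H) => [||c /child_not_owned /notin_block_coords]; last exact: Ho.
    exact: child_le.
  by rewrite Hh.
case: (boolP (rich_block h c0 o')) => [ok|nok]; last first.
  rewrite -[leRHS](expect_const w (block_coords v) (1 / 2) o'); apply: expect_le_on => // o2 Ho.
  by rewrite /rich_block targets_same // -/(rich_block _ _ _) (negbTE nok) /=; lra.
apply: le_trans (tree_good_fail_on false o' v0 vu (fun a b => rich_targets a b ok)).
apply: expect_le_on => // o2 Ho; rewrite /rich_block targets_same // -/(rich_block _ _ _) ok /=.
by rewrite -/c0 targets_same // -/(rich_block _ _ _) ok /= -/c0 targets_same.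
Qed.

End MacroProbability.
End Macro.

(** * Measures with independent coordinates *)

Lemma uniq_map_inj (T U : eqType) (f : T -> U) s : uniq (map f s) ->
  {in s &, injective f}.
Proof.
elim: s => //= z s IH /andP[nz us] x y; rewrite !inE.
move=> /orP[/eqP->|xs] /orP[/eqP->|ys] // e; last exact: IH.
  by case/negP: nz; rewrite e map_f.
by case/negP: nz; rewrite -e map_f.
Qed.

Section Transfer.
Variables (R : realType) (P : probability configT R).
Hypothesis indepP : independent_coords P.
Variables (T : eqType) (embed : T -> edge + vertex).

Definition open_prob (s : edge + vertex) : R := fine (P [set c | Defs.coord s c = true]).
Definition weight (x : T) : R := open_prob (embed x).

Lemma measurable_coord s b : measurable ([set c | Defs.coord s c = b] : set configT).
Proof. by apply: sub_sigma_algebra; exists s, b. Qed.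

Lemma P_coord_true s : P [set c | Defs.coord s c = true] = (open_prob s)%:E.
Proof.
rewrite /open_prob fineK // fin_num_measure //; exact: measurable_coord.
Qed.

Lemma open_prob01 s : 0 <= open_prob s <= 1.
Proof.
have m := measurable_coord s true.
rewrite -!lee_fin -P_coord_true measure_ge0 /=; exact: probability_le1.
Qed.

Lemma P_coord s (b : bool) :
  P [set c | Defs.coord s c = b] = (if b then open_prob s else 1 - open_prob s)%:E.
Proof.
case: b; first exact: P_coord_true.
have -> : [set c : configT | Defs.coord s c = false] = ~` [set c | Defs.coord s c = true].
  by apply/seteqP; split=> c /=; case: (Defs.coord s c).
rewrite probability_setC; last exact: measurable_coord.
by rewrite P_coord_true EFinB.
Qed.

Definition cyl (m : seq T) (om : T -> bool) : set configT :=
  [set c | forall x, x \in m -> Defs.coord (embed x) c = om x].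

Lemma cyl_cons x m om : cyl (x :: m) om =
  [set c | Defs.coord (embed x) c = om x] `&` cyl m om.
Proof.
apply/seteqP; split=> c /= H.
  by split=> [|y ym]; apply: H; rewrite inE ?eqxx // ym orbT.
by move=> y; rewrite inE => /orP[/eqP->|]; [exact: H.1|exact: H.2].
Qed.

Lemma measurable_cyl m om : measurable (cyl m om).
Proof.
elim: m => [|x m IH]; last by rewrite cyl_cons; apply: measurableI => //; exact: measurable_coord.
have -> : cyl [::] om = setT by apply/seteqP; split.
exact: measurableT.
Qed.

Lemma P_cyl m om : uniq (map embed m) ->
  P (cyl m om) = (\prod_(x <- m) (if om x then weight x else 1 - weight x))%:E.
Proof.
move=> um; pose S : {fset (edge + vertex)%type} := [fset s in map embed m]%fset.
pose b s := has (fun x => (embed x == s) && om x) m.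
have bE x : x \in m -> b (embed x) = om x.
  move=> xm; apply/hasP/idP => [[y ym /andP[/eqP e oy]]|ox].
    by rewrite -(uniq_map_inj um ym xm e).
  by exists x => //; rewrite eqxx.
have -> : cyl m om = [set c | forall s, s \in S -> Defs.coord s c = b s].
  apply/seteqP; split=> c /= H.
    by move=> s; rewrite !inE /= => /mapP[x xm ->]; rewrite bE // H.
  by move=> x xm; rewrite -bE // H // !inE /= map_f.
rewrite indepP.
rewrite (perm_big (map embed m)); last first.
  by apply: uniq_perm; rewrite ?fset_uniq // => s; rewrite !inE.
rewrite big_map -prodEFin big_seq [RHS]big_seq; apply: eq_bigr => x xm.
by rewrite P_coord bE.
Qed.

(** Induction on l, where the coordinates of m have already been given values.
    *)
Lemma P_dep_aux l : forall m om (F : (T -> bool) -> bool),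
  uniq (map embed (m ++ l)) -> depends_on F (mem (m ++ l)) ->
  let A := cyl m om `&` [set c | F (fun x => Defs.coord (embed x) c)] in
  measurable A /\
  P A = ((\prod_(x <- m) (if om x then weight x else 1 - weight x)) *
         expect weight l (fun o => (F o)%:R) om)%:E.
Proof.
elim: l => [|x l IH] m om F.
  rewrite cats0 => um dF /=.
  case Fom : (F om).
    have -> : cyl m om `&` [set c | F (fun x => Defs.coord (embed x) c)] = cyl m om.
      apply/seteqP; split=> c /= => [[]//|H]; split=> //.
      by rewrite (dF _ om).
    by split; [exact: measurable_cyl|rewrite P_cyl // mulr1].
  have -> : cyl m om `&` [set c | F (fun x => Defs.coord (embed x) c)] = set0.
    apply/seteqP; split=> c //= [H]; rewrite (dF _ om) ?Fom //.
  by split; [exact: measurable0|rewrite measure0 mulr0].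
move=> um dF A.
have pm : perm_eq (m ++ x :: l) ((x :: m) ++ l) by rewrite -cat1s perm_catCA.
have um' : uniq (map embed ((x :: m) ++ l)) by rewrite -(perm_uniq (perm_map embed pm)).
have dF' : depends_on F (mem ((x :: m) ++ l)).
  by apply: depends_sub dF _ => c /=; rewrite (perm_mem pm).
have [mt Pt] := IH (x :: m) (set_coord om x true) F um' dF'.
have [mf Pf] := IH (x :: m) (set_coord om x false) F um' dF'.
have xm : x \notin m.
  move: um' => /= /andP[]; rewrite map_cat mem_cat negb_or => /andP[H _] _.
  by apply: contra H; apply: map_f.
have updm b y : y \in m -> set_coord om x b y = om y.
  by move=> ym; rewrite set_coord_other //; apply: contraNneq xm => <-.
have cylb b : cyl m (set_coord om x b) = cyl m om.
  by apply/seteqP; split=> c /= H y ym; move: (H y ym); rewrite updm.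
have xb b : set_coord om x b x = b by rewrite /set_coord eqxx.
pose Ab b := cyl (x :: m) (set_coord om x b) `&` [set c | F (fun x => Defs.coord (embed x) c)].
have AE : A = Ab true `|` Ab false.
  rewrite /A /Ab !cyl_cons !cylb !xb; apply/seteqP; split=> c /=.
    by case: (Defs.coord (embed x) c) => -[? ?]; [left|right].
  by move=> [[[_ ?] ?]|[[_ ?] ?]].
rewrite AE; split; first exact: measurableU.
transitivity (P (Ab true) + P (Ab false))%E.
  rewrite measureU //; apply/seteqP; split=> c //= -[[H1 _] [H2 _]].
  by have := H1 x (mem_head _ _); rewrite (H2 x (mem_head _ _)) !xb.
have prodb b : \prod_(y <- m) (if set_coord om x b y then weight y else 1 - weight y) =
   \prod_(y <- m) (if om y then weight y else 1 - weight y).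
  by apply: eq_big_seq => y ym; rewrite updm.
rewrite /Ab Pt Pf !big_cons !prodb !xb -EFinD /=; congr EFin; ring.
Qed.

(** An event that reads finitely many coordinates is measurable, and its
    probability is its finite expectation. *)
Lemma P_dep l (F : (T -> bool) -> bool) om : uniq (map embed l) -> depends_on F (mem l) ->
  measurable ([set c | F (fun x => Defs.coord (embed x) c)] : set configT) /\
  P [set c | F (fun x => Defs.coord (embed x) c)] = (expect weight l (fun o => (F o)%:R) om)%:E.
Proof.
move=> ul dF; have := @P_dep_aux l [::] om F ul dF; rewrite big_nil mul1r.
have -> // : cyl [::] om `&` [set c | F (fun x => Defs.coord (embed x) c)] =
   [set c | F (fun x => Defs.coord (embed x) c)].
by apply/seteqP; split=> c //= -[].
Qed.

End Transfer.

(** * Placing the blocks in the lattice *)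

Lemma fset2_eq (K : choiceType) (a b c e : K) :
  [fset a; b]%fset = [fset c; e]%fset -> (a = c /\ b = e) \/ (a = e /\ b = c).
Proof.
move=> H; have Ha : a \in [fset c; e]%fset by rewrite -H !inE eqxx.
have Hb : b \in [fset c; e]%fset by rewrite -H !inE eqxx orbT.
have Hc : c \in [fset a; b]%fset by rewrite H !inE eqxx.
have He : e \in [fset a; b]%fset by rewrite H !inE eqxx orbT.
move: Ha Hb Hc He; rewrite !inE.
move=> /orP[]/eqP ? /orP[]/eqP ? /orP[]/eqP ? /orP[]/eqP ?; subst; tauto.
Qed.

(** The second case is a default for pairs that are not edges; it does not
    occur for coordinates in range. *)
Definition mk_edge (a b : vertex) : edge + vertex :=
  if (insub [fset a; b]%fset : option edge) is Some e then inl e else inr a.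

Lemma mk_edgeP a b : is_edge [fset a; b]%fset ->
  exists2 e : edge, mk_edge a b = inl e & val e = [fset a; b]%fset.
Proof.
move=> ab; rewrite /mk_edge; case: insubP => [e _ ve|]; first by exists e.
by move=> /negP; case; apply/asboolP.
Qed.

Section Embedding.
Variables (g N : nat).
Let n := (g * N)%N.

Definition pos (v : nat * nat) : int := (2 * v.1)%N%:Z - v.2%:Z.
Definition loc (u : nat * nat) : nat := (u.1 * N + u.2)%N.
(** The root (land = false) or the landing vertex below it (land = true) of
    the site u in the block v. *)
Definition vtx (land : bool) (v u : nat * nat) : vertex :=
  (pos v * n%:Z + (loc u)%:Z, v.2%:Z - land%:Z).

Definition embed (c : coordT) : edge + vertex :=
  let: ((v, t), ((tag, i), (a, b))) := c in
  match tag with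
  | 0 => inr (vtx false v (t, i))
  | 1 => inr (vtx true v (t, i))
  | 2 => mk_edge (vtx false v (t, i)) (vtx true v (t, i))
  | 3 => mk_edge (vtx false v (t, i)) (vtx false v (t, b))
  | 4 => mk_edge (vtx false v (t, i)) (vtx true (child v false) (a, b))
  | _ => mk_edge (vtx false v (t, i)) (vtx true (child v true) (a, b))
  end.

Lemma loc_lt u : vsite g N u -> (loc u < n)%N.
Proof. by case: u => a b /andP[/= ag bN]; rewrite /loc /n /=; nia. Qed.

Lemma loc_inj u u' : vsite g N u -> vsite g N u' -> loc u = loc u' -> u = u'.
Proof.
case: u u' => [a b] [a' b'] /andP[/= _ bN] /andP[/= _ bN']; rewrite /loc /= => e.
have N0 : (0 < N)%N by apply: leq_ltn_trans bN.
have := congr1 (fun x => x %/ N)%N e; have := congr1 (fun x => x %% N)%N e.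
by rewrite !modnMDl !modn_small // !divnMDl // !divn_small // !addn0 => -> ->.
Qed.

Lemma pos_loc_inj (j j' : int) (l l' : nat) : (l < n)%N -> (l' < n)%N ->
  j * n%:Z + l%:Z = j' * n%:Z + l'%:Z -> j = j' /\ l = l'.
Proof.
move=> ln ln' e; have : j = j' by move: (n) ln ln' e => m *; nia.
by move=> ej; split=> //; move: e; rewrite ej => /addrI [].
Qed.

(** Roots of line y lie in intervals whose number has the parity of y, landing
    vertices of line y in intervals of the other parity. *)
Lemma vtx_inj l v u l' v' u' : vsite g N u -> vsite g N u' ->
  vtx l v u = vtx l' v' u' -> [/\ l = l', v = v' & u = u'].
Proof.
move=> vu vu' [e1 e2]; have [ep el] := pos_loc_inj (loc_lt vu) (loc_lt vu') e1.
have -> := loc_inj vu vu' el.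
move: ep e2; rewrite /pos; case: v v' {e1} => [k y] [k' y'] /=.
by case: l; case: l' => /=; split=> //; try congr pair; lia.
Qed.

Lemma vertical_edge v u : is_edge [fset vtx false v u; vtx true v u]%fset.
Proof.
left; exists (pos v * n%:Z + (loc u)%:Z), (v.2%:Z), (v.2%:Z - 1).
by split; [lia|rewrite /vtx /= subr0].
Qed.

Lemma horizontal_tree v t i b :
  horizontal (absz (i%:Z - b%:Z)%R) [fset vtx false v (t, i); vtx false v (t, b)]%fset.
Proof.
exists (pos v * n%:Z + (loc (t, i))%:Z), (pos v * n%:Z + (loc (t, b))%:Z), (v.2%:Z - 0).
by split=> //; rewrite /loc /=; lia.
Qed.

Definition jump_len (s : bool) (u u' : nat * nat) : nat :=
  absz ((if s then - n%:Z else n%:Z) + (loc u)%:Z - (loc u')%:Z)%R.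

Lemma horizontal_jump v s u u' :
  horizontal (jump_len s u u') [fset vtx false v u; vtx true (child v s) u']%fset.
Proof.
exists (pos v * n%:Z + (loc u)%:Z), (pos (child v s) * n%:Z + (loc u')%:Z), v.2%:Z.
split; last by rewrite /vtx /child /= subr0 -addn1 PoszD addrK.
rewrite /jump_len /pos /child /=; case: s => /=; rewrite ?addn0 ?addn1; nia.
Qed.

Lemma jump_len_lt s u u' : vsite g N u -> vsite g N u' -> (jump_len s u u' < 2 * n)%N.
Proof.
move=> /loc_lt l1 /loc_lt l2; rewrite /jump_len.
by move: (n) (loc u) (loc u') l1 l2 => m a b *; case: s; lia.
Qed.

Lemma jump_len_gt0 s u u' : vsite g N u -> vsite g N u' -> (0 < jump_len s u u')%N.
Proof.
move=> /loc_lt l1 /loc_lt l2; rewrite /jump_len.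
by move: (n) (loc u) (loc u') l1 l2 => m a b *; case: s; lia.
Qed.

(** The other endpoint of an edge coordinate, whose first endpoint is always
    the root of the site (t, i). The last case stands for jumps to the right
    child. *)
Definition far_end (kd : kind) (v : nat * nat) t : bool * (nat * nat) * (nat * nat) :=
  let: ((tag, i), (a, b)) := kd in
  match tag with
  | 2 => (true, v, (t, i))
  | 3 => (false, v, (t, b))
  | 4 => (true, child v false, (a, b))
  | _ => (true, child v true, (a, b))
  end.

Definition far_vtx (x : bool * (nat * nat) * (nat * nat)) := vtx x.1.1 x.1.2 x.2.

Lemma embed_state (c : coordT) : vkind g N c.2 -> (c.2.1.1 < 2)%N ->
  embed c = inr (vtx (c.2.1.1 == 1%N) c.1.1 (c.1.2, c.2.1.2)).
Proof. by case: c => [[v t] [[tag i] [a b]]] /=; case: tag => [|[|tag]]. Qed.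

Lemma embed_edge (c : coordT) : (c.1.2 < g)%N -> vkind g N c.2 -> (2 <= c.2.1.1)%N ->
  exists2 e : edge, embed c = inl e &
    val e = [fset vtx false c.1.1 (c.1.2, c.2.1.2); far_vtx (far_end c.2 c.1.1 c.1.2)]%fset.
Proof.
case: c => [[v t] [[tag i] [a b]]] /= tg.
case: tag => [|[|[|[|[|[|tag]]]]]] //= vk _; apply: mk_edgeP; rewrite /far_vtx /=.
- exact: vertical_edge.
- right; exists (absz (i%:Z - b%:Z)%R); last exact: horizontal_tree.
  by case/and3P: vk => *; lia.
- have /and3P[iN ag bN] := vk; right; exists (jump_len false (t, i) (a, b)); last exact: horizontal_jump.
  by apply: jump_len_gt0; rewrite /vsite /= ?tg ?ag.
- have /and3P[iN ag bN] := vk; right; exists (jump_len true (t, i) (a, b)); last exact: horizontal_jump.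
  by apply: jump_len_gt0; rewrite /vsite /= ?tg ?ag.
Qed.

Lemma vkind_i kd : vkind g N kd -> (kd.1.2 < N)%N.
Proof.
case: kd => [[tag i] [a b]] /=.
by case: tag => [|[|[|[|[|[|tag]]]]]] //= /and3P[? ? ?]; lia.
Qed.

Lemma far_end_site kd v t : (t < g)%N -> vkind g N kd -> (2 <= kd.1.1)%N ->
  vsite g N (far_end kd v t).2.
Proof.
move=> tg; case: kd => [[tag i] [a b]] /=.
by case: tag => [|[|[|[|[|[|tag]]]]]] //= /and3P[h1 h2 h3] _; rewrite /vsite /= ?tg ?h1 ?h2 ?h3.
Qed.

(** Roots, landing vertices and their names determine one another ([vtx_inj]),
    and an edge is determined by its endpoints up to exchange; exchange is
    only possible inside a sub-block, where the naming is symmetric. *)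
Lemma embed_inj H : {in coords g N H &, injective embed}.
Proof.
move=> c c'; rewrite !mem_coords => /and3P[_ tg vk] /and3P[_ tg' vk'] e.
have vs : vsite g N (c.1.2, c.2.1.2) by rewrite /vsite /= tg vkind_i.
have vs' : vsite g N (c'.1.2, c'.2.1.2) by rewrite /vsite /= tg' vkind_i.
case: (ltnP c.2.1.1 2) => tag; case: (ltnP c'.2.1.1 2) => tag'.
- move: e; rewrite (embed_state vk tag) (embed_state vk' tag').
  move=> /(congr1 (fun x => if x is inr v then v else (0, 0) : vertex)) /= e.
  move: (vtx_inj vs vs' e) vk vk' tag tag'.
  case: c c' {e vs vs' tg tg'} => [[[k y] t] [[tg i] [a b]]] [[[k' y'] t'] [[tg' i'] [a' b']]] /=.
  case: tg => [|[|tg]] //; case: tg' => [|[|tg']] //= -[] // _ [-> ->] [-> ->];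
    by move=> /and3P[_ /eqP-> /eqP->] /and3P[_ /eqP-> /eqP->].
- have [e' he' _] := embed_edge tg' vk' tag'.
  by move: e; rewrite (embed_state vk tag) he'; discriminate.
- have [e' he' _] := embed_edge tg vk tag.
  by move: e; rewrite (embed_state vk' tag') he'; discriminate.
- have [e1 he1 ve1] := embed_edge tg vk tag.
  have [e2 he2 ve2] := embed_edge tg' vk' tag'.
  move: e; rewrite he1 he2 => -[e12].
  have s1 := far_end_site c.1.1 tg vk tag.
  have s2 := far_end_site c'.1.1 tg' vk' tag'.
  move: ve1; rewrite e12 ve2 /far_vtx => /fset2_eq[] [] /vtx_inj H1 /vtx_inj H2.
    move: (H1 vs' vs) (H2 s2 s1) vk vk' tag tag'.
    case: c c' {e12 he1 he2 ve2 H1 H2 vs vs' tg tg' s1 s2} =>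
      [[[k y] t] [[tg i] [a b]]] [[[k' y'] t'] [[tg' i'] [a' b']]] /= [_ [? ?] [? ?]].
    by case: tg => [|[|[|[|[|[|tg]]]]]] //=; case: tg' => [|[|[|[|[|[|tg']]]]]] //= [];
      rewrite /child //= => _ [? ?] [? ?]; do ?[move/and3P=> [? ? ?]] => ? ?;
      do ?congr pair; lia.
  move: (H1 vs' s1) (H2 s2 vs) vk vk' tag tag'.
  case: c c' {e12 he1 he2 ve2 H1 H2 vs vs' tg tg' s1 s2} =>
    [[[k y] t] [[tg i] [a b]]] [[[k' y'] t'] [[tg' i'] [a' b']]] /=.
  by case: tg => [|[|[|[|[|[|tg]]]]]] //=; case: tg' => [|[|[|[|[|[|tg']]]]]] //= [];
      rewrite /child //= => _ [? ?] [? ?] [] // _ [? ?] [? ?];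
      do ?[move/and3P=> [? ? ?]] => ? ?; lia.
Qed.

End Embedding.

(** * Finite words, measurability and compactness *)

Section FinitePaths.
Variable K : nat.

Definition link_at (c : config) (a b : vertex) (e : edge) : Prop :=
  [/\ val e = [fset a; b]%fset, (dist1 a b <= K)%N & c.1 e = true].
Definition link (c : config) (a b : vertex) : bool := `[< exists e, link_at c a b e >].

Definition fpath_sees (c : config) (v : vertex) (xi : seq bool) (s : seq vertex) :=
  [&& uniq (v :: s), path (link c) v s & map c.2 s == xi].

(** All words of length m are seen from the origin; this event is decreasing
    in m. *)
Definition sees_all m : set configT :=
  [set c | forall xi : seq bool, size xi = m ->
     exists s, fpath_sees c (0, 0) xi s].

Lemma sees_all_S m : sees_all m.+1 `<=` sees_all m.
Proof.
move=> c H xi sxi; have [|s] := H (rcons xi true); first by rewrite size_rcons sxi.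
move=> /and3P[us ps /eqP es].
case/lastP: s us ps es => [|s x]; first by move=> _ _; case: (xi).
rewrite -rcons_cons rcons_uniq rcons_path map_rcons.
move=> /andP[_ us] /andP[ps _] /rcons_inj[es _]; exists s.
by rewrite /fpath_sees us ps es eqxx.
Qed.

Lemma sees_all_le m m' : (m <= m')%N -> sees_all m' `<=` sees_all m.
Proof.
move=> /subnK<-; elim: (m' - m)%N => [|k IH] //=.
by rewrite addSn; apply: subset_trans IH; exact: sees_all_S.
Qed.

Lemma measurable_link a b : measurable ([set c | link c a b] : set configT).
Proof.
have [[e ve]|ne] := pselect (exists e : edge, val e = [fset a; b]%fset); last first.
  have -> : ([set c | link c a b] : set configT) = set0.
    by apply/seteqP; split=> c //= /asboolP[e [ve _ _]]; apply: ne; exists e.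
  exact: measurable0.
case dK : (dist1 a b <= K)%N; last first.
  have -> : ([set c | link c a b] : set configT) = set0.
    by apply/seteqP; split=> c //= /asboolP[e' [_]]; rewrite dK.
  exact: measurable0.
have -> : ([set c | link c a b] : set configT) = [set c | Defs.coord (inl e) c = true].
  apply/seteqP; split=> c /=.
    by move=> /asboolP[e' [ve' _ <-]]; congr (c.1 _); apply: val_inj; rewrite ve ve'.
  by move=> ce; apply/asboolP; exists e.
exact: measurable_coord.
Qed.

(** A single path is a finite intersection of cylinders; there are countably
    many paths and finite words. *)
Lemma measurable_fpath v xi s : measurable ([set c | fpath_sees c v xi s] : set configT).
Proof.
have mbool (b : bool) : measurable ([set c | b] : set configT).
  case: b; last by rewrite (_ : [set _ | _] = set0) //; apply/seteqP; split.
  by rewrite (_ : [set _ | _] = setT) //; apply/seteqP; split.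
have -> : ([set c | fpath_sees c v xi s] : set configT) =
  ([set c | uniq (v :: s)] `&` [set c | path (link c) v s]) `&` [set c : config | map c.2 s == xi].
  apply/seteqP; split=> c; first by move=> H; case/and3P: (H : is_true (fpath_sees c v xi s)).
  by move=> [[us ps] es]; apply/and3P; split.
apply: measurableI; first apply: measurableI; first exact: mbool.
  elim: s v => [|x s IH] v /=; first exact: (mbool true).
  have -> : ([set c | link c v x && path (link c) x s] : set configT) =
     [set c | link c v x] `&` [set c | path (link c) x s].
    by apply/seteqP; split=> c /=; [move=> /andP|move=> ?; apply/andP].
  by apply: measurableI => //; exact: measurable_link.
elim: s xi => [|x s IH] [|b xi] /=; [exact: (mbool true)|exact: (mbool false)|exact: (mbool false)|].
have -> : ([set c : config | c.2 x :: map c.2 s == b :: xi] : set configT) =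
   [set c | Defs.coord (inr x) c = b] `&` [set c : config | map c.2 s == xi].
  apply/seteqP; split=> c /=; rewrite eqseq_cons.
    by move=> /andP[/eqP-> ->].
  by move=> [-> ->]; rewrite eqxx.
by apply: measurableI => //; exact: measurable_coord.
Qed.

Lemma bigcup_countable_measurable (I : countType) (F : I -> set configT) :
  (forall i, measurable (F i)) -> measurable (\bigcup_i F i).
Proof.
move=> mF; have -> : \bigcup_i F i =
    \bigcup_(k : nat) (if (choice.unpickle k : option I) is Some i then F i else set0).
  apply/seteqP; split=> c [k _ Hk].
    by exists (choice.pickle k) => //; rewrite choice.pickleK.
  by move: Hk; case: choice.unpickle => // i Fi; exists i.
by apply: bigcupT_measurable => k; case: choice.unpickle.
Qed.

Lemma bigcap_countable_measurable (I : countType) (F : I -> set configT) :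
  (forall i, measurable (F i)) -> measurable (\bigcap_i F i).
Proof.
move=> mF; rewrite -[X in measurable X]setCK setC_bigcap; apply: measurableC.
by apply: bigcup_countable_measurable => i; exact: measurableC.
Qed.

Lemma measurable_sees_all m : measurable (sees_all m).
Proof.
have -> : sees_all m = \bigcap_(xi : seq bool) (if size xi == m
    then \bigcup_(s : seq (int * int)) [set c | fpath_sees c (0, 0) xi s] else setT).
  apply/seteqP; split=> c H.
    by move=> xi _; case: eqP => // /H[s Hs]; exists s.
  by move=> xi sxi; have := H xi I; rewrite sxi eqxx => -[s _ Hs]; exists s.
apply: bigcap_countable_measurable => xi; case: ifP => // _.
by apply: bigcup_countable_measurable => s; exact: measurable_fpath.
Qed.

Lemma seen_sees_all c : words_seen K c = setT -> forall m, sees_all m c.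
Proof.
move=> Hall m xi sxi.
have [w [w0 wi ww]] : seen K c (0, 0) (fun i => nth false xi i).
  by have : words_seen K c (fun i => nth false xi i) by rewrite Hall.
exists [seq w i.+1 | i <- iota 0 m].
have -> : (0, 0) = w 0%N :> vertex by [].
apply/and3P; split.
- have -> : w 0%N :: [seq w i.+1 | i <- iota 0 m] = [seq w i | i <- iota 0 m.+1].
    by rewrite /= -[1%N]addn0 iotaDl -map_comp.
  by rewrite map_inj_uniq ?iota_uniq.
- apply/(pathP (w 0%N)) => i; rewrite size_map size_iota => im.
  rewrite (nth_map 0%N) ?size_iota // nth_iota // add0n.
  have -> : nth (w 0%N) (w 0%N :: [seq w i.+1 | i <- iota 0 m]) i = w i.
    case: i im => [|i] im //=; rewrite (nth_map 0%N) ?size_iota 1?ltnW //.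
    by rewrite nth_iota 1?ltnW // add0n.
  by apply/asboolP; have [e [e1 e2 e3 _]] := ww i; exists e.
- apply/eqP; apply: (@eq_from_nth _ false); rewrite !size_map size_iota ?sxi //.
  move=> i im; rewrite -map_comp (nth_map 0%N) ?size_iota // nth_iota // add0n /=.
  by have [e [_ _ _]] := ww i.
Qed.

Definition nbrs (v : vertex) : seq vertex :=
  [seq (v.1 + i%:Z - K%:Z, v.2 + j%:Z - K%:Z) | i <- iota 0 (2 * K).+1, j <- iota 0 (2 * K).+1].

Lemma mem_nbrs u v : (dist1 u v <= K)%N -> v \in nbrs u.
Proof.
case: u v => [a b] [a' b']; rewrite /dist1 /= => d.
apply/allpairsP; exists (absz (a' - a + K%:Z), absz (b' - b + K%:Z)).
rewrite !mem_iota; split=> /=; [lia|lia|].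
have -> : a' = a + (absz (a' - a + K%:Z))%:Z - K%:Z by lia.
have -> : b' = b + (absz (b' - b + K%:Z))%:Z - K%:Z by lia.
congr pair; lia.
Qed.

Section Konig.
Variables (c : config) (xi : nat -> bool) (O : vertex).
Definition prefix_seen s := fpath_sees c O (mkseq xi (size s)) s.

Lemma prefix_seen_cat s s' : prefix_seen (s ++ s') -> prefix_seen s.
Proof.
rewrite /prefix_seen /fpath_sees => /and3P[us ps es]; apply/and3P; split.
- by move: us; rewrite -cat_cons cat_uniq => /andP[].
- by move: ps; rewrite cat_path => /andP[].
- move: es; rewrite /mkseq size_cat iotaD !map_cat eqseq_cat; last by rewrite !size_map size_iota.
  by case/andP.
Qed.

(** Koenig's lemma follows a path that has extensions of every length. *)
Definition extendable s := forall m, (size s <= m)%N ->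
  exists s', prefix_seen (s ++ s') /\ size (s ++ s') = m.

(** If no neighbour of the endpoint kept extensions of every length, then the
    finitely many neighbours would all be stuck at some common length. *)
Lemma extendable_step s : extendable s -> exists x, extendable (rcons s x).
Proof.
move=> es; apply: contrapT => /forallNP Hn.
have Hm x : exists m, (size s < m)%N /\ ~ (exists s', prefix_seen (rcons s x ++ s') /\ size (rcons s x ++ s') = m).
  have /existsNP[m /not_implyP[sm nm]] := Hn x.
  by exists m; split=> //; rewrite size_rcons in sm.
have [f Hf] := choice Hm.
(* Beyond length mx no neighbour can be followed. *)
pose mx := \max_(x <- nbrs (last O s)) f x.
have [|s' [vs' zs']] := es (size s + mx.+1)%N; first by rewrite leq_addr.
case: s' vs' zs' => [|x s'] vs' zs'; first by rewrite cats0 in zs'; lia.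
have xn : x \in nbrs (last O s).
  move: (vs') => /and3P[_]; rewrite cat_path /= => /andP[_ /andP[/asboolP[e [_ d _]] _]] _.
  exact: mem_nbrs.
have fm : (f x <= mx)%N by rewrite /mx; exact: leq_bigmax_seq.
have [sf nf] := Hf x; apply: nf.
exists (take (f x - (size s).+1) s').
rewrite -cat_rcons in vs' zs'.
split.
  apply: (@prefix_seen_cat _ (drop (f x - (size s).+1) s')).
  by rewrite -catA cat_take_drop.
move: zs'; rewrite !size_cat size_rcons size_take_min => zs'.
by rewrite (minn_idPl _); lia.
Qed.

Lemma konig : extendable [::] -> seen K c O xi.
Proof.
move=> e0.
have Hc s : exists y, extendable s -> extendable (rcons s y).
  have [/extendable_step[x Hx]|ns] := pselect (extendable s); first by exists x.
  by exists O.
have [f Hf] := choice Hc.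
pose S k := iter k (fun s => rcons s (f s)) [::].
have eS k : extendable (S k) by elim: k => // k IH; apply: Hf.
have zS k : size (S k) = k by elim: k => // k IH; rewrite /= size_rcons IH.
pose w k := last O (S k).
have wS k : O :: S k = mkseq w k.+1.
  elim: k => // k IH; rewrite mkseqS -IH.
  by rewrite /w /= last_rcons.
have vS k : prefix_seen (S k).
  have [|s' [vs' zs']] := eS k k; first by rewrite zS.
  exact: prefix_seen_cat vs'.
exists w; split=> //.
- move=> i j wij; have /and3P[us _ _] := vS (maxn i j).
  move: us; rewrite wS => /(uniqP O); rewrite size_mkseq => /(_ i j).
  rewrite !inE !ltnS leq_maxl leq_maxr => /(_ isT isT); apply.
  by rewrite !nth_mkseq // ltnS ?leq_maxl ?leq_maxr.
- move=> i; have /and3P[_ ps es] := vS i.+1.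
  move: ps es; rewrite /= rcons_path => /andP[_ /asboolP[e [e1 e2 e3]]].
  rewrite size_rcons zS mkseqS map_rcons => /eqP/rcons_inj[_ e4].
  by exists e; split=> //; rewrite /w /= ?last_rcons.
Qed.
End Konig.

Lemma sees_all_seen c : (forall m, sees_all m c) -> words_seen K c = setT.
Proof.
move=> H; apply/seteqP; split=> // xi _; apply: konig => m _.
have [|s Hs] := H m (mkseq xi m); first by rewrite size_mkseq.
exists s; rewrite cat0s.
have zs : size s = m.
  by move: (Hs) => /and3P[_ _ /eqP/(congr1 size)]; rewrite size_map size_mkseq.
by split=> //; rewrite /prefix_seen zs.
Qed.

(** For a fixed configuration this is compactness: edges have length at most
    K, so every vertex has finitely many neighbours. *)
Lemma words_seenE : ([set c | words_seen K c = setT] : set configT) = \bigcap_m sees_all m.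
Proof.
apply/seteqP; split=> c /=.
  by move=> /seen_sees_all H m _; apply: H.
by move=> H; apply: sees_all_seen => m; apply: H.
Qed.

Lemma prob_words_seen (R : realType) (P : probability configT R) (a : R) :
  (forall m, exists2 m', (m <= m')%N & (a%:E <= P (sees_all m'))%E) ->
  (a%:E <= P [set c | words_seen K c = setT])%E.
Proof.
move=> H; rewrite words_seenE.
have cv : P (sees_all m) @[m --> \oo] --> P (\bigcap_m sees_all m).
  apply: nonincreasing_cvg_mu => //.
  - by rewrite -ge0_fin_numE // fin_num_measure //; exact: measurable_sees_all.
  - exact: measurable_sees_all.
  - by apply: bigcapT_measurable; exact: measurable_sees_all.
  - by apply/nonincreasing_seqP => m; apply/subsetPset; exact: sees_all_S.
rewrite -(cvg_lim _ cv) //; apply: lime_ge; first by apply/cvg_ex; eexists; exact: cv.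
near=> m; have [m' mm' Hm'] := H m; apply: le_trans Hm' _.
apply: le_measure; rewrite ?inE; try exact: measurable_sees_all.
exact: sees_all_le.
Unshelve. all: by end_near. Qed.

End FinitePaths.

(** * Good roots see all finite words *)

Lemma path_strengthen (T : eqType) (e e' : rel T) (P : pred T) x s :
  path e x s -> uniq (x :: s) -> all P (x :: s) ->
  (forall a b, P a -> P b -> a != b -> e a b -> e' a b) -> path e' x s.
Proof.
move=> ps us aP H; elim: s x ps us aP => [|y s IH] x //=.
move=> /andP[exy ps] /andP[]; rewrite inE negb_or => /andP[xy _] us /andP[Px aP].
rewrite IH // andbT; apply: H => //; by case/andP: aP.
Qed.

Section GoodPath.
Variables (g N M d depth r : nat) (c : config).
Let K := (2 * (g * N))%N.
Let om : coordT -> bool := fun x => Defs.coord (embed g N x) c.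

Lemma link_tree_edge v t i j : (t < g)%N -> (i < N)%N -> (j < N)%N -> i != j ->
  om (tree_coord v t i j) -> link K c (vtx g N false v (t, i)) (vtx g N false v (t, j)).
Proof.
move=> tg iN jN ij.
have vk := vkind_tree_edge g iN jN ij.
have [e] := @embed_edge g N (tree_coord v t i j) tg vk isT.
rewrite /om => -> ve ce; apply/asboolP; exists e; split=> //.
  rewrite ve /far_vtx /=; case: (leqP i j) => // _; by rewrite fsetUC.
rewrite /dist1 /vtx /loc /K /=; have : (N <= g * N)%N by rewrite leq_pmull //; lia.
by move: (g * N)%N => n; lia.
Qed.

Lemma dist_jump v s u u' : vsite g N u -> vsite g N u' ->
  dist1 (vtx g N false v u) (vtx g N true (child v s) u') = jump_len g N s u u'.
Proof.
move=> vu vu'; rewrite /dist1 /jump_len /vtx /pos /child /=.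
move: (g * N)%N (loc _ _) (loc _ _) => n a b.
have -> : absz (v.2%:Z - 0 - (v.2.+1%:Z - 1))%R = 0%N by lia.
rewrite addn0; congr absz; rewrite -addn1 !PoszM !PoszD.
by case: s => /=; ring.
Qed.

Lemma link_jump_edge v s u u' : vsite g N u -> vsite g N u' ->
  om (coord_at v u.1 (jump_edge s u.2 u')) -> link K c (vtx g N false v u) (vtx g N true (child v s) u').
Proof.
move=> vu vu'; have /andP[tg iN] := vu; have /andP[tg' iN'] := vu'.
have vk : vkind g N (jump_edge s u.2 u').
  by case: u' {vu'} tg' iN' => a b /= ? ?; case: (s); apply/and3P; split.
have [|e] := @embed_edge g N (coord_at v u.1 (jump_edge s u.2 u')) tg vk; first by case: (s).
rewrite /om => -> ve ce; apply/asboolP; exists e; split=> //.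
  by rewrite ve /far_vtx; case: u u' {vk vu vu' tg tg' iN iN' ve} => [? ?] [? ?]; case: (s).
by rewrite dist_jump //; apply: ltnW; apply: jump_len_lt.
Qed.

Lemma link_vert_edge v u : vsite g N u -> om (coord_at v u.1 (vert_edge u.2)) ->
  link K c (vtx g N true v u) (vtx g N false v u).
Proof.
move=> vu; have /andP[tg iN] := vu.
have vk : vkind g N (vert_edge u.2) by rewrite /= iN.
have [//|e] := @embed_edge g N (coord_at v u.1 (vert_edge u.2)) tg vk.
rewrite /om => -> ve ce; apply/asboolP; exists e; split=> //.
  by rewrite ve /far_vtx /= fsetUC; case: (u).
rewrite /dist1 /vtx /K /=; have : (0 < g * N)%N by rewrite muln_gt0; lia.
by move: (g * N)%N (loc _ _) => n a; lia.
Qed.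

(** The path of a word through one level stays on line y until it climbs, so
    that it avoids the path through the levels above, which is obtained by
    induction. *)
Lemma good_path h v u xi : vsite g N u -> good g N M d depth r h v u om ->
  size xi = (h * (depth + 2))%N ->
  exists s, fpath_sees K c (vtx g N false v u) xi s /\
    forall q, q \in s -> v.2%:Z <= q.2.
Proof.
elim: h v u xi => [|h IH] v u xi vu.
  by move=> _ /size0nil->; exists [::].
move=> /= /andP[_]; set s := ~~ _; set A := targets _ _ _ _ _ => /forallP Hall sxi.
pose xi1 := take depth xi; pose xi2 := drop depth xi.
have sxi1 : size xi1 == depth by rewrite size_takel // sxi; lia.
have sxi2 : size xi2 = (h * (depth + 2) + 2)%N by rewrite size_drop sxi; lia.
have xiE : xi = xi1 ++ xi2 by rewrite cat_take_drop.
case: xi2 sxi2 xiE => [|a [|b xi3]]; [by rewrite addn2|by rewrite addn2|].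
rewrite /= addn2 => -[sxi3] xiE.
have /forallP/(_ a)/forallP/(_ b) := Hall (Tuple sxi1).
move=> /hasP[l /reachP[lN [s1 ll /and3P[us1 as1 /andP[ps1 /eqP es1]]]] /hasP[u' u'A Hj]].
have vu' : vsite g N u' by exact: targets_vsite u'A.
move: u'A; rewrite mem_filter => /andP[/and4P[oVE /eqP oSB /eqP oSA Gu'] _].
have [s2 [/and3P[us2 ps2 /eqP es2] ys2]] := IH (child v s) u' xi3 vu' Gu' sxi3.
have /andP[tg iN] := vu; pose w j := vtx g N false v (u.1, j).
have vs j : (j < N)%N -> vsite g N (u.1, j) by move=> jN; rewrite /vsite tg.
pose R1 := map w s1; pose la := vtx g N true (child v s) u'.
pose ro := vtx g N false (child v s) u'.
have wu : vtx g N false v u = w u.2 by rewrite /w; case: (u).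
have y1 q : q \in R1 -> q.2 = v.2%:Z by move=> /mapP[j _ ->]; rewrite /= subr0.
have yla : la.2 = v.2%:Z by rewrite /= -addn1 PoszD addrK.
have yro : ro.2 = v.2%:Z + 1 by rewrite /= subr0 -addn1 PoszD.
have y2 q : q \in ro :: s2 -> v.2%:Z + 1 <= q.2.
  rewrite inE => /orP[/eqP->|/ys2]; first by rewrite yro.
  by rewrite /child /= -addn1 PoszD.
exists (R1 ++ la :: ro :: s2); split; last first.
  move=> q; rewrite mem_cat inE => /orP[/y1->//|/orP[/eqP->|/y2]]; first by rewrite yla.
  by apply: le_trans; rewrite lerDl.
have winj : {in u.2 :: s1 &, injective w}.
  move=> j j' jin j'in /vtx_inj[]; try by move=> _ _ [].
  - by apply: vs; move: jin; rewrite inE => /orP[/eqP->//|/(allP as1)].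
  - by apply: vs; move: j'in; rewrite inE => /orP[/eqP->//|/(allP as1)].
have la1 : la \notin w u.2 :: R1.
  rewrite -map_cons; apply/mapP => -[j jin] /vtx_inj[] //.
  by apply: vs; move: jin; rewrite inE => /orP[/eqP->//|/(allP as1)].
have lt1 : (v.2%:Z + 1 <= v.2%:Z) = false by rewrite gerDl.
have nin q : q \in ro :: s2 -> q \notin w u.2 :: R1.
  move=> /y2 yq; apply/negP; rewrite inE => /orP[/eqP eq|/y1 eq].
    by rewrite eq /= subr0 lt1 in yq.
  by rewrite eq lt1 in yq.
have sN : all (fun j => (j < N)%N) (u.2 :: s1) by rewrite /= iN.
apply/and3P; split.
- rewrite wu -cat_cons cat_uniq; apply/and3P; split.
  + by rewrite -map_cons map_inj_in_uniq.
  + by apply/hasPn => q; rewrite inE => /orP[/eqP->//|/nin].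
  + by rewrite cons_uniq us2 andbT; apply/negP => /y2; rewrite yla lt1.
- rewrite wu cat_path; apply/andP; split.
    rewrite path_map; apply: path_strengthen ps1 us1 sN _ => j j' jN jN' jj'.
    exact: link_tree_edge.
  rewrite /R1 last_map -ll; apply/andP; split.
    by apply: (@link_jump_edge v s (u.1, l)); rewrite ?vs.
  apply/andP; split; last exact: ps2.
  exact: link_vert_edge.
- rewrite map_cat xiE; apply/eqP; congr (_ ++ _).
    by rewrite /R1 -map_comp; exact: es1.
  rewrite /= es2 -oSB -oSA /om /la /ro.
  by case: (u').
Qed.

End GoodPath.

(** * A finite criterion *)

Lemma ler_sum_subseq (R : realFieldType) (I : eqType) (s t : seq I) (f : I -> R) :
  uniq s -> {subset s <= t} -> (forall i, i \in t -> 0 <= f i) ->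
  \sum_(i <- s) f i <= \sum_(i <- t) f i.
Proof.
elim: s t => [|x s IH] t.
  by move=> _ _ f0; rewrite big_nil big_seq; apply: sumr_ge0.
move=> /= /andP[xs us] st f0.
have xt : x \in t by apply: st; rewrite mem_head.
rewrite (perm_big _ (perm_to_rem xt)) !big_cons lerD2l; apply: IH => //.
  move=> y ys; have := st y; rewrite inE ys orbT (perm_mem (perm_to_rem xt)) inE.
  by move=> /(_ isT)/orP[/eqP yx|//]; rewrite yx (negbTE xs) in ys.
by move=> y /mem_rem; apply: f0.
Qed.

Definition idist (z y : nat) : nat := absz (z%:Z - y%:Z)%R.

Lemma idist_add z i : idist z (z + i) = i. Proof. by rewrite /idist; lia. Qed.
Lemma idist_sub z i : (i <= z)%N -> idist z (z - i) = i. Proof. by rewrite /idist; lia. Qed.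
Lemma idist_minmax z y : idist z y = absz ((minn z y)%:Z - (maxn z y)%:Z)%R.
Proof. by rewrite /idist; lia. Qed.
Lemma idist_lt z y N : (z < N)%N -> (y < N)%N -> (idist z y < N)%N.
Proof. by rewrite /idist; lia. Qed.
Lemma right_half N z i : (z < N)%N -> (z <= N.-1 %/ 2)%N -> (i < (N %/ 2).+1)%N ->
  (z + i < N)%N.
Proof. lia. Qed.
Lemma left_half N z i : (N.-1 %/ 2 < z)%N -> (i < (N %/ 2).+1)%N -> (i <= z)%N.
Proof. lia. Qed.
Lemma subn_inj z a b : (a <= z)%N -> (b <= z)%N -> (z - a = z - b)%N -> a = b.
Proof. lia. Qed.
Lemma close_eq (c : int) (a b k : nat) : (absz (c - a%:Z)%R < k)%N ->
  (absz (c - b%:Z)%R < k)%N -> absz (a%:Z - c + k%:Z)%R = absz (b%:Z - c + k%:Z)%R -> a = b.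
Proof. lia. Qed.
Lemma close_lt (c : int) (a k : nat) : (absz (c - a%:Z)%R < k)%N ->
  (absz (a%:Z - c + k%:Z)%R < 2 * k)%N.
Proof. lia. Qed.

Section Criterion.
Variables (R : realType) (q p_ : nat -> R) (p eps pm D : R).
Variables (g N M d depth r m i0 : nat).
Let n := (g * N)%N.
Let K := (2 * n)%N.
Hypothesis p01 : 0 < p < 1.
Hypothesis eps01 : 0 < eps <= 1.
Hypothesis pm_gt0 : 0 < pm.
Hypothesis pm_le : pm <= p /\ pm <= 1 - p.
Hypothesis q_gt0 : forall i, (1 <= i)%N -> 0 < q i.
Hypothesis q_noninc : forall i j, (1 <= i)%N -> (i <= j)%N -> q j <= q i.
Hypothesis i0_gt0 : (1 <= i0)%N.
Hypothesis p_ge_q : forall i, (i0 <= i)%N -> q i <= p_ i.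
Hypothesis i0m : (i0 <= m)%N.
Hypothesis D_large : (2 ^ (M + 4))%:R <= D.
Hypothesis deg : D <= \sum_(m <= i < (N %/ 2).+1) q i - m%:R * q m.
Hypothesis tau_small :
  2 ^+ d * ((1 - 3 / 8 * p) ^+ M + (1 - 3 / 8 * (1 - p)) ^+ M) <= 1 / 8.
Hypothesis Hbud : (1 + explore_cost M depth <= m)%N.
Hypothesis r_large : (2 * i0 <= r)%N.
Let J0 := (r - 2 * i0)%N%:R * q K.
Hypothesis jump_small : (2 ^ depth * 4)%:R * (1 + (d ^ depth)%:R * J0)^-1 <= 1 / 4.
Hypothesis N_gt0 : (0 < N)%N.
Hypothesis g_gt0 : (0 < g)%N.
Hypothesis r_small : r%:R <= eps * pm ^+ 2 / 4 * N%:R.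
Hypothesis delta_ge : 4 * (1 - eps * pm ^+ 2 / 4) ^+ g <= 1 / 216.

Lemma m_gt0 : (0 < m)%N. Proof. exact: leq_trans i0m. Qed.

(** One of the two sides of z in the sub-block has at least N / 2 points. *)
Lemma side_sum z : (z < N)%N ->
  \sum_(m <= i < (N %/ 2).+1) q i <=
  \sum_(y <- [seq y <- iota 0 N | (m <= idist z y)%N]) q (idist z y).
Proof.
move=> zN.
have q0 y : y \in [seq y <- iota 0 N | (m <= idist z y)%N] -> 0 <= q (idist z y).
  rewrite mem_filter => /andP[md _]; apply/ltW/q_gt0; apply: leq_trans md; exact: m_gt0.
have ui := iota_uniq m ((N %/ 2).+1 - m).
have [zl|zr] := leqP z (N.-1 %/ 2).
  apply: le_trans (ler_sum_subseq (s := [seq (z + i)%N | i <- index_iota m (N %/ 2).+1]) _ _ q0).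
  - rewrite big_map le_eqVlt; apply/orP; left; apply/eqP; apply: eq_bigr => i _.
    by rewrite idist_add.
  - by rewrite map_inj_uniq // => a b /addnI.
  - move=> y /mapP[i]; rewrite mem_index_iota => /andP[mi iN] ->.
    by rewrite mem_filter mem_iota idist_add mi add0n right_half.
have le_z i : i \in index_iota m (N %/ 2).+1 -> (i <= z)%N.
  by rewrite mem_index_iota => /andP[_]; apply: left_half.
apply: le_trans (ler_sum_subseq (s := [seq (z - i)%N | i <- index_iota m (N %/ 2).+1]) _ _ q0).
- rewrite big_map le_eqVlt; apply/orP; left; apply/eqP; apply: eq_big_seq => i /le_z iz.
  by rewrite idist_sub.
- by rewrite map_inj_in_uniq // => a b /le_z az /le_z bz; apply: subn_inj.
- move=> y /mapP[i im ->]; have iz := le_z i im; move: im; rewrite mem_index_iota => /andP[mi iN].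
  by rewrite mem_filter mem_iota idist_sub // mi add0n (leq_ltn_trans (leq_subr _ _)).
Qed.

(** The vertices of X are at most m terms of size at most q m, since edges
    shorter than m are not counted. *)
Lemma deg_bound z (X : seq nat) : (z < N)%N -> (size X <= m)%N ->
  D <= \sum_(y <- avail (iota 0 N) X | (m <= idist z y)%N) q (idist z y).
Proof.
move=> zN szX; apply: le_trans deg _; rewrite lerBlDr.
apply: le_trans (side_sum zN) _; rewrite big_filter (bigID (fun y => y \notin X)) /=.
apply: lerD.
  rewrite /avail big_filter_cond le_eqVlt; apply/orP; left; apply/eqP.
  by apply: eq_bigl => y; rewrite andbC.
apply: (@le_trans _ _ (\sum_(y <- iota 0 N | (m <= idist z y)%N && ~~ (y \notin X)) q m)).
  by apply: ler_sum => y /andP[md _]; apply: q_noninc => //; exact: m_gt0.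
rewrite big_const_seq iter_addr_0 -[leLHS]mulr_natl; apply: ler_wpM2r.
  by apply/ltW/q_gt0; exact: m_gt0.
rewrite ler_nat; apply: leq_trans szX; rewrite -size_filter; apply: uniq_leq_size.
  by apply: filter_uniq; exact: iota_uniq.
by move=> y; rewrite mem_filter negbK => /andP[/andP[]].
Qed.

(** The comparison of p with q is only known from length i0 on; at most 2 * i0
    targets are closer than that. *)
Lemma jump_bound s u A : vsite g N u -> uniq A -> all (vsite g N) A ->
  (r <= size A)%N ->
  J0 <= \sum_(u' <- A | (i0 <= jump_len g N s u u')%N) q (jump_len g N s u u').
Proof.
move=> vu uA vA rA.
apply: (@le_trans _ _ (\sum_(u' <- A | (i0 <= jump_len g N s u u')%N) q K)); last first.
  rewrite big_seq_cond [leRHS]big_seq_cond; apply: ler_sum => u' /andP[/(allP vA) vu' hi].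
  apply: q_noninc; first exact: leq_trans hi.
  by apply: ltnW; apply: jump_len_lt.
rewrite big_const_seq iter_addr_0 -[leRHS]mulr_natl; apply: ler_wpM2r.
  by apply/ltW/q_gt0; rewrite /K /n !muln_gt0 g_gt0.
rewrite ler_nat leq_subLR; apply: leq_trans rA _.
rewrite -(count_predC (fun u' => i0 <= jump_len g N s u u')%N) addnC leq_add2r.
rewrite -size_filter.
pose cn : int := (if s then - n%:Z else n%:Z) + (loc N u)%:Z.
pose f (u' : nat * nat) := absz ((loc N u')%:Z - cn + i0%:Z)%R.
have Hf u' : u' \in [seq u' <- A | predC (fun u' => i0 <= jump_len g N s u u')%N u'] ->
    vsite g N u' /\ (absz (cn - (loc N u')%:Z)%R < i0)%N.
  by rewrite mem_filter /= -ltnNge => /andP[h1 /(allP vA)].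
rewrite -(size_map f) -(size_iota 0 (2 * i0)); apply: uniq_leq_size.
  rewrite map_inj_in_uniq ?filter_uniq // => u1 u2 /Hf[v1 l1] /Hf[v2 l2]; rewrite /f => e.
  by apply: (loc_inj v1 v2); exact: close_eq l1 l2 e.
move=> x /mapP[u' /Hf[_ l1] ->]; rewrite mem_iota /f.
by rewrite add0n; exact: close_lt.
Qed.

Section Law.
Variable P : probability configT R.
Hypothesis law : is_perc_law K p eps p_ P.
Notation w := (weight P (embed g N)).

Lemma weight01 c : 0 <= w c <= 1. Proof. exact: open_prob01. Qed.

Lemma w_root_state v t i : w (coord_at v t (root_state i)) = p.
Proof. by case: law => _ _ _ /(_ (vtx g N false v (t, i))) Hp; rewrite /weight /open_prob [P _]Hp. Qed.

Lemma w_land_state v t i : w (coord_at v t (land_state i)) = p.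
Proof. by case: law => _ _ _ /(_ (vtx g N true v (t, i))) Hp; rewrite /weight /open_prob [P _]Hp. Qed.

Lemma w_vert_edge v t i : (t < g)%N -> (i < N)%N -> w (coord_at v t (vert_edge i)) = eps.
Proof.
move=> tg iN; have vk : vkind g N (vert_edge i) by rewrite /= iN.
have [//|e he ve] := @embed_edge g N (coord_at v t (vert_edge i)) tg vk.
case: law => _ /(_ e) Hp _ _; rewrite /weight /open_prob he [P _]Hp //.
rewrite ve /far_vtx /=; exists (pos v * n%:Z + (loc N (t, i))%:Z), (v.2%:Z), (v.2%:Z - 1).
by split; [rewrite subKr normr1|rewrite /vtx /= subr0].
Qed.

Lemma w_horizontal c (e : edge) i : embed g N c = inl e -> horizontal i (val e) ->
  (i0 <= i)%N -> (i <= K)%N -> q i <= w c.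
Proof.
move=> he hi i0i iK; case: law => _ _ /(_ i e (leq_trans i0_gt0 i0i) hi) Hp _.
by rewrite /weight /open_prob he [P _]Hp iK /=; apply: p_ge_q.
Qed.

Lemma w_tree_edge v t z y : (t < g)%N -> (z < N)%N -> (y < N)%N -> (m <= idist z y)%N ->
  q (idist z y) <= w (tree_coord v t z y).
Proof.
move=> tg zN yN md.
have zy : z != y.
  by apply: contraTneq md => ->; rewrite /idist subrr absz0 -ltnNge m_gt0.
have vk := vkind_tree_edge g zN yN zy.
have [e he ve] := @embed_edge g N (tree_coord v t z y) tg vk isT.
apply: (w_horizontal he).
- by rewrite idist_minmax ve; exact: horizontal_tree.
- exact: leq_trans md.
- apply: ltnW; apply: (leq_trans (idist_lt zN yN)); rewrite /K /n mulnA.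
  by rewrite leq_pmull // muln_gt0.
Qed.

Lemma w_jump_edge v s u u' : vsite g N u -> vsite g N u' -> (i0 <= jump_len g N s u u')%N ->
  q (jump_len g N s u u') <= w (coord_at v u.1 (jump_edge s u.2 u')).
Proof.
move=> vu vu' hi; have /andP[tg iN] := vu; have /andP[tg' iN'] := vu'.
have vk : vkind g N (jump_edge s u.2 u').
  by case: u' {vu' hi} tg' iN' => a b /= ? ?; case: (s); apply/and3P; split.
have [|e he ve] := @embed_edge g N (coord_at v u.1 (jump_edge s u.2 u')) tg vk; first by case: (s).
apply: (w_horizontal he) => //; last by apply: ltnW; apply: jump_len_lt.
rewrite ve /far_vtx; have := horizontal_jump g N v s u u'.
by case: u u' {vk vu vu' tg tg' iN iN' ve he hi} => [? ?] [? ?]; case: (s).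
Qed.

(** The origin is the root of the site (0, 0) of the block (0, 0), and it is
    good at height H with probability at least 1 / 4. *)
Lemma sees_all_prob H : (0 < H)%N -> ((1 / 4)%:E <= P (sees_all K (H * (depth + 2))%N))%E.
Proof.
move=> H0; pose om0 : coordT -> bool := fun=> false.
have indepP : independent_coords P by case: law.
have v00 : vsite g N (0, 0)%N by rewrite /vsite N_gt0 g_gt0.
pose F (o : coordT -> bool) := good g N M d depth r H (0, 0)%N (0, 0)%N o.
have dF : depends_on F (mem (coords g N H)).
  apply: (depends_sub (@good_dep g N M d depth r H H (0, 0)%N (0, 0)%N isT (leqnn _) v00)).
  by move=> c /and4P[c1 c2 c3 _]; rewrite inE mem_coords c1 c2 c3.
have ue : uniq (map (embed g N) (coords g N H)).
  by rewrite map_inj_in_uniq ?coords_uniq //; exact: embed_inj.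
have [mF PF] := P_dep indepP om0 ue dF.
apply: (@le_trans _ _ (P [set c | F (fun x => Defs.coord (embed g N x) c)])).
  rewrite PF lee_fin.
  apply: (@good_prob g N M d depth r R w p eps pm D J0 (1 / 216) m) => //.
  - exact: weight01.
  - by move=> *; exact: w_root_state.
  - by move=> *; exact: w_land_state.
  - by move=> *; exact: w_vert_edge.
  - move=> v t z X tg zN szX; apply: le_trans (deg_bound zN szX) _.
    rewrite [leRHS](bigID (fun y => (m <= idist z y)%N)) /= -[leLHS]addr0; apply: lerD.
      rewrite big_seq_cond [leRHS]big_seq_cond; apply: ler_sum => y /andP[].
      by rewrite mem_avail mem_iota => /andP[/andP[_ yN] _] md; apply: w_tree_edge.
    by apply: sumr_ge0 => y _; have /andP[] := weight01 (tree_coord v t z y).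
  - by apply: mulr_ge0; [rewrite ler0n|apply/ltW/q_gt0; rewrite /K /n !muln_gt0 g_gt0].
  - move=> v t i s A tg iN uA vA rA.
    have vu : vsite g N (t, i) by rewrite /vsite tg iN.
    apply: le_trans (jump_bound s vu uA vA rA) _.
    rewrite [leRHS](bigID (fun u' => (i0 <= jump_len g N s (t, i) u')%N)) /= -[leLHS]addr0.
    apply: lerD.
      rewrite big_seq_cond [leRHS]big_seq_cond; apply: ler_sum => u' /andP[/(allP vA) vu' hi].
      exact: (@w_jump_edge v s (t, i) u').
    by apply: sumr_ge0 => u' _; have /andP[] := weight01 (coord_at v t (jump_edge s i u')).
apply: le_measure; rewrite ?inE //; first exact: measurable_sees_all.
move=> c Fc xi sxi; have [s [Hs _]] := good_path v00 Fc sxi; exists s.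
have -> : (0, 0) = vtx g N false (0, 0)%N (0, 0)%N :> vertex; last exact: Hs.
by rewrite /vtx /pos /loc /= !mul0n mul0r.
Qed.

Lemma words_seen_pos : (0 < P [set c | words_seen K c = setT])%E.
Proof.
apply: (@lt_le_trans _ _ (1 / 4)%:E); first by rewrite lte_fin; lra.
apply: prob_words_seen => k; exists (k.+1 * (depth + 2))%N.
  by apply: (leq_trans (leqnSn k)); apply: leq_pmulr; rewrite addn2.
exact: sees_all_prob.
Qed.

End Law.
End Criterion.

(** * Numerical estimates *)

Section Numbers.
Variable R : realType.

(** From the bound of [prod_le_inv] with equal factors. *)
Lemma pow_small (x e : R) : 0 <= x < 1 -> 0 < e ->
  exists n0, forall n, (n0 <= n)%N -> x ^+ n <= e.
Proof.
move=> /andP[x0 x1] e0; set y := 1 - x; have y0 : 0 < y by rewrite /y; lra.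
have ey : 0 < e * y by exact: mulr_gt0.
have ey0 : 0 <= (e * y)^-1 by rewrite invr_ge0 ltW.
have := archi_boundP ey0; set n0 := Num.Def.archi_bound _ => Hn0.
exists n0 => n n0n.
have : \prod_(i <- iota 0 n) (1 - y) <= (1 + \sum_(i <- iota 0 n) y)^-1.
  by apply: prod_le_inv => i _; rewrite /y; apply/andP; split; lra.
rewrite !big_const_seq !count_predT size_iota iter_mulr_1 iter_addr_0.
have -> : 1 - y = x by rewrite /y; ring.
move=> /le_trans; apply.
have nn : (n0%:R : R) <= n%:R by rewrite ler_nat.
have : (e * y)^-1 * (e * y) = 1 by rewrite mulVf // gt_eqF.
move: (_^-1) Hn0 => z Hz zey.
have z0 : 0 <= n%:R * y by apply: mulr_ge0; rewrite ?ler0n // ltW.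
rewrite -[y *+ n]mulr_natl invf_ple ?posrE //; last by lra.
rewrite -[leLHS]mul1r ler_pdivrMr //.
have : z * (e * y) <= n%:R * (e * y) by apply: ler_wpM2r; lra.
lra.
Qed.

Lemma pow_le (x y : R) n : 0 <= x -> x <= y -> x ^+ n <= y ^+ n.
Proof. by move=> x0 xy; apply: lerXn2r => //; rewrite nnegrE //; apply: le_trans xy. Qed.

(** With tau the larger base, tau ^ h <= 1 / 32 gives tau ^ (h ^ 3) <= 32 ^ (-
    h ^ 2), which beats the factor 2 ^ (h ^ 2). *)
Lemma branching_const (p pm : R) : 0 < pm -> pm <= p -> pm <= 1 - p ->
  exists2 h : nat, (4 <= h)%N & 2 ^+ (h ^ 2) *
    ((1 - 3 / 8 * p) ^+ (h ^ 3) + (1 - 3 / 8 * (1 - p)) ^+ (h ^ 3)) <= 1 / 8 :> R.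
Proof.
move=> pm0 pmp pmp'; pose tau := 1 - 3 / 8 * pm.
have [||n0 Hn0] := @pow_small tau (1 / 32); [by rewrite /tau; apply/andP; split; lra|lra|].
exists (n0 + 4)%N; first by rewrite leq_addl.
set h := (n0 + 4)%N; have := Hn0 h (leq_addr _ _); set d := (h ^ 2)%N => tauh.
have tau0 : 0 <= tau by rewrite /tau; lra.
have taud : tau ^+ (h ^ 3) <= (1 / 32) ^+ d.
  by rewrite expnS exprM; apply: pow_le => //; exact: exprn_ge0.
have t1 : (1 - 3 / 8 * p) ^+ (h ^ 3) <= tau ^+ (h ^ 3) by apply: pow_le; rewrite /tau; lra.
have t2 : (1 - 3 / 8 * (1 - p)) ^+ (h ^ 3) <= tau ^+ (h ^ 3) by apply: pow_le; rewrite /tau; lra.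
have d1 : (1 <= d)%N by rewrite /d expn_gt0 /h addn4.
have P0 : 0 <= 2 ^+ d :> R by exact: exprn_ge0.
apply: (@le_trans _ _ (2 ^+ d * (2 * (1 / 32) ^+ d))).
  by apply: ler_wpM2l => //; lra.
rewrite mulrCA -exprMn.
have -> : 2 * (1 / 32) = 1 / 16 :> R by field.
case: d d1 {taud P0} => // d _; rewrite exprS.
have : (1 / 16) ^+ d <= 1 :> R by apply: exprn_ile1; lra.
move: (_ ^+ d) => x; lra.
Qed.

Lemma explore_cost_le M j : (2 <= M)%N -> (1 + explore_cost M j <= 2 * M ^ j)%N.
Proof.
move=> M2; suff : (explore_cost M j + 2 <= 2 * M ^ j)%N by lia.
elim: j => //= j IH; rewrite expnS.
have : (M * (explore_cost M j + 2) <= M * (2 * M ^ j))%N by rewrite leq_mul2l IH orbT.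
move: (explore_cost M j) (M ^ j)%N => a b; nia.
Qed.

(** The least L with s <= h ^ L. *)
Lemma depth_exists (h : nat) (s : R) : (2 <= h)%N -> 1 < s ->
  exists L, (h ^ L.-1)%:R < s <= (h ^ L)%:R.
Proof.
move=> h2 s1.
have ex : exists L, s <= (h ^ L)%:R.
  exists (Num.Def.archi_bound s); apply/ltW; apply: lt_trans (archi_boundP _) _; first by lra.
  by rewrite ltr_nat ltn_expl.
have [L sL minL] := ex_minnP ex; exists L; rewrite sL andbT.
case: L sL minL => [|L] sL minL; first by move: sL; rewrite expn0; lra.
by rewrite /= ltNge; apply/negP => /minL; rewrite ltnn.
Qed.

Section Sequences.
Variable q : nat -> R.
Hypothesis q_gt0 : forall i, (1 <= i)%N -> 0 < q i.
Hypothesis q_noninc : forall i j, (1 <= i)%N -> (i <= j)%N -> q j <= q i.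

(** Restricting edges to half a sub-block instead of half an interval costs
    the terms between N / 2 and g * N / 2, at most g * N / 2 terms bounded by
    q (N / 2). *)
Lemma tail_le m g N : (1 <= m)%N -> (4 <= N)%N ->
  \sum_(m <= i < (g * N %/ 2).+1) q i <=
  \sum_(m <= i < (N %/ 2).+1) q i + 4 * g%:R * ((N %/ 4)%:R * q (2 * (N %/ 4))%N).
Proof.
move=> m1 N4; set a := (N %/ 2).+1; set b := (g * N %/ 2).+1.
apply: (@le_trans _ _ (\sum_(i <- index_iota m a ++ index_iota a b) q i)).
  apply: ler_sum_subseq; first exact: iota_uniq.
    by move=> i; rewrite mem_cat !mem_index_iota; lia.
  by move=> i; rewrite mem_cat !mem_index_iota => H; apply/ltW/q_gt0; lia.
rewrite big_cat /= lerD2l.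
have N41 : (1 <= N %/ 4)%N by lia.
apply: (@le_trans _ _ (\sum_(i <- index_iota a b) q (2 * (N %/ 4))%N)).
  rewrite big_seq [leRHS]big_seq; apply: ler_sum => i; rewrite mem_index_iota => H.
  by apply: q_noninc; rewrite /a in H; lia.
rewrite big_const_seq count_predT iter_addr_0 size_iota -[leLHS]mulr_natl mulrA.
apply: ler_wpM2r; first by apply/ltW/q_gt0; lia.
rewrite -!natrM ler_nat /a /b.
suff : (g * N %/ 2 <= 4 * g * (N %/ 4))%N by lia.
have : (N <= 8 * (N %/ 4))%N by lia.
move: (N %/ 4)%N => x Nx; have : (g * N <= g * (8 * x))%N by rewrite leq_mul2l Nx orbT.
have -> : (g * (8 * x) = (4 * g * x) * 2)%N by lia.
by move=> H; rewrite -(mulnK (4 * g * x) (ltn0Sn 1)); apply: leq_div2r.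
Qed.

Lemma mq_le m k0 : (1 <= k0)%N -> (2 * k0 <= m)%N ->
  (forall k, (k0 <= k)%N -> k%:R * q (2 * k)%N <= 1 / 3) -> m%:R * q m <= 1.
Proof.
move=> k01 km H; have kk : (k0 <= m %/ 2)%N by lia.
have := H _ kk; have : q m <= q (2 * (m %/ 2))%N by apply: q_noninc; lia.
have : (m%:R : R) <= 3 * (m %/ 2)%:R by rewrite -natrM ler_nat; lia.
have : 0 <= q m by apply/ltW/q_gt0; lia.
have : 0 <= (m %/ 2)%:R :> R by rewrite ler0n.
move: (q m) (q _) (m%:R) ((m %/ 2)%:R) => a b x y *; nra.
Qed.
End Sequences.

(** Here x stands for n * q (2 * n), so that h ^ L >= 1 / x: the expected
    number of open jumps is at least a constant times h ^ (2 * L) * x, hence a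
    constant times h ^ L >= 2 ^ L * 2 ^ L, and beats the number 2 ^ L of
    words. *)
Lemma jump_num (h L g N r' : nat) (mu x qn : R) : (4 <= h)%N -> (0 < g)%N -> (0 < N)%N ->
  0 < mu -> 0 < x -> qn = x / (g * N)%N%:R -> x^-1 <= (h ^ L)%:R ->
  mu / 8 * N%:R <= r'%:R -> 128 * g%:R <= mu * (2 ^ L)%:R ->
  (2 ^ L * 4)%:R * (1 + ((h ^ 2) ^ L)%:R * (r'%:R * qn))^-1 <= 1 / 4.
Proof.
move=> h4 g0 N0 mu0 x0 -> xh rN Lg.
have gR : 0 < g%:R :> R by rewrite ltr0n.
have NR : 0 < N%:R :> R by rewrite ltr0n.
set A : R := (h ^ L)%:R; set T : R := (2 ^ L)%:R.
have T0 : 0 < T by rewrite ltr0n expn_gt0.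
have AT : T * T <= A.
  by rewrite -natrM -expnMn ler_nat; case: (L) => // L'; rewrite leq_exp2r.
have Ax : 1 <= A * x by rewrite -(mulVf (lt0r_neq0 x0)); apply: ler_wpM2r => //; exact: ltW.
have -> : ((h ^ 2) ^ L)%:R = A * A :> R by rewrite /A -natrM -expnMn mulnn.
have main : 16 * T <= A * A * (r'%:R * (x / (g * N)%N%:R)).
  apply: (@le_trans _ _ (A * A * ((mu / 8 * N%:R) * (x / (g * N)%N%:R)))); last first.
    apply: ler_wpM2l; first by apply: mulr_ge0; rewrite ler0n.
    by apply: ler_wpM2r rN; apply: divr_ge0; rewrite ?ler0n // ltW.
  have -> : A * A * ((mu / 8 * N%:R) * (x / (g * N)%N%:R)) = (A * x) * (A * mu / (8 * g%:R)).
    by rewrite natrM; field; rewrite !gt_eqF.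
  apply: (@le_trans _ _ (1 * (A * mu / (8 * g%:R)))); last first.
    by apply: ler_wpM2r => //; rewrite divr_ge0 ?mulr_ge0 ?ler0n // ltW.
  rewrite mul1r ler_pdivlMr; last by apply: mulr_gt0.
  apply: (@le_trans _ _ (T * T * mu)); last by apply: ler_wpM2r => //; exact: ltW.
  have : T * (128 * g%:R) <= T * (mu * T) by apply: ler_wpM2l => //; exact: ltW.
  by move: (g%:R) T mu {AT Lg rN T0 mu0 gR} => *; lra.
rewrite natrM -/T; rewrite ler_pdivrMr; first by lra.
by lra.
Qed.

End Numbers.

(** * Choice of the scale *)

Section Scales.
Variable R : realType.

(** As h ^ (L - 1) < 1 / x, an exploration to depth L uses at most 2 * h ^ 3 /
    x ^ 3 vertices. *)
Lemma budget_le (h L m : nat) (x : R) : (4 <= h)%N -> 0 < x ->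
  (h ^ L.-1)%:R < x^-1 -> (0 < L)%N ->
  (2 * h ^ 3)%N%:R * x ^- 3 <= m%:R -> (1 + explore_cost (h ^ 3) L <= m)%N.
Proof.
move=> h4 x0 hx L0 cm; apply: leq_trans (explore_cost_le L _) _.
  by apply: (leq_trans (leq_trans _ h4)) => //; rewrite -{1}(expn1 h) leq_pexp2l //; lia.
rewrite -(ler_nat R); apply: le_trans cm; case: L L0 hx => // L _ /= hx.
have -> : (2 * (h ^ 3) ^ L.+1 = 2 * h ^ 3 * (h ^ L) ^ 3)%N.
  by rewrite expnS mulnA -!expnM (mulnC 3).
rewrite natrM; apply: ler_wpM2l; first exact: ler0n.
rewrite natrX -exprVn; apply: lerXn2r; rewrite ?nnegrE ?ler0n //.
  by rewrite invr_ge0 ltW.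
exact: ltW.
Qed.

Lemma common_bound (a b c e : nat) :
  exists N, [/\ (a <= N)%N, (b <= N)%N, (c <= N %/ 4)%N, (e <= N)%N & (4 <= N)%N].
Proof. by exists (a + b + 4 * c + 4 + e)%N; split; lia. Qed.

Lemma sum_bounds (a b c : nat) : [/\ (a <= a + b + c + 2)%N, (b <= a + b + c + 2)%N,
  (c <= a + b + c + 2)%N & (1 < a + b + c + 2)%N].
Proof. by split; lia. Qed.

End Scales.

Theorem theorem3 (R : realType) (q p_ : nat -> R)
    (q_gt0 : forall n : nat, (1 <= n)%N -> 0 < q n)
    (q_noninc : forall m n : nat, (1 <= m)%N -> (m <= n)%N -> q n <= q m)
    (q_small : (fun n : nat => n%:R * q (2 * n)%N) @ \oo --> (0 : R))
    (p_01 : forall i : nat, (1 <= i)%N -> 0 <= p_ i <= 1)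
    (p_ge_q : exists2 i0 : nat, (1 <= i0)%N &
       forall i : nat, (i0 <= i)%N -> q i <= p_ i)
    (q_div : forall c : R, 0 < c ->
       (fun n : nat =>
          \sum_(`|Num.ceil (c * beta q n)|%N <= i < (n %/ 2).+1) q i)
         @ \oo --> +oo) :
  forall p eps : R, 0 < p < 1 -> 0 < eps <= 1 ->
  exists2 K : nat, (1 <= K)%N &
    forall P : probability configT R, is_perc_law K p eps p_ P ->
      (0 < P [set c | words_seen K c = setT])%E.
Proof.
move=> p eps p01 eps01; have [i0 i0_gt0 p_ge] := p_ge_q.
have [p0 p1] := andP p01; have [e0 e1] := andP eps01.
have small e : 0 < e -> exists n0, forall n, (n0 <= n)%N -> n%:R * q (2 * n)%N < e.
  move=> e_gt0; have /cvgr0Pnorm_lt/(_ _ e_gt0)[n0 _ Hn0] := q_small.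
  by exists n0 => n /Hn0; apply: le_lt_trans; exact: ler_norm.
pose pm := Num.min p (1 - p).
have pm0 : 0 < pm by rewrite lt_min p0 subr_gt0.
have pmp : pm <= p by rewrite ge_min lexx.
have pmp' : pm <= 1 - p by rewrite ge_min lexx orbT.
have [h h4 Hh] := branching_const pm0 pmp pmp'.
(* A root is climbed to and has given states with probability at least mu. *)
pose mu := eps * pm ^+ 2.
have mu0 : 0 < mu by apply: mulr_gt0 => //; exact: exprn_gt0.
have mu1 : mu <= 1.
  rewrite -[1]mulr1; apply: ler_pM => //; [exact: ltW|exact: exprn_ge0 (ltW _)|].
  by apply: exprn_ile1; [exact: ltW|lra].
(* 4 * (1 / 864) = 1 / 216, the admissible failure probability. *)
have [||g0 Hg0] := @pow_small R (1 - mu / 4) (1 / 864); [by apply/andP; split; lra|lra|].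
pose g := g0.+1; have Hg := Hg0 g (leqnSn _).
have [L0 HL0] : exists L0, 128 * g%:R <= mu * (2 ^ L0)%:R.
  have b0 : 0 <= 128 * g%:R / mu by apply: divr_ge0; [apply: mulr_ge0|exact: ltW].
  exists (Num.Def.archi_bound (128 * g%:R / mu)).
  rewrite [leRHS]mulrC -ler_pdivrMr //; apply: ltW; apply: lt_trans (archi_boundP b0) _.
  by rewrite ltr_nat ltn_expl.
have [k0' Hk0'] : exists n0, forall n, (n0 <= n)%N -> n%:R * q (2 * n)%N < 1 / 3.
  by apply: small; lra.
pose k0 := k0'.+1.
(* s0 is a lower bound for s = x^-1, hence for m. *)
have [] := sum_bounds (2 * k0) i0 (h ^ L0); set s0 := (_ + 2)%N => ks0 is0 hs0 s0_gt1.
have s0_gt0 : 0 < s0%:R :> R by rewrite ltr0n ltnW.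
have [n1 Hn1] : exists n0, forall n, (n0 <= n)%N -> n%:R * q (2 * n)%N < s0%:R^-1.
  by apply: small; rewrite invr_gt0.
pose M := (h ^ 3)%N; pose d := (h ^ 2)%N; pose D : R := (2 ^ (M + 4))%:R.
pose cc : R := (2 * h ^ 3)%N%:R.
have h30 : (0 < h ^ 3)%N by rewrite expn_gt0; apply/orP; left; apply: leq_trans h4.
have cc0 : 0 < cc by rewrite ltr0n muln_gt0.
have [n2 _ Hn2] : \forall n \near \oo, D + 2 <=
    \sum_(`|Num.ceil (cc * beta q n)|%N <= i < (n %/ 2).+1) q i.
  by have /cvgryPge := q_div cc cc0; apply.
have [n3 Hn3] : exists n0, forall n, (n0 <= n)%N -> n%:R * q (2 * n)%N < (4 * g%:R)^-1.
  by apply: small; rewrite invr_gt0; apply: mulr_gt0; rewrite ?ltr0n.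
have y0 : 0 <= (1 + 2 * i0%:R) / (mu / 8).
  by apply: divr_ge0; [rewrite addr_ge0 // mulr_ge0|lra].
pose n4 := Num.Def.archi_bound ((1 + 2 * i0%:R) / (mu / 8)).
have Hn4 := archi_boundP y0; rewrite -/n4 in Hn4.
have [N [N1 N2 nn3 Nn4 N4]] := common_bound n1 n2 n3 n4; pose n := (g * N)%N.
have nN : (N <= n)%N by rewrite /n leq_pmull.
have nn1 : (n1 <= n)%N by apply: leq_trans nN.
have nn2 : (n2 <= n)%N by apply: leq_trans nN.
have N0 : (0 < N)%N by apply: leq_trans N4.
have n0 : (0 < n)%N by apply: leq_trans nN.
(* The scale: s = x^-1 and beta q n = s ^ 3. *)
pose x : R := n%:R * q (2 * n)%N.
have x0 : 0 < x by apply: mulr_gt0; rewrite ?ltr0n // q_gt0 // muln_gt0.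
have sx : s0%:R < x^-1.
  by rewrite -[s0%:R]invrK ltf_pV2 ?posrE ?invr_gt0 //; exact: Hn1.
(* Edges shorter than m are discarded; m is also the budget of an exploration.
   *)
pose m := `|Num.ceil (cc * beta q n)|%N.
have betaE : beta q n = x ^- 3 by [].
have cm : cc * x ^- 3 <= m%:R.
  rewrite -betaE /m natr_absz; apply: le_trans (ceil_ge _) _.
  by rewrite ler_int; exact: ler_norm.
have s1 : 1 < x^-1 by apply: lt_trans sx; rewrite ltr1n.
have s0m : (s0 <= m)%N.
  rewrite -(ler_nat R); apply: le_trans cm; apply: le_trans (ltW sx) _.
  rewrite -[leLHS]mul1r; apply: ler_pM => //; first by rewrite invr_ge0 ltW.
    by rewrite ler1n muln_gt0.
  by rewrite -exprVn; apply: ler_eXnr; [|exact: ltW].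
have [L /andP[hL1 hL]] : exists L, (h ^ L.-1)%:R < x^-1 <= (h ^ L)%:R.
  by apply: depth_exists => //; apply: leq_trans h4.
have LL0 : (L0 < L)%N.
  have : (h ^ L0)%:R < (h ^ L)%:R :> R.
    by apply: lt_le_trans hL; apply: le_lt_trans sx; rewrite ler_nat.
  by rewrite ltr_nat ltn_exp2l //; apply: leq_trans h4.
pose y := mu / 4 * N%:R.
have y_ge0 : 0 <= y by apply: mulr_ge0; [lra|exact: ler0n].
pose r := Num.trunc y; have /andP[ry1 ry2] := truncn_itv y_ge0.
have yN : 1 + 2 * i0%:R <= mu / 8 * N%:R.
  rewrite [leRHS]mulrC -ler_pdivrMr; last by lra.
  by apply: (le_trans (ltW Hn4)); rewrite ler_nat.
have i00 : 0 <= i0%:R :> R by exact: ler0n.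
have r_large : (2 * i0 <= r)%N.
  rewrite -ltnS -(ltr_nat R) natrM; apply: le_lt_trans ry2.
  by rewrite /y; lra.
have rN : mu / 8 * N%:R <= (r - 2 * i0)%N%:R.
  rewrite natrB // natrM; move: ry2; rewrite -natr1 -/r /y; lra.
have k01 : (1 <= k0)%N by [].
have mq : m%:R * q m <= 1.
  apply: (mq_le q_gt0 q_noninc k01).
    by apply: leq_trans s0m.
  by move=> k kk; apply/ltW/Hk0'; apply: ltnW.
have i0m : (i0 <= m)%N by apply: leq_trans s0m.
have m1 : (1 <= m)%N by apply: leq_trans i0m.
(* Each of the two losses, on long edges and on excluded vertices, is at most
   1. *)
have deg : D <= \sum_(m <= i < (N %/ 2).+1) q i - m%:R * q m.
  have /= := Hn2 n nn2; rewrite -/m => Hsum.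
  have := le_trans Hsum (tail_le q_gt0 q_noninc g m1 N4).
  have : 4 * g%:R * ((N %/ 4)%:R * q (2 * (N %/ 4))%N) <= 1.
    have g4 : 0 < 4 * g%:R :> R by apply: mulr_gt0; rewrite ?ltr0n.
    rewrite -[leRHS](mulfV (lt0r_neq0 g4)); apply: ler_wpM2l; first exact: ltW.
    exact/ltW/Hn3.
  lra.
exists (2 * (g * N))%N; first by rewrite !muln_gt0.
move=> P law.
apply: (@words_seen_pos R q p_ p eps pm D g N M d L r m i0) => //.
- by apply: budget_le cm => //; apply: leq_ltn_trans LL0.
- apply: (@jump_num R h L g N _ mu x) => //.
    rewrite -/n /x mulrAC mulfV ?mul1r //; by rewrite pnatr_eq0 -lt0n.
  apply: le_trans HL0 _; apply: ler_wpM2l; first exact: ltW.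
  by rewrite ler_nat leq_exp2l // ltnW.
- by rewrite -/mu; lra.
Qed.
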